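(* The Weil-Petersson curvature operator $\tilde Q$ on $T_H(1)$ is not a compact operator; more specifically, the set of spectra of $\tilde Q$ (the spectrum of $\tilde Q$, as a set) is not discrete on the interval $[-16\sqrt{3/\pi},\,0)$.
   Context: Setting. $\mathbb D$ is the unit disk with hyperbolic metric $\rho(z)|dz|^2$, $\rho(z)=\frac{4}{(1-|z|^2)^2}$, area element $dA=\rho|dz|^2$ ($|dz|^2$ is Lebesgue measure), Laplacian $\Delta_\rho=\frac{4}{\rho}\partial_z\partial_{\bar z}$. $D=-2(\Delta_\rho-2)^{-1}$: for a bounded smooth $f$, $D(f)$ is the bounded smooth solution $u$ of $(\Delta_\rho-2)u=-2f$; it is given by a Green's function, $D(f)(z)=\int_{\mathbb D}G(z,w)f(w)\,dA(w)$, with $G>0$, $G(z,w)=G(w,z)$, $\int_{\mathbb D}G(z,w)\,dA(w)=1$. $H^{-1,1}(\mathbb D)$ is the complex Hilbert space of functions $\nu=\bar q/\rho$ with $q$ holomorphic on $\mathbb D$ and $\int_{\mathbb D}|q|^2\rho^{-1}|dz|^2<\infty$, with inner product $\langle\mu,\nu\rangle=\int_{\mathbb D}\mu\bar\nu\,dA$. It has the orthonormal basis $\mu_{n-1}(z)=\frac{(1-|z|^2)^2}{4}\sqrt{\frac{2n^3-2n}{\pi}}\,\bar z^{\,n-2}$, $n\ge2$. $T_H(1)$ is the universal Teichmüller space with the Takhtajan–Teo Hilbert manifold structure: a complex Hilbert manifold whose holomorphic tangent space at each point $P$ is identified with $H^{-1,1}(\mathbb D)$, the Weil-Petersson metric at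 $P$ being the inner product $\langle\mu,\nu\rangle=\int_{\mathbb D}\mu\bar\nu\,dA$ on $H^{-1,1}(\mathbb D)$. Near $P$ take holomorphic coordinates $t_i=x_i+\mathbf i y_i$ ($i\ge1$) with $\frac{\partial}{\partial t_i}|_P=\mu_i$; $\frac{\partial}{\partial x_i}=\frac{\partial}{\partial t_i}+\frac{\partial}{\partial\bar t_i}$, $\frac{\partial}{\partial y_i}=\mathbf i\big(\frac{\partial}{\partial t_i}-\frac{\partial}{\partial\bar t_i}\big)$. The real tangent space has orthonormal basis $\{\frac{\partial}{\partial x_i},\frac{\partial}{\partial y_i}\}_{i\ge1}$ at $P$. The curvature tensor $R$ of this Kähler metric, extended complex multilinearly, has the usual Riemannian symmetries (antisymmetric in the first two and in the last two arguments, symmetric under exchanging the two pairs), vanishes when its first two arguments (or its last two) are both of type $(1,0)$ or both of type $(0,1)$, and satisfies $R_{i\bar jk\bar\ell}=R(\frac{\partial}{\partial t_i},\frac{\partial}{\partial\bar t_j},\frac{\partial}{\partial t_k},\frac{\partial}{\partial\bar t_\ell})=\int_{\mathbb D}D(\mu_i\bar\mu_j)\mu_k\bar\mu_\ell\,dA+\int_{\mathbb D}D(\mu_i\bar\mu_\ell)\mu_k\bar\mu_j\,dA$. $\wedge^2TT_H(1)$ (at $P$) is the real Hilbert space spanned by $\frac{\partial}{\partial x_i}\wedge\frac{\partial}{\partial x_j}$, $\frac{\partial}{\partial x_i}\wedge\frac{\partial}{\partial y_j}$, $\frac{\partial}{\partial y_i}\wedge\frac{\partial}{\partial y_j}$ (closed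 span, square-summable coefficients), with inner product $\langle V_1\wedge V_2,V_3\wedge V_4\rangle_{eu}=\langle V_1,V_3\rangle\langle V_2,V_4\rangle-\langle V_1,V_4\rangle\langle V_2,V_3\rangle$. The curvature operator $\tilde Q$ is the symmetric bilinear form with $\tilde Q(V_1\wedge V_2,V_3\wedge V_4)=R(V_1,V_2,V_3,V_4)$ for real tangent vectors, extended bilinearly (and to infinite sums as the limit over truncations $i,j\le N$, $N\to\infty$). It is bounded, with $-16\sqrt{3/\pi}\,\|V\|_{eu}^2\le\tilde Q(V,V)\le0$, and is identified with the self-adjoint operator on $\wedge^2TT_H(1)$ determined by $\langle\tilde Q(V),W\rangle_{eu}=\tilde Q(V,W)$; compactness and spectrum refer to this operator. *)

(* Defs.v *)
From HB Require Import structures.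
From mathcomp Require Import all_boot all_order all_algebra.
From mathcomp Require Import all_classical all_reals all_analysis.
From mathcomp Require Import complex ring lra.
Set Implicit Arguments.
Unset Strict Implicit.
Unset Printing Implicit Defensive.
Import Order.TTheory GRing.Theory Num.Theory.
Import numFieldNormedType.Exports.

Local Open Scope classical_set_scope.
Local Open Scope ring_scope.

(** * The real Hilbert space of square-summable families *)

Section Ell2.
Context (R : realType) (I : choiceType).

Definition sqsum (f : I -> R) : \bar R := \esum_(i in setT) (f i ^+ 2)%:E.

Definition sqsummable : {pred I -> R} := [pred f | `[< (sqsum f < +oo)%E >]].

Lemma sqsum_ge0 f : (0 <= sqsum f)%E.
Proof. by apply: esum_ge0 => i _; rewrite lee_fin sqr_ge0. Qed.

Lemma sqsumZ (a : R) f : sqsum (a *: f) = ((a ^+ 2)%:E * sqsum f)%E.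
Proof.
have [->|a0] := eqVneq a 0.
  rewrite expr0n /= mul0e; apply: esum1 => i _.
  by rewrite fctE /= scale0r expr0n.
have ineq (b : R) g : b != 0 -> (sqsum (b *: g)%R <= (b ^+ 2)%:E * sqsum g)%E.
  move=> b0; apply: ge_ereal_sup => _ [A [fA _] <-].
  under eq_fsbigr do rewrite fctE /= exprMn EFinM.
  rewrite -ge0_mule_fsumr; last by move=> i; rewrite lee_fin sqr_ge0.
  apply: lee_wpmul2l; first by rewrite lee_fin sqr_ge0.
  by apply: ereal_sup_ubound; exists A.
apply/eqP; rewrite eq_le ineq //=.
have := ineq a^-1 (a *: f); rewrite invr_eq0 => /(_ a0).
rewrite scalerA mulVf // scale1r => h.
have a2 : (0%:E <= (a ^+ 2)%:E)%E by rewrite lee_fin sqr_ge0.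
have := lee_wpmul2l a2 h.
by rewrite muleA -EFinM -exprMn divff // expr1n mul1e.
Qed.

Lemma sqsumD_young (t : R) f g : 0 < t ->
  (sqsum (f + g)%R <= (1 + t)%:E * sqsum f + (1 + t^-1)%:E * sqsum g)%E.
Proof.
move=> t0; apply: ge_ereal_sup => _ [A [fA _] <-].
have t1 : 0 <= 1 + t by rewrite addr_ge0 // ltW.
have t2 : 0 <= 1 + t^-1 by rewrite addr_ge0 // invr_ge0 ltW.
apply: (@le_trans _ _
  (\sum_(i \in A) ((1 + t)%:E * (f i ^+ 2)%:E + (1 + t^-1)%:E * (g i ^+ 2)%:E))%E).
  rewrite !fsbig_finite //=; apply: lee_sum => i _.
  rewrite -!EFinM -EFinD lee_fin fctE -subr_ge0.
  set s := Num.sqrt t.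
  have s0 : s != 0 by rewrite gt_eqF // sqrtr_gt0.
  have -> : t = s ^+ 2 by rewrite sqr_sqrtr // ltW.
  rewrite (_ : _ - _ = (s * f i - s^-1 * g i) ^+ 2) ?sqr_ge0 //.
  by field; rewrite s0.
rewrite fsbig_split //=; apply: leeD.
  rewrite -ge0_mule_fsumr; last by move=> i; rewrite lee_fin sqr_ge0.
  by apply: lee_wpmul2l; rewrite ?lee_fin //; apply: ereal_sup_ubound; exists A.
rewrite -ge0_mule_fsumr; last by move=> i; rewrite lee_fin sqr_ge0.
by apply: lee_wpmul2l; rewrite ?lee_fin //; apply: ereal_sup_ubound; exists A.
Qed.

Lemma sqsummable_submod : submod_closed sqsummable.
Proof.
split.
  apply/asboolP; rewrite /sqsum esum1 ?ltry // => i _.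
  by rewrite [X in X ^+ 2](_ : _ = 0) ?expr0n.
move=> a f g /asboolP hf /asboolP hg; apply/asboolP.
apply: le_lt_trans (sqsumD_young _ _ (@ltr01 R)) _.
apply: lte_add_pinfty; apply: lte_mul_pinfty => //; rewrite ?lee_fin.
by rewrite sqsumZ lte_mul_pinfty // lee_fin sqr_ge0.
Qed.

HB.instance Definition _ := GRing.isSubmodClosed.Build _ _ sqsummable
  sqsummable_submod.

Record ell2 := Ell2 { ell2_fun :> I -> R; _ : ell2_fun \in sqsummable }.

HB.instance Definition _ := [isSub for ell2_fun].
HB.instance Definition _ := [Choice of ell2 by <:].
HB.instance Definition _ := [SubChoice_isSubLmodule of ell2 by <:].

Definition ell2_norm (f : ell2) : R := Num.sqrt (fine (sqsum f)).

Lemma ell2_normE (f : ell2) : sqsum f = (ell2_norm f ^+ 2)%:E.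
Proof.
have /asboolP hf : ell2_fun f \in sqsummable by case: f.
rewrite /ell2_norm sqr_sqrtr ?fine_ge0 ?sqsum_ge0 // fineK //.
by rewrite ge0_fin_numE // sqsum_ge0.
Qed.

Lemma ell2_norm_ge0 f : 0 <= ell2_norm f. Proof. exact: sqrtr_ge0. Qed.

Lemma ell2_norm0_eq0 f : ell2_norm f = 0 -> f = 0.
Proof.
move=> f0; apply/val_inj/funext => i /=.
have : ((f i ^+ 2)%:E <= sqsum f)%E.
  rewrite -(@esum_set1 _ _ i (fun j => (f j ^+ 2)%:E)) ?lee_fin ?sqr_ge0 //.
  apply: ereal_sup_ubound; exists [set i]; first by split.
  by rewrite esum_set1 ?lee_fin ?sqr_ge0 // fsbig_set1.
rewrite ell2_normE f0 expr0n /= lee_fin => h.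
by apply/eqP; rewrite -sqrf_eq0 eq_le h sqr_ge0.
Qed.

Lemma ell2_normZ (a : R) f : ell2_norm (a *: f) = `|a| * ell2_norm f.
Proof.
apply/eqP; rewrite -(@eqrXn2 _ 2) ?ell2_norm_ge0 ?mulr_ge0 ?ell2_norm_ge0 //.
rewrite exprMn real_normK ?num_real //; have := sqsumZ a f.
by rewrite -[LHS]/(sqsum (a *: f)%R) !ell2_normE -EFinM => -[->].
Qed.

Lemma ell2_normD f g : ell2_norm (f + g) <= ell2_norm f + ell2_norm g.
Proof.
have [/ell2_norm0_eq0 ->|f0] := eqVneq (ell2_norm f) 0.
  by rewrite add0r ler_wpDl ?ell2_norm_ge0.
have [/ell2_norm0_eq0 ->|g0] := eqVneq (ell2_norm g) 0.
  by rewrite addr0 ler_wpDr ?ell2_norm_ge0.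
have {}f0 : 0 < ell2_norm f by rewrite lt0r f0 ell2_norm_ge0.
have {}g0 : 0 < ell2_norm g by rewrite lt0r g0 ell2_norm_ge0.
rewrite -(@ler_pXn2r _ 2) ?nnegrE ?addr_ge0 ?ell2_norm_ge0 //.
have := @sqsumD_young (ell2_norm g / ell2_norm f) f g (divr_gt0 g0 f0).
rewrite -[X in (sqsum X <= _)%E]/(ell2_fun (f + g)%R) !ell2_normE.
rewrite -!EFinM -EFinD lee_fin => /le_trans; apply.
rewrite le_eqVlt; apply/orP; left; apply/eqP.
by field; rewrite !gt_eqF.
Qed.

HB.instance Definition _ := @Lmodule_isNormed.Build R ell2
  ell2_norm ell2_normD ell2_normZ ell2_norm0_eq0.

End Ell2.

(** * Operators on a real normed space *)

Section Operators.
Context (R : realType) (V : normedModType R).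

Definition compact_operator (T : V -> V) :=
  forall B : set V, bounded_set B -> precompact (T @` B).

(* For a self-adjoint operator on a real Hilbert space the spectrum of the
   complexification is real, hence equal to this set. *)
Definition spectrum (T : V -> V) : set R :=
  [set l | ~ exists S : {linear V -> V},
     [/\ continuous S, cancel (fun v => T v - l *: v) S
       & cancel S (fun v => T v - l *: v)]].

End Operators.

Definition discrete_set (T : topologicalType) (A : set T) := A `<=` isolated A.

(** * The hyperbolic disk; a point z = x + i y is given as p = (x, y) *)

Section Disk.
Context (R : realType).
Local Notation C := R[i].
Local Notation imag := ('i%C : C).

Definition zof (p : R * R) : C := (p.1 +i* p.2)%C.
Definition sqmod (p : R * R) : R := p.1 ^+ 2 + p.2 ^+ 2.
Definition disk : set (R * R) := [set p | sqmod p < 1].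

Definition rho (p : R * R) : R := 4 / (1 - sqmod p) ^+ 2.

Definition integral_dA (f : R * R -> C) : C :=
  let leb2 := (@lebesgue_measure R \x @lebesgue_measure R)%E in
  ((\int[leb2]_(p in disk) (complex.Re (f p) * rho p)) +i*
   (\int[leb2]_(p in disk) (complex.Im (f p) * rho p)))%C.

Definition dirx : R * R := (1, 0).
Definition diry : R * R := (0, 1).

Fixpoint Ck (k : nat) (u : R * R -> R) : Prop :=
  (forall p, disk p -> {for p, continuous u}) /\
  if k is k'.+1 then
    [/\ forall p, disk p -> derivable u p dirx /\ derivable u p diry,
        Ck k' (fun p => 'D_dirx u p) & Ck k' (fun p => 'D_diry u p)]
  else True.

Definition smooth_on_disk (u : R * R -> C) :=
  forall k, Ck k (fun p => complex.Re (u p)) /\ Ck k (fun p => complex.Im (u p)).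

Definition bounded_on_disk (u : R * R -> C) :=
  exists M : R, forall p, disk p -> `|u p| <= M%:C%C.

Definition partial (v : R * R) (u : R * R -> C) (p : R * R) : C :=
  ('D_v (fun q => complex.Re (u q)) p +i* 'D_v (fun q => complex.Im (u q)) p)%C.

Definition d_z (u : R * R -> C) p : C := (partial dirx u p - imag * partial diry u p) / 2.
Definition d_zbar (u : R * R -> C) p : C := (partial dirx u p + imag * partial diry u p) / 2.

Definition laplacian (u : R * R -> C) p : C :=
  (4 / rho p)%:C%C * d_z (d_zbar u) p.

Definition is_opD (f u : R * R -> C) :=
  [/\ smooth_on_disk u, bounded_on_disk u
    & forall p, disk p -> laplacian u p - 2 * u p = - 2 * f p].

(* D = -2 (Delta_rho - 2)^{-1}.  Only the values on the disk are meaningful: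
   they are determined by is_opD when f is bounded and smooth. *)
Definition opD (f : R * R -> C) : R * R -> C := xget (fun=> 0) [set u | is_opD f u].

(* The orthonormal basis of H^{-1,1}(D), the holomorphic tangent space of T_H(1).
   mu k is mu_{k+1}, i.e. mu_{n-1} with n = k + 2: the indices i >= 1 of the
   coordinates t_i are shifted to start at 0. *)
Definition mu (k : nat) (p : R * R) : C :=
  let n : R := k.+2%:R in
  ((1 - sqmod p) ^+ 2 / 4 * Num.sqrt ((2 * n ^+ 3 - 2 * n) / pi))%:C%C
  * ((zof p)^*%C) ^+ k.

(** * Curvature tensor *)

(* R(d/dt_i, d/dtbar_j, d/dt_k, d/dtbar_l) *)
Definition curv_t (i j k l : nat) : C :=
  integral_dA (fun p => opD (fun q => mu i q * (mu j q)^*%C) p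
                        * (mu k p * (mu l p)^*%C))
  + integral_dA (fun p => opD (fun q => mu i q * (mu l q)^*%C) p
                          * (mu k p * (mu j p)^*%C)).

(* The tensor on the frame of the complexified tangent space: (false, i) stands
   for d/dt_i and (true, i) for d/dtbar_i. *)
Definition curv_c (a b c d : bool * nat) : C :=
  match a, b, c, d with
  | (false, i), (true, j), (false, k), (true, l) => curv_t i j k l
  | (false, i), (true, j), (true, k), (false, l) => - curv_t i j l k
  | (true, i), (false, j), (false, k), (true, l) => - curv_t j i k l
  | (true, i), (false, j), (true, k), (false, l) => curv_t j i l k
  | _, _, _, _ => 0
  end.

(* Orthonormal basis of the real tangent space: inl i is d/dx_i, inr i d/dy_i. *)
Definition frame := (nat + nat)%type.

Definition frame_idx (e : frame) : nat := match e with inl k => k | inr k => k end.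

(* d/dx_i = d/dt_i + d/dtbar_i and d/dy_i = i (d/dt_i - d/dtbar_i) *)
Definition frame_coef (e : frame) (s : bool) : C :=
  match e, s with
  | inl _, _ => 1
  | inr _, false => imag
  | inr _, true => - imag
  end.

(* Complex multilinear expansion; the value on real vectors is real. *)
Definition curv (a b c d : frame) : R :=
  complex.Re (\sum_(s1 : bool) \sum_(s2 : bool) \sum_(s3 : bool) \sum_(s4 : bool)
    frame_coef a s1 * frame_coef b s2 * frame_coef c s3 * frame_coef d s4
    * curv_c (s1, frame_idx a) (s2, frame_idx b) (s3, frame_idx c) (s4, frame_idx d)).

(** * The space of bivectors and the curvature operator *)

Definition before (a b : frame) : bool :=
  match a, b with
  | inl i, inl j => (i < j)%N
  | inl _, inr _ => true
  | inr _, inl _ => false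
  | inr i, inr j => (i < j)%N
  end.

(* The bivectors d/dx_i /\ d/dx_j (i < j), d/dx_i /\ d/dy_j, and
   d/dy_i /\ d/dy_j (i < j): they are orthonormal for < , >_eu and span. *)
Definition wedge_basis := {p : frame * frame | before p.1 p.2}.

(* Coordinates in that orthonormal basis. *)
Definition wedge2 := ell2 R wedge_basis.

Definition frame_trunc (N : nat) : seq frame :=
  [seq inl k | k <- iota 0 N] ++ [seq inr k | k <- iota 0 N].

Definition wedge_trunc (N : nat) : seq wedge_basis :=
  pmap insub [seq (a, b) | a <- frame_trunc N, b <- frame_trunc N].

Definition dot_eu (V W : wedge2) : R :=
  lim ((fun N => \sum_(e <- wedge_trunc N) V e * W e) @ \oo).

Definition curvature_form (V W : wedge2) : R :=
  lim ((fun N => \sum_(e <- wedge_trunc N) \sum_(f <- wedge_trunc N)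
    V e * W f * curv (val e).1 (val e).2 (val f).1 (val f).2) @ \oo).

(* The operator Q with <Q V, W>_eu = Q(V, W) for all V, W; it is unique, since
   dot_eu X W for W in the basis gives the coordinates of X. *)
Definition curvature_operator : wedge2 -> wedge2 :=
  xget (fun=> 0) [set Q | forall V W, dot_eu (Q V) W = curvature_form V W].

End Disk.

(* Main.v *)
(* For [f = y^4 zbar^i z^j] with [y = 1 - |z|^2] the function [D f] is an explicit polynomial,
   so every entry of the curvature tensor is a rational expression in the indices.  The entries
   decay fast enough off the diagonal for the Schur test, whence the operator exists and is bounded.
   It preserves the closed span of the bivectors d/dx_k /\ d/dy_k, where its matrix is [- 4 A]
   with [A] symmetric and [(k + 1) A k l --> K (l / k)]: asymptotically [A] is homogeneous of
   degree -1.  Hence the truncations of [(l + 1)^(-1/2 + i s)] to [l < N] are Weyl sequences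
   (the harmonic sum makes their norms diverge while the boundary errors stay bounded), and
   [- 4 c(s)] lies in the spectrum for every [s], where [c(s)] is the integral over ]0, +oo[ of
   [K t * t^(-1/2) * cos (s ln t)].  Since [K > 0], [c(s) < c(0)] for [s > 0], while
   [c(s) --> c(0)] as [s] tends to 0, so [- 4 c(0)] is a nonzero accumulation point of the spectrum;
   its normalized Weyl sequence tends to 0 in every coordinate, which excludes compactness. *)
Require Import Defs.
From mathcomp Require Import all_boot all_order all_algebra.
From mathcomp Require Import all_classical all_reals all_analysis.
From mathcomp Require Import measurable_realfun.
From mathcomp Require Import complex ring lra zify.
Set Implicit Arguments.
Unset Strict Implicit.
Unset Printing Implicit Defensive.
Import Order.TTheory GRing.Theory Num.Theory.
Import numFieldNormedType.Exports.
Local Open Scope classical_set_scope.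
Local Open Scope ring_scope.

(** * Uniqueness of the bounded solution on the disk *)

Section MixedDerivatives.
Context (R : realType).
Implicit Types (u : R * R -> R) (p q v w : R * R).

(** [opD] is defined by choice, so an explicit solution says something about it only once bounded
    solutions are known to be unique; hence the maximum principle below. Entries of the tensor
    vanish unless i + k = j + l, which reflects invariance under rotations of the disk. This rule
    decouples the bivectors with equal indices from all others, and it turns the double sum over a
    row into a single sum. A kernel homogeneous of degree -1 is compatible with dilations, so the
    Mellin transform diagonalises its continuous model; this is where the powers (l + 1)^(-1/2 + i
    s) come from. As the Hilbert space is real, such a power is carried as the pair of its real and
    imaginary parts, with one truncation serving both. Only rough bounds on the area of the disk and
    on pi enter the constants; they are sharp enough to give 4 c(0) <= 9 < 16 sqrt(3 / pi), which
    places the spectral points in the prescribed interval. *)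

Lemma is_derive_line u q v (t : R) : derivable u (q + t *: v) v ->
  is_derive t 1 (fun s : R => u (q + s *: v)) ('D_v u (q + t *: v)).
Proof.
have E : (fun h : R => h^-1 *: (((fun s : R => u (q + s *: v)) \o shift t) (h *: (1 : R))
      - u (q + t *: v)))
    = (fun h : R => h^-1 *: ((u \o shift (q + t *: v)) (h *: v) - u (q + t *: v))).
  apply/funext => h /=; congr (_ *: (u _ - _)).
  by rewrite /shift /= scalerDl addrCA [h *: 1]mulr1.
move=> du; split; first by rewrite /derivable E.
by rewrite /derive E.
Qed.

(* Two applications of the mean value theorem to the second difference. *)
Lemma second_difference u p v w (h : R) : 0 < h ->
  (forall s t, 0 <= s <= h -> 0 <= t <= h ->
     derivable u (p + s *: v + t *: w) v /\
     derivable (fun q => 'D_v u q) (p + s *: v + t *: w) w) ->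
  exists s t, [/\ 0 <= s <= h, 0 <= t <= h &
    u (p + h *: v + h *: w) - u (p + h *: v) - u (p + h *: w) + u p
    = h ^+ 2 * 'D_w (fun q => 'D_v u q) (p + s *: v + t *: w)].
Proof.
move=> h0 du.
have hh : 0 <= h <= h by lra.
have h00 : (0 : R) <= 0 <= h by lra.
pose f (s : R) := u ((p + h *: w) + s *: v) - u (p + s *: v).
pose df (s : R) := 'D_v u ((p + h *: w) + s *: v) - 'D_v u (p + s *: v).
have fd (s : R) : 0 <= s <= h -> is_derive s 1 f (df s).
  move=> sh; apply: is_deriveB; apply: is_derive_line.
    by have [+ _] := du s h sh hh; rewrite -addrA [s *: v + _]addrC addrA.
  by have [+ _] := du s 0 sh h00; rewrite scale0r addr0.
have [x xh||s sh fE] := @MVT R f df 0 h h0.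
- by apply: fd; move: xh; rewrite in_itv/= => /andP[/ltW-> /ltW->].
- apply: derivable_within_continuous => x; rewrite in_itv/= => xh.
  by have [] := fd x xh.
have {}sh : 0 <= s <= h by move: sh; rewrite in_itv/= => /andP[/ltW-> /ltW->].
pose g (t : R) := 'D_v u ((p + s *: v) + t *: w).
pose dg (t : R) := 'D_w (fun q => 'D_v u q) ((p + s *: v) + t *: w).
have gd (t : R) : 0 <= t <= h -> is_derive t 1 g (dg t).
  move=> th; have [_ d] := du s t sh th.
  exact: (@is_derive_line (fun q => 'D_v u q) (p + s *: v) w t d).
have [x xh||t th gE] := @MVT R g dg 0 h h0.
- by apply: gd; move: xh; rewrite in_itv/= => /andP[/ltW-> /ltW->].
- apply: derivable_within_continuous => x; rewrite in_itv/= => xh.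
  by have [] := gd x xh.
have {}th : 0 <= t <= h by move: th; rewrite in_itv/= => /andP[/ltW-> /ltW->].
exists s, t; split => //.
rewrite -/(dg t) expr2 -mulrA mulrC; transitivity (f h - f 0).
  by rewrite /f scale0r !addr0 -!addrA; congr (_ + _);
     rewrite ?[h *: w + _]addrC // opprB [X in _ = - _ + X]addrC addrA.
rewrite fE subr0 [LHS]mulrC [RHS]mulrC; congr (_ * _).
move: gE; rewrite subr0 [h * _]mulrC => <-; rewrite /g /df scale0r addr0.
by rewrite -!addrA [h *: w + _]addrC.
Qed.


(** The first derivative vanishes at the maximum. If a were positive, [f1] would be positive just to
    the right of 0, and the mean value theorem would give a value of [f] above the maximum. *)
Lemma second_derivative_at_max (f f1 : R -> R) (a e : R) : 0 < e ->
  (forall t, `|t| < e -> is_derive t (1 : R) f (f1 t)) -> is_derive (0 : R) (1 : R) f1 a ->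
  (forall t, `|t| < e -> f t <= f 0) -> a <= 0.
Proof.
move=> e0 df [df1 f1a] fmax; rewrite leNgt; apply/negP => a0.
have f10 : f1 0 = 0.
  have d0 : is_derive (0 : R) (1 : R) f (f1 0) by apply: df; rewrite normr0.
  suff [_ E0] : is_derive (0 : R) (1 : R) f 0 by have [_ E1] := d0; rewrite -E1 E0.
  apply: (@derive1_at_max _ f (- e) e 0).
  - by lra.
  - by move=> t; rewrite in_itv/= => te; have [|//] := df t; rewrite ltr_norml.
  - by rewrite in_itv/= e0 oppr_lt0 e0.
  - by move=> t; rewrite in_itv/= => te; apply: fmax; rewrite ltr_norml.
have : \forall h \near (0 : R)^', 0 < h^-1 *: (f1 (h *: (1:R) + 0) - f1 0).
  by apply: cvgr_gt a0; rewrite -f1a; exact: df1.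
rewrite near_withinE => -[d /= d0 dP].
pose h := Num.min d e / 2.
have m0 : 0 < Num.min d e by rewrite lt_min d0 e0.
have h0 : 0 < h by rewrite /h; lra.
have hd : h < d by apply: (@lt_le_trans _ _ (Num.min d e)); [rewrite /h; lra|rewrite ge_min lexx].
have he : h < e by apply: (@lt_le_trans _ _ (Num.min d e)); [rewrite /h; lra|rewrite ge_min lexx orbT].
have [x xh||s sh fE] := @MVT R f f1 0 h h0.
- by apply: df; move: xh; rewrite in_itv/= => xh; rewrite ltr_norml; lra.
- apply: (@derivable_within_continuous _ _ f `[0, h]) => t; rewrite in_itv/= => th.
  by have [|//] := df t; rewrite ltr_norml; lra.
move: sh; rewrite in_itv/= => /andP[s0 sh].
have := fmax h; rewrite ger0_norm ?(ltW h0)// => /(_ he).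
rewrite -subr_le0 fE subr0 pmulr_lle0// leNgt => /negP; apply.
have := dP s; rewrite /= sub0r normrN gtr0_norm// => /(_ (lt_trans sh hd)).
rewrite gt_eqF// => /(_ isT); rewrite addr0 f10 subr0 [s *: 1]mulr1.
by rewrite pmulr_rgt0 ?invr_gt0.
Qed.

Lemma continuous_sqmod : continuous (@sqmod R).
Proof.
move=> p; rewrite /sqmod; apply: cvgD; apply: cvgM => //.
- exact: cvg_fst.
- exact: cvg_fst.
- exact: cvg_snd.
- exact: cvg_snd.
Qed.

Lemma open_disk : open (@disk R).
Proof.
rewrite (_ : @disk R = @sqmod R @^-1` [set x | x < 1]); last by [].
by apply: open_comp; [move=> x _; exact: continuous_sqmod|exact: open_lt].
Qed.

Lemma disk_nbhs p : disk p -> nbhs p (@disk R).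
Proof. by move=> dp; apply: open_nbhs_nbhs; split => //; exact: open_disk. Qed.

Lemma nbhs_parallelogram p v w (A : set (R * R)) : nbhs p A -> exists2 e, 0 < e &
  forall s t, `|s| < e -> `|t| < e -> A (p + s *: v + t *: w).
Proof.
pose F (z : R * R) := p + z.1 *: v + z.2 *: w.
have cF : continuous F.
  move=> z; apply: cvgD; first (apply: cvgD; first exact: cvg_cst).
  - by apply: cvgZr_tmp; exact: cvg_fst.
  - by apply: cvgZr_tmp; exact: cvg_snd.
move=> pA; have : nbhs (0 : R * R) (F @^-1` A).
  by apply: cF; rewrite /F !scale0r !addr0.
move=> /nbhs_ballP[e /= e0 eA]; exists e => // s t se te.
by apply: (eA (s, t)); split; rewrite /ball/= sub0r normrN.
Qed.

(** The mean value theorem yields equality only at two uncontrolled points of a small parallelogram;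
    shrinking it and using continuity moves the equality to the corner p. *)
Lemma eq_at_limit (F G : R * R -> R) p v w (D : set (R * R)) : nbhs p D ->
  {for p, continuous F} -> {for p, continuous G} ->
  (forall h, 0 < h -> (forall s t, 0 <= s <= h -> 0 <= t <= h -> D (p + s *: v + t *: w)) ->
    exists s t s' t', [/\ 0 <= s <= h, 0 <= t <= h, 0 <= s' <= h & 0 <= t' <= h] /\
      F (p + s *: v + t *: w) = G (p + s' *: v + t' *: w)) ->
  F p = G p.
Proof.
move=> pD cF cG FG.
apply/eqP; rewrite -subr_eq0 -normr_le0; apply/ler_addgt0Pr => e e0.
rewrite add0r.
have e2 : 0 < e / 2 by lra.
have /cvgr_dist_lt /(_ _ e2) n1 := cF.
have /cvgr_dist_lt /(_ _ e2) n2 := cG.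
have [d d0 dP] := nbhs_parallelogram v w (filterI (filterI n1 n2) pD).
have h0 : 0 < d / 2 by lra.
have small (s : R) : 0 <= s <= d / 2 -> `|s| < d by move=> ?; rewrite ger0_norm; lra.
have [|s [t [s' [t' [[sh th sh' th'] E]]]]] := FG (d / 2) h0.
  by move=> s t sh th; have [] := dP s t (small _ sh) (small _ th).
have [[h1 _] _] := dP s t (small _ sh) (small _ th).
have [[_ h2] _] := dP s' t' (small _ sh') (small _ th').
move: h1 h2; rewrite /= E; set X := G (_ + _ + _); move: (F p) (G p) X => A B X.
move=> h1 h2; rewrite (_ : A - B = (A - X) - (B - X)); last by ring.
by rewrite (le_trans (ler_normB _ _))//; lra.
Qed.

(** The second difference is symmetric in v and w. Expanding it in either order gives h^2 times one
    of the two mixed derivatives, each at some point of the same parallelogram. *)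
Lemma derive_commute u p v w (D : set (R * R)) : nbhs p D ->
  (forall q, D q -> derivable u q v) -> (forall q, D q -> derivable u q w) ->
  (forall q, D q -> derivable (fun x => 'D_v u x) q w) ->
  (forall q, D q -> derivable (fun x => 'D_w u x) q v) ->
  {for p, continuous (fun q => 'D_w (fun x => 'D_v u x) q)} ->
  {for p, continuous (fun q => 'D_v (fun x => 'D_w u x) q)} ->
  'D_w (fun x => 'D_v u x) p = 'D_v (fun x => 'D_w u x) p.
Proof.
move=> pD duv duw duvw duwv cwv cvw.
apply: (@eq_at_limit _ _ p v w D pD cwv cvw) => h h0 hD.
have [|s [t [sh th E1]]] := @second_difference u p v w h h0.
  by move=> s t sh th; split; [exact/duv/hD|exact/duvw/hD].
have [|s' [t' [sh' th' E2]]] := @second_difference u p w v h h0.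
  by move=> s' t' sh' th'; rewrite addrAC; split; [exact/duw/hD|exact/duwv/hD].
exists s, t, t', s'; split; first by split.
have h2 : h ^+ 2 != 0 by rewrite expf_neq0// gt_eqF.
rewrite [p + h *: w + h *: v]addrAC [p + s' *: w + t' *: v]addrAC in E2.
move: E1 E2; set X := 'D_w _ _; set Y := 'D_v _ _.
move: (u _) (u _) (u _) (u _) X Y => a b c d X Y E1 E2.
by apply: (mulfI h2); rewrite -E1 -E2; ring.
Qed.

Lemma Ck2_mixed u p : Ck 2 u -> disk p ->
  'D_(@diry R) (fun q => 'D_(@dirx R) u q) p
  = 'D_(@dirx R) (fun q => 'D_(@diry R) u q) p.
Proof.
move=> [_ [du [_ [dux [_ _] [cuyx _]]] [_ [duy [cuxy _] _]]]] dp.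
apply: (derive_commute (disk_nbhs dp)).
- by move=> q dq; exact: (du _ dq).1.
- by move=> q dq; exact: (du _ dq).2.
- by move=> q dq; exact: (dux _ dq).2.
- by move=> q dq; exact: (duy _ dq).1.
- exact: cuyx.
- exact: cuxy.
Qed.

End MixedDerivatives.

(** * Maximum principle with a barrier blowing up at the circle *)

Section MaximumPrinciple.
Context (R : realType).
Implicit Types (u : R * R -> R) (p q v w : R * R).

Lemma is_derive_inv (f : R -> R) (x df : R) : f x != 0 ->
  is_derive x (1 : R) f df ->
  is_derive x (1 : R) (fun y => (f y)^-1) (- (f x)^-1 ^+ 2 * df).
Proof.
move=> fx [d <-]; split; first exact: derivableV.
by rewrite deriveV// exprVn.
Qed.

Lemma is_derive_inv_quadratic (X c t : R) : 1 - (X + t) ^+ 2 - c != 0 ->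
  is_derive t (1 : R) (fun s : R => (1 - (X + s) ^+ 2 - c)^-1)
    (2 * (X + t) * (1 - (X + t) ^+ 2 - c)^-1 ^+ 2).
Proof.
move=> h.
have D : is_derive t (1 : R) (fun s : R => 1 - (X + s) ^+ 2 - c) (- (2 * (X + t))).
  by apply: is_derive_eq; rewrite /GRing.scale /=; ring.
by have := @is_derive_inv (fun s : R => 1 - (X + s) ^+ 2 - c) t _ h D; rewrite mulrNN mulrC.
Qed.

Lemma is_derive_inv_quadratic2 (X c t : R) : 1 - (X + t) ^+ 2 - c != 0 ->
  is_derive t (1 : R) (fun s : R => 2 * (X + s) * (1 - (X + s) ^+ 2 - c)^-1 ^+ 2)
    (2 * (1 - (X + t) ^+ 2 - c)^-1 ^+ 2 + 8 * (X + t) ^+ 2 * (1 - (X + t) ^+ 2 - c)^-1 ^+ 3).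
Proof.
move=> h; have D := is_derive_inv_quadratic h.
have D2 : is_derive t (1 : R) (fun s : R => 2 * (X + s)) 2.
  by apply: is_derive_eq; rewrite /GRing.scale /=; ring.
apply: is_derive_eq.
by rewrite /GRing.scale /=; ring.
Qed.

(** Restriction of u - e / (1 - |z|^2) to a line through p where it has a local maximum: X + t is
    the coordinate along v and c the square of the other one. The bound is e times the second
    derivative of the barrier. *)
Lemma second_derivative_barrier u p v (X c e d : R) : 0 < d ->
  (forall t, `|t| < d -> derivable u (p + t *: v) v) ->
  derivable (fun q => 'D_v u q) p v ->
  (forall t, `|t| < d -> sqmod (p + t *: v) = (X + t) ^+ 2 + c /\ (X + t) ^+ 2 + c < 1) ->
  (forall t, `|t| < d ->
    u (p + t *: v) - e * (1 - sqmod (p + t *: v))^-1 <= u p - e * (1 - sqmod p)^-1) ->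
  'D_v (fun q => 'D_v u q) p
    <= e * (2 * (1 - sqmod p)^-1 ^+ 2 + 8 * X ^+ 2 * (1 - sqmod p)^-1 ^+ 3).
Proof.
move=> d0 du ddu sq umax; rewrite -subr_le0.
have dd : `|0 : R| < d by rewrite normr0.
have [sp sp1] := sq 0 dd; rewrite scale0r !addr0 in sp sp1.
pose B (s : R) := (1 - (X + s) ^+ 2 - c)^-1.
pose f (s : R) := u (p + s *: v) - e * B s.
pose f1 (s : R) := 'D_v u (p + s *: v) - e * (2 * (X + s) * B s ^+ 2).
apply: (@second_derivative_at_max _ f f1 _ d d0).
- move=> t td; have [_ s1] := sq t td.
  apply: is_deriveB; first exact: is_derive_line (du t td).
  have ne : 1 - (X + t) ^+ 2 - c != 0 by lra.
  have D := is_derive_inv_quadratic ne.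
  exact: (@is_deriveZ _ _ _ _ e t _ _ D).
- have ne : 1 - (X + 0) ^+ 2 - c != 0 by rewrite addr0; lra.
  rewrite /f1; apply: is_deriveB.
    have := @is_derive_line _ (fun q => 'D_v u q) p v 0.
    by rewrite scale0r addr0 => /(_ ddu).
  have := @is_derive_inv_quadratic2 X c 0 ne.
  rewrite addr0 -/(B _).
  have -> : (1 - X ^+ 2 - c)^-1 = (1 - sqmod p)^-1 by rewrite sp opprD addrA.
  exact: (@is_deriveZ _ _ _ _ e 0).
- move=> t td; have := umax t td; have [-> _] := sq t td.
  by rewrite sp /f /B scale0r !addr0 !opprD !addrA.
Qed.

Lemma sqmod_dirx p (t : R) : sqmod (p + t *: @dirx R) = (p.1 + t) ^+ 2 + p.2 ^+ 2.
Proof. by rewrite /sqmod /dirx /= scaler0 addr0 [t *: 1]mulr1. Qed.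

Lemma sqmod_diry p (t : R) : sqmod (p + t *: @diry R) = (p.2 + t) ^+ 2 + p.1 ^+ 2.
Proof. by rewrite /sqmod /diry /= scaler0 addr0 [t *: 1]mulr1 addrC. Qed.

Lemma compact_subdisk (s : R) : compact [set p : R * R | sqmod p <= s].
Proof.
pose b := 1 + `|s|.
apply: (subclosed_compact _ (compact_setX (@segment_compact R (- b) b) (@segment_compact R (- b) b))).
  rewrite (_ : [set p | _] = @sqmod R @^-1` [set x | x <= s]); last by [].
  apply: closed_comp; [move=> x _; exact: continuous_sqmod|exact: closed_le].
move=> p /=; rewrite /sqmod => ps.
have b0 : 0 <= b by rewrite addr_ge0.
have H (x y : R) : x ^+ 2 + y ^+ 2 <= s -> x \in `[- b, b].
  move=> xy; have xs : x ^+ 2 <= s by apply: le_trans xy; rewrite lerDl sqr_ge0.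
  rewrite in_itv/= -ler_norml -(@ler_pXn2r _ 2) ?nnegrE//.
  rewrite real_normK ?num_real// (le_trans xs)// (le_trans (ler_norm _))//.
  by rewrite /b sqrrD; nra.
split; first exact: H ps.
by apply: (H _ p.1); rewrite addrC.
Qed.

Definition real_laplacian u p : R :=
  'D_(@dirx R) (fun q => 'D_(@dirx R) u q) p + 'D_(@diry R) (fun q => 'D_(@diry R) u q) p.

(** The barrier b = 1 / (1 - |z|^2) satisfies (1 - |z|^2)^2 / 4 * Laplacian(b) = (1 + |z|^2) b < 2
    b. As u is bounded above, u - e b attains its maximum inside the disk if it is positive
    somewhere; there 2 u <= e (1 + |z|^2) b < 2 e b, against u > e b. *)
Lemma barrier_max_principle u (M : R) : Ck 2 u ->
  (forall p, disk p -> u p <= M) ->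
  (forall p, disk p -> (1 - sqmod p) ^+ 2 / 4 * real_laplacian u p = 2 * u p) ->
  forall p, disk p -> u p <= 0.
Proof.
move=> [cu [du [_ [dux _ _]] [_ [duy _ _]]]] uM uE p0 dp0.
rewrite leNgt; apply/negP => u0.
have M0 : 0 < M by apply: lt_le_trans u0 (uM _ dp0).
have x0 : sqmod p0 < 1 := dp0.
(* With this e the barrier takes exactly half of the value at [p0], so [g p0] stays positive. *)
pose e := u p0 * (1 - sqmod p0) / 2.
have e0 : 0 < e by rewrite /e divr_gt0// mulr_gt0// subr_gt0.
pose g p := u p - e * (1 - sqmod p)^-1.
have gp0 : 0 < g p0.
  rewrite /g /e (_ : _ - _ = u p0 / 2); last by field; rewrite gt_eqF// subr_gt0.
  by rewrite divr_gt0.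
(* Outside this compact subdisk the term e / (1 - |z|^2) exceeds M, hence u, and [g] is negative or
   zero. *)
pose A := [set p : R * R | sqmod p <= 1 - e / M].
have Ad p : A p -> disk p.
  by rewrite /A /disk/= => /le_lt_trans; apply; rewrite ltrBlDr ltrDl divr_gt0.
have gA p : disk p -> ~ A p -> g p <= 0.
  move=> dp /negP; rewrite -ltNge ltrBlDr => h.
  have dp' : 0 < 1 - sqmod p by rewrite subr_gt0.
  rewrite subr_le0 (le_trans (uM _ dp))// ler_pdivlMr// mulrC -ler_pdivlMr//.
  by apply/ltW; rewrite ltrBlDl.
have Ap0 : A p0 by apply: contrapT => /(gA _ dp0); rewrite leNgt gp0.
have cg p : disk p -> {for p, continuous g}.
  move=> dp; apply: cvgB; first exact: cu.
  apply: cvgM; first exact: cvg_cst.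
  apply: cvgV; first by rewrite subr_eq0 gt_eqF.
  by apply: cvgB; [exact: cvg_cst|exact: continuous_sqmod].
have [||c Ac cmax] := @compact_EVT_max _ _ g A _ (@compact_subdisk _).
- by exists p0.
- apply: continuous_in_subspaceT => p /set_mem pA; exact/cg/Ad.
have {}Ac : A c by apply/set_mem.
have dc : disk c := Ad _ Ac.
have gc : 0 < g c by apply: lt_le_trans gp0 (cmax _ _); exact/mem_set.
have gmax q : disk q -> g q <= g c.
  move=> dq; have [qA|qA] := pselect (A q); first by apply: cmax; exact/mem_set.
  by apply: le_trans (ltW gc); exact: gA.
have [d d0 dP] := nbhs_parallelogram (@dirx R) (@diry R) (disk_nbhs dc).
have dirxd (t : R) : `|t| < d -> disk (c + t *: @dirx R).
  by move=> td; have := dP t 0 td; rewrite normr0 scale0r addr0; apply.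
have diryd (t : R) : `|t| < d -> disk (c + t *: @diry R).
  by move=> td; have := dP 0 t; rewrite normr0 scale0r addr0; apply.
have hx := @second_derivative_barrier u c (@dirx R) c.1 (c.2 ^+ 2) e d d0.
have {}hx := hx (fun t td => (du _ (dirxd t td)).1) (dux _ dc).1.
have {}hx := hx (fun t td => conj (sqmod_dirx c t) (eq_ind _ (fun z => z < 1) (dirxd t td) _ (sqmod_dirx c t))).
have {}hx := hx (fun t td => gmax _ (dirxd t td)).
have hy := @second_derivative_barrier u c (@diry R) c.2 (c.1 ^+ 2) e d d0.
have {}hy := hy (fun t td => (du _ (diryd t td)).2) (duy _ dc).2.
have {}hy := hy (fun t td => conj (sqmod_diry c t) (eq_ind _ (fun z => z < 1) (diryd t td) _ (sqmod_diry c t))).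
have {}hy := hy (fun t td => gmax _ (diryd t td)).
have := uE _ dc; rewrite /real_laplacian; move: hx hy gc; rewrite /g.
have x1 : sqmod c < 1 := dc.
have x1' : 0 < 1 - sqmod c by rewrite subr_gt0.
have sqE : sqmod c = c.1 ^+ 2 + c.2 ^+ 2 by [].
set a := 'D_ _ _ c; set b := 'D_ _ _ c => hx hy gc ab.
have hxy : a + b <= e * (4 * (1 - sqmod c)^-1 ^+ 2 + 8 * sqmod c * (1 - sqmod c)^-1 ^+ 3).
  apply: le_trans (lerD hx hy) _; rewrite -mulrDr sqE le_eqVlt.
  by apply/orP; left; apply/eqP; ring.
have : 2 * u c <= (1 - sqmod c) ^+ 2 / 4 *
    (e * (4 * (1 - sqmod c)^-1 ^+ 2 + 8 * sqmod c * (1 - sqmod c)^-1 ^+ 3)).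
  by rewrite -ab ler_wpM2l// divr_ge0// sqr_ge0.
have -> : (1 - sqmod c) ^+ 2 / 4 *
    (e * (4 * (1 - sqmod c)^-1 ^+ 2 + 8 * sqmod c * (1 - sqmod c)^-1 ^+ 3))
    = (1 + sqmod c) * (e * (1 - sqmod c)^-1) by field; rewrite gt_eqF.
have eV : 0 < e * (1 - sqmod c)^-1 by rewrite mulr_gt0// invr_gt0.
move=> h; set E := e * _ in gc eV h *.
have : 2 * E < (1 + sqmod c) * E by lra.
by rewrite ltr_pM2r//; lra.
Qed.

End MaximumPrinciple.

Opaque dirx diry real_laplacian.

(** * Uniqueness for the equation that defines [opD] *)

Section Uniqueness.
Context (R : realType).
Implicit Types (u : R * R -> R) (p q v w : R * R).

Lemma near_disk p (P : R * R -> Prop) : disk p -> (forall q, disk q -> P q) ->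
  \forall q \near p, P q.
Proof. by move=> dp DP; near=> q; apply: DP; near: q; exact: disk_nbhs. Unshelve. all: by end_near. Qed.

Lemma derive_congr_disk (f g : R * R -> R) v p : disk p ->
  (forall q, disk q -> f q = g q) -> 'D_v f p = 'D_v g p.
Proof. by move=> dp fg; apply: near_eq_derive; exact: near_disk. Qed.

(** The derivatives inside [Ck] are taken of functions on the whole plane, while rules such as the
    derivative of a difference are available only at points of the disk. Openness of the disk lets
    agreement there pass to all derivatives. *)
Lemma Ck_congr k (f g : R * R -> R) : (forall q, disk q -> f q = g q) ->
  Ck k f -> Ck k g.
Proof.
have C0 f' g' : (forall q, disk q -> f' q = g' q) ->
    (forall p, disk p -> {for p, continuous f'}) ->
    (forall p, disk p -> {for p, continuous g'}).
  move=> fg cf p dp; suff H : g' @ p --> f' p by move: H; rewrite (fg p dp).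
  by apply: cvg_trans (cf p dp); apply: near_eq_cvg; apply: near_disk => // q dq; rewrite fg.
elim: k f g => [|k IH] f g fg /= [cf df]; first by split => //; exact: C0 cf.
have [d fx fy] := df; split; first exact: C0 cf.
split.
- move=> p dp; split.
    by apply: near_eq_derivable (d p dp).1; exact: near_disk.
  by apply: near_eq_derivable (d p dp).2; exact: near_disk.
- by apply: IH fx => q dq; exact: derive_congr_disk.
- by apply: IH fy => q dq; exact: derive_congr_disk.
Qed.

Lemma Ck_sub k (f g : R * R -> R) : Ck k f -> Ck k g -> Ck k (fun p => f p - g p).
Proof.
elim: k f g => [|k IH] f g /= [cf df] [cg dg].
  by split => // p dp; apply: cvgB; [exact: cf|exact: cg].
have [d fx fy] := df; have [e gx gy] := dg.
split; first by move=> p dp; apply: cvgB; [exact: cf|exact: cg].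
split.
- move=> p dp; split.
    by apply: derivableB; [exact: (d p dp).1|exact: (e p dp).1].
  by apply: derivableB; [exact: (d p dp).2|exact: (e p dp).2].
- apply: Ck_congr (IH _ _ fx gx) => q dq.
  by rewrite [RHS]deriveB//; [exact: (d q dq).1|exact: (e q dq).1].
- apply: Ck_congr (IH _ _ fy gy) => q dq.
  by rewrite [RHS]deriveB//; [exact: (d q dq).2|exact: (e q dq).2].
Qed.

Lemma real_laplacianB u1 u2 p : Ck 2 u1 -> Ck 2 u2 -> disk p ->
  real_laplacian (fun q => u1 q - u2 q) p = real_laplacian u1 p - real_laplacian u2 p.
Proof.
move=> [_ [d1 [_ [dx1 _ _]] [_ [dy1 _ _]]]] [_ [d2 [_ [dx2 _ _]] [_ [dy2 _ _]]]] dp.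
Transparent real_laplacian.
rewrite /real_laplacian.
Opaque real_laplacian.
have Dx q : disk q -> 'D_(@dirx R) (fun q => u1 q - u2 q) q = 'D_(@dirx R) u1 q - 'D_(@dirx R) u2 q.
  by move=> dq; apply: deriveB; [exact: (d1 q dq).1|exact: (d2 q dq).1].
have Dy q : disk q -> 'D_(@diry R) (fun q => u1 q - u2 q) q = 'D_(@diry R) u1 q - 'D_(@diry R) u2 q.
  by move=> dq; apply: deriveB; [exact: (d1 q dq).2|exact: (d2 q dq).2].
rewrite (derive_congr_disk _ dp Dx) (derive_congr_disk _ dp Dy).
have Ex : 'D_(@dirx R) (fun q => 'D_(@dirx R) u1 q - 'D_(@dirx R) u2 q) p =
    'D_(@dirx R) (fun q => 'D_(@dirx R) u1 q) p - 'D_(@dirx R) (fun q => 'D_(@dirx R) u2 q) p.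
  by apply: deriveB; [exact: (dx1 p dp).1|exact: (dx2 p dp).1].
have Ey : 'D_(@diry R) (fun q => 'D_(@diry R) u1 q - 'D_(@diry R) u2 q) p =
    'D_(@diry R) (fun q => 'D_(@diry R) u1 q) p - 'D_(@diry R) (fun q => 'D_(@diry R) u2 q) p.
  by apply: deriveB; [exact: (dy1 p dp).2|exact: (dy2 p dp).2].
by rewrite Ex Ey opprD -!addrA; congr (_ + _); rewrite addrCA.
Qed.

(** The source term F cancels in the difference, which then solves the homogeneous equation; the
    maximum principle is applied to it and to its opposite. *)
Lemma bounded_solution_unique u1 u2 (F : R * R -> R) (M1 M2 : R) : Ck 2 u1 -> Ck 2 u2 ->
  (forall p, disk p -> `|u1 p| <= M1) -> (forall p, disk p -> `|u2 p| <= M2) ->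
  (forall p, disk p -> (1 - sqmod p) ^+ 2 / 4 * real_laplacian u1 p = 2 * u1 p + F p) ->
  (forall p, disk p -> (1 - sqmod p) ^+ 2 / 4 * real_laplacian u2 p = 2 * u2 p + F p) ->
  forall p, disk p -> u1 p = u2 p.
Proof.
move=> c1 c2 b1 b2 e1 e2 p dp.
suff H a b (Ma Mb : R) : Ck 2 a -> Ck 2 b -> (forall p, disk p -> `|a p| <= Ma) ->
    (forall p, disk p -> `|b p| <= Mb) ->
    (forall p, disk p -> (1 - sqmod p) ^+ 2 / 4 * real_laplacian a p = 2 * a p + F p) ->
    (forall p, disk p -> (1 - sqmod p) ^+ 2 / 4 * real_laplacian b p = 2 * b p + F p) ->
    a p <= b p.
  by apply/eqP; rewrite eq_le (H u1 u2 M1 M2)// (H u2 u1 M2 M1).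
move=> ca cb ba bb ea eb; rewrite -subr_le0.
apply: (@barrier_max_principle R (fun q => a q - b q) (Ma + Mb) _ _ _ _ dp).
- exact: Ck_sub.
- move=> q dq; have := ba q dq; have := bb q dq; rewrite !ler_norml; lra.
- move=> q dq; rewrite (real_laplacianB ca cb dq) mulrBr.
  transitivity ((2 * a q + F q) - (2 * b q + F q)); last by ring.
  exact: (congr2 (fun x y => x - y) (ea q dq) (eb q dq)).
Qed.

Lemma half_complex (x y : R) : ((x +i* y) / 2)%C = (x / 2 +i* (y / 2))%C.
Proof.
have -> : (2 : R[i]) = 2%:C%C by rewrite rmorph_nat.
by rewrite -fmorphV; simpc.
Qed.

(** Since 4 d_z d_zbar is the Euclidean Laplacian up to the commutator of the two partial
    derivatives, symmetry of the mixed derivatives of both parts removes the cross terms and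
    separates real from imaginary part. *)
Lemma laplacian_disk (u : R * R -> R[i]) p : smooth_on_disk u -> disk p ->
  laplacian u p =
  (((1 - sqmod p) ^+ 2 / 4 * real_laplacian (fun q => complex.Re (u q)) p) +i*
   ((1 - sqmod p) ^+ 2 / 4 * real_laplacian (fun q => complex.Im (u q)) p))%C.
Proof.
move=> su dp; have [ca cb] := su 2%N.
set a := fun q => complex.Re (u q) in ca *; set b := fun q => complex.Im (u q) in cb *.
have [_ [_ [_ [dax _ _]] [_ [day _ _]]]] := ca.
have [_ [_ [_ [dbx _ _]] [_ [dby _ _]]]] := cb.
have zbarE q : d_zbar u q = ((('D_(@dirx R) a q - 'D_(@diry R) b q) / 2) +i*
                             (('D_(@dirx R) b q + 'D_(@diry R) a q) / 2))%C.
  by rewrite /d_zbar /partial -/a -/b -half_complex; simpc.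
have Re_zbar : (fun q => complex.Re (d_zbar u q)) =
    (fun q => 2^-1 * ('D_(@dirx R) a q - 'D_(@diry R) b q)).
  by apply/funext => q; rewrite zbarE /= mulrC.
have Im_zbar : (fun q => complex.Im (d_zbar u q)) =
    (fun q => 2^-1 * ('D_(@dirx R) b q + 'D_(@diry R) a q)).
  by apply/funext => q; rewrite zbarE /= mulrC.
have DR v : derivable (fun q => 'D_(@dirx R) a q) p v -> derivable (fun q => 'D_(@diry R) b q) p v ->
    'D_v (fun q => complex.Re (d_zbar u q)) p =
    2^-1 * ('D_v (fun q => 'D_(@dirx R) a q) p - 'D_v (fun q => 'D_(@diry R) b q) p).
  move=> h1 h2; rewrite Re_zbar; transitivity (2^-1 * 'D_v (fun q => 'D_(@dirx R) a q - 'D_(@diry R) b q) p).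
    exact: (@deriveZ _ _ _ (fun q => 'D_(@dirx R) a q - 'D_(@diry R) b q) 2^-1 p v (derivableB h1 h2)).
  exact: (congr1 (fun z => 2^-1 * z) (deriveB h1 h2)).
have DI v : derivable (fun q => 'D_(@dirx R) b q) p v -> derivable (fun q => 'D_(@diry R) a q) p v ->
    'D_v (fun q => complex.Im (d_zbar u q)) p =
    2^-1 * ('D_v (fun q => 'D_(@dirx R) b q) p + 'D_v (fun q => 'D_(@diry R) a q) p).
  move=> h1 h2; rewrite Im_zbar; transitivity (2^-1 * 'D_v (fun q => 'D_(@dirx R) b q + 'D_(@diry R) a q) p).
    exact: (@deriveZ _ _ _ (fun q => 'D_(@dirx R) b q + 'D_(@diry R) a q) 2^-1 p v (derivableD h1 h2)).
  exact: (congr1 (fun z => 2^-1 * z) (deriveD h1 h2)).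
rewrite /laplacian /d_z /partial.
rewrite (DR _ (dax p dp).1 (dby p dp).1) (DR _ (dax p dp).2 (dby p dp).2).
rewrite (DI _ (dbx p dp).1 (day p dp).1) (DI _ (dbx p dp).2 (day p dp).2).
rewrite (Ck2_mixed ca dp) (Ck2_mixed cb dp).
have -> : 4 / rho p = (1 - sqmod p) ^+ 2.
  have p1 : 1 - sqmod p != 0 by rewrite subr_eq0 gt_eqF//; exact: dp.
  by rewrite /rho; field.
Transparent real_laplacian.
rewrite /real_laplacian -/a -/b.
Opaque real_laplacian.
set axx := 'D_(@dirx R) (fun q => 'D_(@dirx R) a q) p.
set ayy := 'D_(@diry R) (fun q => 'D_(@diry R) a q) p.
set bxx := 'D_(@dirx R) (fun q => 'D_(@dirx R) b q) p.
set byy := 'D_(@diry R) (fun q => 'D_(@diry R) b q) p.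
set axy := 'D_(@dirx R) (fun q => 'D_(@diry R) a q) p.
set bxy := 'D_(@dirx R) (fun q => 'D_(@diry R) b q) p.
move: axx ayy bxx byy axy bxy => axx ayy bxx byy axy bxy.
rewrite (_ : (_ - _)%R = ((2^-1 * (axx + ayy)) +i* (2^-1 * (bxx + byy)))%C).
  by rewrite half_complex; simpc; congr (_ +i* _)%C; field.
by simpc; congr (_ +i* _)%C; ring.
Qed.

Lemma is_opD_unique (f u1 u2 : R * R -> R[i]) : is_opD f u1 -> is_opD f u2 ->
  forall p, disk p -> u1 p = u2 p.
Proof.
move=> [s1 [M1 b1] e1] [s2 [M2 b2] e2] p dp.
have bdR (u : R * R -> R[i]) (M : R) : (forall p, disk p -> `|u p| <= M%:C%C) ->
    forall p, disk p -> `|complex.Re (u p)| <= M.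
  move=> ub q dq; have := ub q dq; rewrite -lecR; apply: le_trans.
  exact: normc_ge_Re.
have bdI (u : R * R -> R[i]) (M : R) : (forall p, disk p -> `|u p| <= M%:C%C) ->
    forall p, disk p -> `|complex.Im (u p)| <= M.
  move=> ub q dq; have := ub q dq; rewrite -lecR; apply: le_trans.
  by rewrite normc_def lecR -sqrtr_sqr ler_wsqrtr// lerDr sqr_ge0.
have eq_parts (u : R * R -> R[i]) : smooth_on_disk u ->
   (forall p, disk p -> laplacian u p - 2 * u p = - 2 * f p) ->
   forall q, disk q ->
   ((1 - sqmod q) ^+ 2 / 4 * real_laplacian (fun q => complex.Re (u q)) q
      = 2 * complex.Re (u q) + (- 2) * complex.Re (f q)) /\
   ((1 - sqmod q) ^+ 2 / 4 * real_laplacian (fun q => complex.Im (u q)) q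
      = 2 * complex.Im (u q) + (- 2) * complex.Im (f q)).
  move=> su eu q dq; have := eu q dq; rewrite (laplacian_disk su dq).
  move: (real_laplacian _ q) => A; move: (real_laplacian _ q) => B.
  case: (u q) (f q) => [a b] [c d].
  have -> : (2 : R[i]) = 2%:C%C by rewrite rmorph_nat.
  by simpc => /= -[E1 E2]; split; lra.
have RE := bounded_solution_unique (s1 2%N).1 (s2 2%N).1 (bdR _ _ b1) (bdR _ _ b2)
  (fun q dq => (eq_parts _ s1 e1 q dq).1) (fun q dq => (eq_parts _ s2 e2 q dq).1) dp.
have IE := bounded_solution_unique (s1 2%N).2 (s2 2%N).2 (bdI _ _ b1) (bdI _ _ b2)
  (fun q dq => (eq_parts _ s1 e1 q dq).2) (fun q dq => (eq_parts _ s2 e2 q dq).2) dp.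
by move: RE IE; case: (u1 p) (u2 p) => [a b] [c d] /= -> ->.
Qed.

(** An explicit solution shows that the choice in [opD] is not the default value, and uniqueness
    then identifies the chosen solution with it on the disk. *)
Lemma opDE (f u : R * R -> R[i]) : is_opD f u -> forall p, disk p -> opD f p = u p.
Proof.
move=> fu p dp; apply: (is_opD_unique _ fu dp).
exact: (@xgetPex _ (fun=> 0) [set u | is_opD f u] (ex_intro _ u fu)).
Qed.

End Uniqueness.

(** * Wirtinger calculus and explicit solutions *)

Section PolynomialFunctions.
Context (R : realType).
Local Notation C := R[i].
Implicit Types (u v : R * R -> R) (p q w : R * R).

(** Real polynomials in x and y as a class of functions: smoothness, boundedness on the disk and
    measurability all follow by one induction each, which discharges the analytic side conditions
    later. *)
Inductive polyfun : (R * R -> R) -> Prop :=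
| polyfun_cst (c : R) : polyfun (fun=> c)
| polyfun_fst : polyfun (fun p => p.1)
| polyfun_snd : polyfun (fun p => p.2)
| polyfunD u v : polyfun u -> polyfun v -> polyfun (fun p => u p + v p)
| polyfunM u v : polyfun u -> polyfun v -> polyfun (fun p => u p * v p).

Lemma is_derive_linear w (f : R * R -> R) p : (forall p q (h : R), f (h *: p + q) = h * f p + f q) ->
  is_derive p w f (f w).
Proof.
move=> lf; have E : (fun h : R => h^-1 *: ((f \o shift p) (h *: w) - f p)) @ 0^' --> f w.
  apply: cvg_near_cst; exists 1 => //= h _ h0.
  by rewrite lf addrK /GRing.scale/= mulKf.
by split; [exact: cvgP E|exact: cvg_lim E].
Qed.

Lemma polyfun_continuous u : polyfun u -> continuous u.
Proof.
elim=> {u} [c||| u v _ cu _ cv| u v _ cu _ cv] p.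
- exact: cvg_cst.
- exact: cvg_fst.
- exact: cvg_snd.
- by apply: cvgD; [exact: cu|exact: cv].
- by apply: cvgM; [exact: cu|exact: cv].
Qed.

Lemma polyfun_derive w u : polyfun u ->
  exists2 u', polyfun u' & forall p, is_derive p w u (u' p).
Proof.
elim=> {u} [c||| u v pu [u' pu' du] pv [v' pv' dv]| u v pu [u' pu' du] pv [v' pv' dv]].
- by exists (fun=> 0) => [|p]; [exact: polyfun_cst|exact: is_derive_cst].
- exists (fun=> w.1) => [|p]; first exact: polyfun_cst.
  by apply: (@is_derive_linear w (fun p => p.1)).
- exists (fun=> w.2) => [|p]; first exact: polyfun_cst.
  by apply: (@is_derive_linear w (fun p => p.2)).
- exists (fun p => u' p + v' p) => [|p]; first exact: polyfunD.
  exact: is_deriveD.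
- exists (fun p => u p * v' p + v p * u' p) => [|p].
    by apply: polyfunD; apply: polyfunM.
  exact: is_deriveM.
Qed.

Lemma polyfun_Ck k u : polyfun u -> Ck k u.
Proof.
elim: k u => [|k IH] u pu; first by split => // p _; exact: polyfun_continuous.
have [ux pux dux] := polyfun_derive (@dirx R) pu.
have [uy puy duy] := polyfun_derive (@diry R) pu.
have Ex : (fun p => 'D_(@dirx R) u p) = ux by apply/funext => p; have [] := dux p.
have Ey : (fun p => 'D_(@diry R) u p) = uy by apply/funext => p; have [] := duy p.
split; first by move=> p _; exact: polyfun_continuous.
rewrite Ex Ey; split; [|exact: IH|exact: IH].
by move=> p _; split; [have [] := dux p|have [] := duy p].
Qed.

Lemma polyfun_bounded u : polyfun u -> exists M : R, forall p, disk p -> `|u p| <= M.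
Proof.
have sq1 (a b : R) : a ^+ 2 + b ^+ 2 < 1 -> `|a| <= 1.
  move=> ab; rewrite -(@ler_pXn2r _ 2) ?nnegrE// real_normK ?num_real// expr1n.
  by apply: ltW; apply: le_lt_trans ab; rewrite lerDl sqr_ge0.
elim=> {u} [c||| u v _ [M hM] _ [N hN]| u v _ [M hM] _ [N hN]].
- by exists `|c|.
- by exists 1 => p dp; exact: sq1 dp.
- by exists 1 => p dp; apply: (@sq1 _ p.1); rewrite addrC; exact: dp.
- by exists (M + N) => p dp; apply: le_trans (ler_normD _ _) _; exact: lerD (hM p dp) (hN p dp).
- exists (M * N) => p dp; rewrite normrM; apply: ler_pM => //; [exact: hM|exact: hN].
Qed.

Definition cpolyfun (u : R * R -> C) :=
  polyfun (fun p => complex.Re (u p)) /\ polyfun (fun p => complex.Im (u p)).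

Lemma cpolyfun_cst (c : C) : cpolyfun (fun=> c).
Proof. by split; exact: polyfun_cst. Qed.

Lemma cpolyfun_zof : cpolyfun (@zof R).
Proof. by split; [exact: polyfun_fst|exact: polyfun_snd]. Qed.

Lemma cpolyfun_conj (u : R * R -> C) : cpolyfun u -> cpolyfun (fun p => (u p)^*%C).
Proof.
move=> [ru iu]; split.
  by rewrite (_ : (fun p => _) = fun p => complex.Re (u p))//; apply/funext => p; case: (u p).
rewrite (_ : (fun p => _) = fun p => (-1) * complex.Im (u p)).
  by apply: polyfunM => //; exact: polyfun_cst.
by apply/funext => p; case: (u p) => a b /=; rewrite mulN1r.
Qed.

Lemma cpolyfunD (u v : R * R -> C) : cpolyfun u -> cpolyfun v -> cpolyfun (fun p => u p + v p).
Proof.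
move=> [ru iu] [rv iv]; split.
  rewrite (_ : (fun p => _) = fun p => complex.Re (u p) + complex.Re (v p)).
    exact: polyfunD.
  by apply/funext => p; case: (u p) (v p) => a b [c d].
rewrite (_ : (fun p => _) = fun p => complex.Im (u p) + complex.Im (v p)).
  exact: polyfunD.
by apply/funext => p; case: (u p) (v p) => a b [c d].
Qed.

Lemma cpolyfunM (u v : R * R -> C) : cpolyfun u -> cpolyfun v -> cpolyfun (fun p => u p * v p).
Proof.
move=> [ru iu] [rv iv]; split.
  rewrite (_ : (fun p => _) = fun p => complex.Re (u p) * complex.Re (v p)
     + (-1) * (complex.Im (u p) * complex.Im (v p))).
    by apply: polyfunD; [|apply: polyfunM; first exact: polyfun_cst]; exact: polyfunM.
  by apply/funext => p; case: (u p) (v p) => a b [c d] /=; rewrite mulN1r.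
rewrite (_ : (fun p => _) = fun p => complex.Re (u p) * complex.Im (v p)
     + complex.Im (u p) * complex.Re (v p)).
  by apply: polyfunD; exact: polyfunM.
by apply/funext => p; case: (u p) (v p) => a b [c d] /=.
Qed.

Lemma cpolyfunX (u : R * R -> C) n : cpolyfun u -> cpolyfun (fun p => u p ^+ n).
Proof.
move=> pu; elim: n => [|n IH]; first exact: cpolyfun_cst.
by under eq_fun do rewrite exprS; exact: cpolyfunM.
Qed.

Lemma cpolyfun_sum n (F : 'I_n -> R * R -> C) : (forall i, cpolyfun (F i)) ->
  cpolyfun (fun p => \sum_(i < n) F i p).
Proof.
elim: n F => [|n IH] F pF.
  rewrite (_ : (fun p => _) = fun=> 0); first exact: cpolyfun_cst.
  by apply/funext => p; rewrite big_ord0.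
rewrite (_ : (fun p => _) = fun p => \sum_(i < n) F (widen_ord (leqnSn n) i) p + F ord_max p).
  by apply: cpolyfunD => //; exact: IH.
by apply/funext => p; rewrite big_ord_recr.
Qed.

Lemma cpolyfun_smooth (u : R * R -> C) : cpolyfun u -> smooth_on_disk u.
Proof. by move=> [ru iu] k; split; exact: polyfun_Ck. Qed.

Lemma cpolyfun_bounded (u : R * R -> C) : cpolyfun u -> bounded_on_disk u.
Proof.
move=> [/polyfun_bounded[M hM] /polyfun_bounded[N hN]].
exists (M + N) => p dp; have := hM p dp; have := hN p dp.
case: (u p) => a b /= bN aM.
rewrite normc_def lecR (le_trans _ (lerD aM bN))//=.
rewrite -(@ler_pXn2r _ 2) ?nnegrE ?sqrtr_ge0 ?addr_ge0// sqr_sqrtr ?addr_ge0 ?sqr_ge0//.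
rewrite sqrrD !real_normK ?num_real// addrAC lerDl.
by rewrite mulrn_wge0// mulr_ge0.
Qed.

(* [u] has Wirtinger derivatives [a] (in z) and [b] (in zbar). *)
Definition has_wirtinger (u a b : R * R -> C) := forall p,
  [/\ is_derive p (@dirx R) (fun q => complex.Re (u q)) (complex.Re (a p + b p)),
      is_derive p (@dirx R) (fun q => complex.Im (u q)) (complex.Im (a p + b p)),
      is_derive p (@diry R) (fun q => complex.Re (u q)) (complex.Re ('i%C * (a p - b p))) &
      is_derive p (@diry R) (fun q => complex.Im (u q)) (complex.Im ('i%C * (a p - b p)))].


Lemma d_zE (u a b : R * R -> C) p : has_wirtinger u a b -> d_z u p = a p.
Proof.
move=> /(_ p)[[_ e1] [_ e2] [_ e3] [_ e4]]; rewrite /d_z /partial e1 e2 e3 e4.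
have -> : (2 : C) = 2%:C%C by rewrite rmorph_nat.
by rewrite -fmorphV; case: (a p) (b p) => [x y] [z t] /=; simpc; congr (_ +i* _)%C; field.
Qed.

Lemma d_zbarE (u a b : R * R -> C) p : has_wirtinger u a b -> d_zbar u p = b p.
Proof.
move=> /(_ p)[[_ e1] [_ e2] [_ e3] [_ e4]]; rewrite /d_zbar /partial e1 e2 e3 e4.
have -> : (2 : C) = 2%:C%C by rewrite rmorph_nat.
by rewrite -fmorphV; case: (a p) (b p) => [x y] [z t] /=; simpc; congr (_ +i* _)%C; field.
Qed.

Lemma has_wirtinger_cst (c : C) : has_wirtinger (fun=> c) (fun=> 0) (fun=> 0).
Proof. by move=> p; rewrite addr0 subr0 mulr0 /=; split; exact: is_derive_cst. Qed.

Transparent dirx diry.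
Lemma has_wirtinger_zof : has_wirtinger (@zof R) (fun=> 1) (fun=> 0).
Proof.
move=> p; rewrite addr0 subr0 mulr1 /=; split.
- exact: (@is_derive_linear (@dirx R) (fun p => p.1)).
- exact: (@is_derive_linear (@dirx R) (fun p => p.2)).
- exact: (@is_derive_linear (@diry R) (fun p => p.1)).
- exact: (@is_derive_linear (@diry R) (fun p => p.2)).
Qed.

Lemma has_wirtinger_conj_zof : has_wirtinger (fun p => (@zof R p)^*%C) (fun=> 0) (fun=> 1).
Proof.
move=> p; rewrite add0r sub0r mulrN1 /= /dirx /diry oppr0; split.
- exact: (@is_derive_linear (1, 0) (fun p => p.1)).
- have := @is_derive_linear (1, 0) (fun p => - p.2) p; rewrite /= oppr0; apply.
  by move=> q r h; rewrite /= opprD mulrN.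
- exact: (@is_derive_linear (0, 1) (fun p => p.1)).
- apply: (@is_derive_linear (0, 1) (fun p => - p.2) p).
  by move=> q r h; rewrite /= opprD mulrN.
Qed.
Opaque dirx diry.

Lemma has_wirtingerD (u a b v a' b' : R * R -> C) : has_wirtinger u a b -> has_wirtinger v a' b' ->
  has_wirtinger (fun p => u p + v p) (fun p => a p + a' p) (fun p => b p + b' p).
Proof.
move=> hu hv p; have [u1 u2 u3 u4] := hu p; have [v1 v2 v3 v4] := hv p.
have re (f g : R * R -> C) : (fun q => complex.Re (f q + g q)) = (fun q => complex.Re (f q) + complex.Re (g q)).
  by apply/funext => q; case: (f q) (g q) => x y [].
have im (f g : R * R -> C) : (fun q => complex.Im (f q + g q)) = (fun q => complex.Im (f q) + complex.Im (g q)).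
  by apply/funext => q; case: (f q) (g q) => x y [].
rewrite !re !im; split.
- by apply: is_derive_eq (is_deriveD u1 v1) _; rewrite !raddfD/=; ring.
- by apply: is_derive_eq (is_deriveD u2 v2) _; rewrite !raddfD/=; ring.
- apply: is_derive_eq (is_deriveD u3 v3) _.
  by case: (a p) (b p) (a' p) (b' p) => [x y] [z t] [x' y'] [z' t'] /=; ring.
- apply: is_derive_eq (is_deriveD u4 v4) _.
  by case: (a p) (b p) (a' p) (b' p) => [x y] [z t] [x' y'] [z' t'] /=; ring.
Qed.

Lemma has_wirtingerM (u a b v a' b' : R * R -> C) : has_wirtinger u a b -> has_wirtinger v a' b' ->
  has_wirtinger (fun p => u p * v p) (fun p => u p * a' p + a p * v p)
    (fun p => u p * b' p + b p * v p).
Proof.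
move=> hu hv p; have [u1 u2 u3 u4] := hu p; have [v1 v2 v3 v4] := hv p.
have re (f g : R * R -> C) : (fun q => complex.Re (f q * g q)) =
    (fun q => complex.Re (f q) * complex.Re (g q) - complex.Im (f q) * complex.Im (g q)).
  by apply/funext => q; case: (f q) (g q) => x y [].
have im (f g : R * R -> C) : (fun q => complex.Im (f q * g q)) =
    (fun q => complex.Re (f q) * complex.Im (g q) + complex.Im (f q) * complex.Re (g q)).
  by apply/funext => q; case: (f q) (g q) => x y [].
rewrite !re !im; split.
- apply: is_derive_eq (is_deriveB (is_deriveM u1 v1) (is_deriveM u2 v2)) _.
  rewrite /GRing.scale/=; case: (u p) (v p) => [c d] [c' d'].
  by case: (a p) (b p) (a' p) (b' p) => [x y] [z t] [x' y'] [z' t'] /=; ring.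
- apply: is_derive_eq (is_deriveD (is_deriveM u1 v2) (is_deriveM u2 v1)) _.
  rewrite /GRing.scale/=; case: (u p) (v p) => [c d] [c' d'].
  by case: (a p) (b p) (a' p) (b' p) => [x y] [z t] [x' y'] [z' t'] /=; ring.
- apply: is_derive_eq (is_deriveB (is_deriveM u3 v3) (is_deriveM u4 v4)) _.
  rewrite /GRing.scale/=; case: (u p) (v p) => [c d] [c' d'].
  by case: (a p) (b p) (a' p) (b' p) => [x y] [z t] [x' y'] [z' t'] /=; ring.
- apply: is_derive_eq (is_deriveD (is_deriveM u3 v4) (is_deriveM u4 v3)) _.
  rewrite /GRing.scale/=; case: (u p) (v p) => [c d] [c' d'].
  by case: (a p) (b p) (a' p) (b' p) => [x y] [z t] [x' y'] [z' t'] /=; ring.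
Qed.

Lemma has_wirtinger_eq (u a b a' b' : R * R -> C) : has_wirtinger u a b -> a =1 a' -> b =1 b' ->
  has_wirtinger u a' b'.
Proof. by move=> + /funext <- /funext <-. Qed.

Definition zmon (a b : nat) (p : R * R) : C := zof p ^+ a * (zof p)^*%C ^+ b.

Lemma has_wirtingerX (u a b : R * R -> C) n : has_wirtinger u a b ->
  has_wirtinger (fun p => u p ^+ n) (fun p => n%:R * u p ^+ n.-1 * a p)
    (fun p => n%:R * u p ^+ n.-1 * b p).
Proof.
move=> h; elim: n => [|n IH].
  by apply: (has_wirtinger_eq (has_wirtinger_cst 1)) => p; rewrite !mul0r.
under eq_fun do rewrite exprS.
by apply: (has_wirtinger_eq (has_wirtingerM h IH)) => p /=;
  case: n {IH} => [|n] /=; rewrite ?exprS ?expr0 -?natr1; ring.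
Qed.

(** At exponent 0 the truncated predecessor is harmless, because the factor in front of it is 0. *)
Lemma has_wirtinger_zmon a b :
  has_wirtinger (zmon a b) (fun p => a%:R * zmon a.-1 b p) (fun p => b%:R * zmon a b.-1 p).
Proof.
have := has_wirtingerM (has_wirtingerX a has_wirtinger_zof) (has_wirtingerX b has_wirtinger_conj_zof).
by move=> h; apply: (has_wirtinger_eq h) => p; rewrite /zmon; ring.
Qed.

Lemma cpolyfun_zmon a b : cpolyfun (zmon a b).
Proof.
apply: cpolyfunM; apply: cpolyfunX; first exact: cpolyfun_zof.
exact/cpolyfun_conj/cpolyfun_zof.
Qed.

End PolynomialFunctions.

(** * Explicit polynomial solutions of the equation *)

Section ExplicitSolution.
Context (R : realType).
Local Notation C := R[i].
Implicit Types (u v l : R * R -> C) (p q : R * R) (P Q n t : nat).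

(** Records that l is d_z d_zbar u through explicit Wirtinger derivatives. It is preserved by linear
    combinations and evaluates [laplacian] without differentiability conditions. *)
Definition has_ddbar u l := exists a b c, has_wirtinger u a b /\ has_wirtinger b l c.

Lemma has_ddbarE u l p : has_ddbar u l -> d_z (d_zbar u) p = l p.
Proof.
move=> [a [b [c [h1 h2]]]].
rewrite (_ : d_zbar u = b); first exact: d_zE h2.
by apply/funext => q; exact: d_zbarE h1.
Qed.

Lemma has_ddbar_eq u l l' : has_ddbar u l -> l =1 l' -> has_ddbar u l'.
Proof. by move=> + /funext <-. Qed.

Lemma has_ddbarD u l v l' : has_ddbar u l -> has_ddbar v l' ->
  has_ddbar (fun p => u p + v p) (fun p => l p + l' p).
Proof.
move=> [a [b [c [h1 h2]]]] [a' [b' [c' [h1' h2']]]].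
exists (fun p => a p + a' p), (fun p => b p + b' p), (fun p => c p + c' p).
by split; exact: has_wirtingerD.
Qed.

Lemma has_ddbarZ (k : C) u l : has_ddbar u l -> has_ddbar (fun p => k * u p) (fun p => k * l p).
Proof.
move=> [a [b [c [h1 h2]]]].
exists (fun p => k * a p), (fun p => k * b p), (fun p => k * c p).
by split; [apply: (has_wirtinger_eq (has_wirtingerM (has_wirtinger_cst k) h1))
          |apply: (has_wirtinger_eq (has_wirtingerM (has_wirtinger_cst k) h2))] => p;
   rewrite /= mul0r addr0.
Qed.

Lemma has_ddbar_sum n (F L : 'I_n -> R * R -> C) : (forall i, has_ddbar (F i) (L i)) ->
  has_ddbar (fun p => \sum_(i < n) F i p) (fun p => \sum_(i < n) L i p).
Proof.
elim: n F L => [|n IH] F L h.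
  exists (fun=> 0), (fun=> 0), (fun=> 0).
  rewrite (_ : (fun p => \sum_(i < 0) F i p) = fun=> 0); last first.
    by apply/funext => p; rewrite big_ord0.
  rewrite (_ : (fun p => \sum_(i < 0) L i p) = fun=> 0); last first.
    by apply/funext => p; rewrite big_ord0.
  by split; exact: has_wirtinger_cst.
rewrite (_ : (fun p => _) = fun p => \sum_(i < n) F (widen_ord (leqnSn n) i) p + F ord_max p);
  last by apply/funext => p; rewrite big_ord_recr.
apply: has_ddbar_eq (has_ddbarD (IH _ _ (fun i => h _)) (h ord_max)) _ => p.
by rewrite big_ord_recr.
Qed.

Lemma has_ddbar_zmon a b : has_ddbar (@zmon R a b) (fun p => (a * b)%:R * zmon a.-1 b.-1 p).
Proof.
exists (fun p => a%:R * zmon a.-1 b p), (fun p => b%:R * zmon a b.-1 p),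
  (fun p => b%:R * (b.-1%:R * zmon a b.-1.-1 p)); split; first exact: has_wirtinger_zmon.
have h := has_wirtingerM (has_wirtinger_cst (b%:R : C)) (@has_wirtinger_zmon R a b.-1).
apply: (has_wirtinger_eq h) => p.
  by rewrite /= natrM; ring.
by rewrite /=; ring.
Qed.

Lemma mulcJ_sqmod p : zof p * (zof p)^*%C = (sqmod p)%:C%C.
Proof. by rewrite /zof /sqmod; simpc; rewrite -!expr2 [X in (_ +i* X)%C](_ : _ = 0)//; ring. Qed.

Lemma zmonS a b p : zmon a.+1 b.+1 p = zmon a b p * (sqmod p)%:C%C.
Proof. by rewrite /zmon -mulcJ_sqmod !exprS; ring. Qed.

(** The product z^(P+t) zbar^(Q+t) (1 - |z|^2)^2, expanded into monomials so that d_z d_zbar acts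
    termwise. *)
Definition bump_mon P Q t p : C :=
  zmon (P + t) (Q + t) p - 2 * zmon (P + t.+1) (Q + t.+1) p + zmon (P + t.+2) (Q + t.+2) p.

Lemma bump_monE P Q t p :
  bump_mon P Q t p = zmon (P + t) (Q + t) p * (1 - (sqmod p)%:C%C) ^+ 2.
Proof. by rewrite /bump_mon !addnS !zmonS; ring. Qed.

(** The factor produced by d_z d_zbar on z^(P+t) zbar^(Q+t). *)
Definition wt P Q t : nat := ((P + t) * (Q + t))%N.

Definition green_coef (F : fieldType) P Q n : F :=
  4 * (2 * n + 4 + P + Q)%:R / ((wt P Q n.+1)%:R * (wt P Q n.+2)%:R * (wt P Q n.+3)%:R).

(* The value of [D] at [(1 - |z|^2)^4 z^(P+n) zbar^(Q+n)] when [P Q = 0]. *)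
Definition green_poly P Q n p : C :=
  green_coef C P Q n * \sum_(t < n.+1) ((wt P Q t.+1)%:R * bump_mon P Q t p)
  - 2 / (wt P Q n.+3)%:R * bump_mon P Q n.+1 p.

Lemma has_ddbar_bump_mon P Q t : has_ddbar (bump_mon P Q t) (fun p =>
  (wt P Q t)%:R * zmon (P + t).-1 (Q + t).-1 p - 2 * ((wt P Q t.+1)%:R * zmon (P + t) (Q + t) p)
  + (wt P Q t.+2)%:R * zmon (P + t.+1) (Q + t.+1) p).
Proof.
have h := has_ddbarD (has_ddbarD (has_ddbar_zmon (P + t) (Q + t))
  (has_ddbarZ (-2) (has_ddbar_zmon (P + t.+1) (Q + t.+1)))) (has_ddbar_zmon (P + t.+2) (Q + t.+2)).
rewrite (_ : bump_mon P Q t = fun p => zmon (P + t) (Q + t) p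
    + (-2) * zmon (P + t.+1) (Q + t.+1) p + zmon (P + t.+2) (Q + t.+2) p); last first.
  by apply/funext => p; rewrite /bump_mon mulNr.
by apply: (has_ddbar_eq h) => p; rewrite /wt mulNr !addnS.
Qed.

(** The second difference of [wt] in t is 2. This matches the term -2 u of the equation and makes
    one more factor 1 - |z|^2 split off, leaving only two monomials. *)
Lemma bump_mon_hyperbolic P Q t p : (P * Q = 0)%N ->
  (1 - (sqmod p)%:C%C) ^+ 2 * ((wt P Q t)%:R * zmon (P + t).-1 (Q + t).-1 p
    - 2 * ((wt P Q t.+1)%:R * zmon (P + t) (Q + t) p)
    + (wt P Q t.+2)%:R * zmon (P + t.+1) (Q + t.+1) p) - 2 * bump_mon P Q t p
  = (1 - (sqmod p)%:C%C) ^+ 3 * ((wt P Q t)%:R * zmon (P + t).-1 (Q + t).-1 p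
    - (wt P Q t.+2)%:R * zmon (P + t) (Q + t) p) :> C.
Proof.
move=> PQ; rewrite bump_monE.
(* Where a predecessor is truncated at exponent 0 the weight [wt P Q t] is 0; otherwise both
   exponents are positive. *)
have E : (wt P Q t)%:R * zmon (P + t) (Q + t) p
    = (wt P Q t)%:R * zmon (P + t).-1 (Q + t).-1 p * (sqmod p)%:C%C :> C.
  have [->|] := eqVneq (wt P Q t) 0%N; first by rewrite !mul0r.
  rewrite muln_eq0 negb_or -!lt0n => /andP[h1 h2].
  by rewrite -{1}(prednK h1) -{1}(prednK h2) zmonS mulrA.
have W : (wt P Q t + wt P Q t.+2 = 2 * wt P Q t.+1 + 2)%N by rewrite /wt; nia.
have {}W : (wt P Q t)%:R + (wt P Q t.+2)%:R = 2 * (wt P Q t.+1)%:R + 2 :> C.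
  by rewrite -!natrD W natrD natrM.
rewrite !addnS zmonS.
move: W E; move: (wt P Q t)%:R (wt P Q t.+1)%:R (wt P Q t.+2)%:R => w0 w1 w2.
move: (zmon _.-1 _ p) (zmon _ _ p) (sqmod p)%:C%C => e0 e1 x W E.
have -> : w1 = (w0 + w2) / 2 - 1 by rewrite W; field.
transitivity ((1 - x) ^+ 2 * (w0 * e0 - (w0 * e1) - w2 * e1 + w2 * e1 * x)); first by field.
by rewrite E; ring.
Qed.

(** The weights [wt P Q t.+1] make consecutive terms cancel, and P Q = 0 removes the boundary term
    at t = 0, where [wt P Q 0] is P Q. *)
Lemma telescope_bump P Q n p : (P * Q = 0)%N ->
  \sum_(t < n.+1) (wt P Q t.+1)%:R * ((wt P Q t)%:R * zmon (P + t).-1 (Q + t).-1 p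
    - (wt P Q t.+2)%:R * zmon (P + t) (Q + t) p)
  = - ((wt P Q n.+1)%:R * (wt P Q n.+2)%:R * zmon (P + n) (Q + n) p) :> C.
Proof.
move=> PQ; elim: n => [|n IH].
  by rewrite big_ord1 /= [wt P Q 0]/wt !addn0 PQ; ring.
by rewrite big_ord_recr IH /= !addnS /=; ring.
Qed.

Lemma wt_neq0 P Q t : (wt P Q t.+1)%:R != 0 :> C.
Proof. by rewrite pnatr_eq0 /wt !addnS muln_eq0. Qed.

Lemma wt_step P Q n : wt P Q n.+3 = (wt P Q n.+1 + 2 * (2 * n + 4 + P + Q))%N.
Proof. by rewrite /wt; nia. Qed.

Opaque wt.
(** Write x = |z|^2, w1, w2, w3 for the weights at n+1, n+2, n+3 and e for z^(P+n) zbar^(Q+n). The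
    telescoped sum contributes -w1 w2 e (1 - x)^3 and the last bump (w1 - w3 x) e (1 - x)^3. Since
    w3 - w1 is 2 (2n + 4 + P + Q), the coefficients combine to -2 (1 - x) e (1 - x)^3, which is -2
    times the source. *)
Lemma is_opD_green_poly P Q n : (P * Q = 0)%N ->
  is_opD (fun p => (1 - (sqmod p)%:C%C) ^+ 4 * zmon (P + n) (Q + n) p) (green_poly P Q n).
Proof.
move=> PQ.
have pb t : cpolyfun (bump_mon P Q t).
  apply: cpolyfunD; last exact: cpolyfun_zmon.
  rewrite (_ : (fun p => _) = fun p => zmon (P + t) (Q + t) p + (-2) * zmon (P + t.+1) (Q + t.+1) p).
    apply: cpolyfunD; first exact: cpolyfun_zmon.
    by apply: cpolyfunM; [exact: cpolyfun_cst|exact: cpolyfun_zmon].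
  by apply/funext => p; rewrite mulNr.
have pg : cpolyfun (green_poly P Q n).
  rewrite (_ : green_poly P Q n = fun p => green_coef C P Q n *
      \sum_(t < n.+1) ((wt P Q t.+1)%:R * bump_mon P Q t p)
      + - (2 / (wt P Q n.+3)%:R) * bump_mon P Q n.+1 p); last first.
    by apply/funext => p; rewrite mulNr.
  apply: cpolyfunD; apply: cpolyfunM => //; try exact: cpolyfun_cst.
  by apply: cpolyfun_sum => i; apply: cpolyfunM => //; exact: cpolyfun_cst.
split; [exact: cpolyfun_smooth|exact: cpolyfun_bounded|move=> p dp].
rewrite /laplacian.
have -> : 4 / rho p = (1 - sqmod p) ^+ 2.
  have p1 : 1 - sqmod p != 0 by rewrite subr_eq0 gt_eqF//; exact: dp.
  by rewrite /rho; field.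
have h := has_ddbarD (has_ddbarZ (green_coef C P Q n)
  (has_ddbar_sum (fun t : 'I_n.+1 => has_ddbarZ (wt P Q t.+1)%:R (has_ddbar_bump_mon P Q t))))
  (has_ddbarZ (- (2 / (wt P Q n.+3)%:R)) (has_ddbar_bump_mon P Q n.+1)).
have E : green_poly P Q n = fun p => green_coef C P Q n *
      (\sum_(t < n.+1) ((wt P Q t.+1)%:R * bump_mon P Q t p))
      + - (2 / (wt P Q n.+3)%:R) * bump_mon P Q n.+1 p.
  by apply/funext => q; rewrite mulNr.
rewrite {1}E (has_ddbarE _ h) {h E}.
rewrite rmorphXn rmorphB rmorph1 /green_poly.
have T := telescope_bump n p PQ.
have H1 := bump_mon_hyperbolic n.+1 p PQ.
have H2 : (1 - (sqmod p)%:C%C) ^+ 2 * (\sum_(i < n.+1) (wt P Q i.+1)%:R *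
     ((wt P Q i)%:R * zmon (P + i).-1 (Q + i).-1 p - 2 * ((wt P Q i.+1)%:R * zmon (P + i) (Q + i) p) +
      (wt P Q i.+2)%:R * zmon (P + i.+1) (Q + i.+1) p))
    - 2 * (\sum_(t < n.+1) (wt P Q t.+1)%:R * bump_mon P Q t p)
    = (1 - (sqmod p)%:C%C) ^+ 3 * - ((wt P Q n.+1)%:R * (wt P Q n.+2)%:R * zmon (P + n) (Q + n) p).
  rewrite -T !mulr_sumr -sumrB; apply: eq_bigr => i _.
  by rewrite [in RHS]mulrCA -bump_mon_hyperbolic//; ring.
move: H1 H2; rewrite /green_coef.
have := wt_neq0 P Q n; have := wt_neq0 P Q n.+1; have := wt_neq0 P Q n.+2.
have := congr1 (fun k => k%:R : C) (wt_step P Q n); rewrite natrD (natrM _ 2 (2 * n + 4 + P + Q)).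
rewrite !(addnS P) !(addnS Q) !zmonS /=.
move: (\sum_(i < _) _) (\sum_(i < _) _) (bump_mon P Q n.+1 p) => S1 S2 B.
set w1 : C := (wt P Q n.+1)%:R; set w2 : C := (wt P Q n.+2)%:R; set w3 : C := (wt P Q n.+3)%:R.
move: (zmon _ _ p) (sqmod p)%:C%C => e x.
move: w1 w2 w3 => w1 w2 w3 E h3 h2 h1 H1 H2.
set m : C := (2 * n + 4 + P + Q)%:R in E *.
set X := (w1 * e - _ + _) in H1 *.
transitivity (4 * m / (w1 * w2 * w3) * ((1 - x) ^+ 2 * S2 - 2 * S1)
   - (2 / w3) * ((1 - x) ^+ 2 * X - 2 * B)); first by ring.
rewrite H1 H2 {H1 H2}.
have -> : m = (w3 - w1) / 2 by rewrite E; field.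
by field; rewrite h1 h2 h3.
Qed.

End ExplicitSolution.

(** * Integrals over the disk *)

Section DiskIntegral.
Context (R : realType).
Local Notation C := R[i].
Local Notation leb := (@lebesgue_measure R).
Local Notation leb2 := (@lebesgue_measure R \x @lebesgue_measure R)%E.
Implicit Types (u v g : R * R -> R) (p q : R * R).

Lemma polyfun_measurable u : polyfun u -> measurable_fun [set: R * R] u.
Proof.
elim=> {u} [c||| u v _ mu _ mv| u v _ mu _ mv].
- exact: measurable_cst.
- exact: measurable_fst.
- exact: measurable_snd.
- exact: measurable_funD.
- exact: measurable_funM.
Qed.

Lemma polyfun_sqmod : polyfun (@sqmod R).
Proof.
rewrite (_ : @sqmod R = fun p => p.1 * p.1 + p.2 * p.2).
  by apply: polyfunD; apply: polyfunM; do [exact: polyfun_fst|exact: polyfun_snd].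
by apply/funext => p; rewrite /sqmod !expr2.
Qed.

Lemma measurable_disk : measurable (@disk R).
Proof.
rewrite (_ : @disk R = [set: R * R] `&` @sqmod R @^-1` `]-oo, 1[).
  exact: (polyfun_measurable polyfun_sqmod).
by rewrite setTI; apply/seteqP; split => p /=; rewrite /disk/= in_itv.
Qed.

Lemma square_measure (a : R) : 0 <= a ->
  leb2 (`[- a, a]%classic `*` `[- a, a]%classic) = ((2 * a) ^+ 2)%:E.
Proof.
move=> a0; have E : leb `[- a, a]%classic = (2 * a)%:E.
  rewrite lebesgue_measure_itv/= lte_fin; case: ifPn => [_|].
    by rewrite -EFinB opprK; congr EFin; ring.
  by rewrite -leNgt => h; congr EFin; lra.
rewrite product_measure1E//=; transitivity ((2 * a)%:E * (2 * a)%:E)%E; last first.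
  by rewrite -EFinM expr2.
by rewrite -!E.
Qed.

Lemma disk_sub_square : @disk R `<=` `[- 1, 1]%classic `*` `[- 1, 1]%classic.
Proof.
have sq1 (a b : R) : a ^+ 2 + b ^+ 2 < 1 -> `[- 1, 1]%classic a.
  move=> ab; rewrite /= in_itv/= -ler_norml -(@ler_pXn2r _ 2) ?nnegrE// real_normK ?num_real// expr1n.
  by apply: ltW; apply: le_lt_trans ab; rewrite lerDl sqr_ge0.
move=> p dp; split; first exact: sq1 dp.
by apply: (@sq1 _ p.1); rewrite addrC; exact: dp.
Qed.

Lemma square_sub_disk : `[- 2^-1, 2^-1]%classic `*` `[- 2^-1, 2^-1]%classic `<=` @disk R.
Proof.
move=> [x y] /= []; rewrite !in_itv/= /disk /sqmod /= => hx hy; nra.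
Qed.

Lemma disk_measure_le : (leb2 (@disk R) <= 4%:E)%E.
Proof.
have := @square_measure 1 ler01; rewrite mulr1 => E.
have -> : 4%:E = ((2 : R) ^+ 2)%:E by congr EFin; ring.
rewrite -E; apply: le_measure; rewrite ?inE; last exact: disk_sub_square.
  exact: measurable_disk.
exact: measurableX.
Qed.

Lemma disk_measure_ge : (1%:E <= leb2 (@disk R))%E.
Proof.
have h0 : 0 <= (2^-1 : R) by rewrite invr_ge0.
have := square_measure h0; rewrite divff// expr1n => <-.
apply: le_measure; rewrite ?inE; last exact: square_sub_disk.
  exact: measurableX.
exact: measurable_disk.
Qed.

Lemma polyfun_integrable u : polyfun u -> leb2.-integrable (@disk R) (EFin \o u).
Proof.
move=> pu; have [M hM] := polyfun_bounded pu.
apply: measurable_bounded_integrable.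
- exact: measurable_disk.
- by apply: le_lt_trans disk_measure_le _; rewrite ltry.
- apply: measurable_funS (polyfun_measurable pu) => //.
- exists M; split; first exact: num_real.
  by move=> x Mx p dp; apply: le_trans (hM p dp) (ltW Mx).
Qed.

Definition disk_int u : R := \int[leb2]_(p in @disk R) u p.

Lemma disk_intD u v : polyfun u -> polyfun v ->
  disk_int (fun p => u p + v p) = disk_int u + disk_int v.
Proof.
by move=> pu pv; apply: RintegralD; [exact: measurable_disk|exact: polyfun_integrable..].
Qed.

Lemma disk_intZ (c : R) u : polyfun u -> disk_int (fun p => c * u p) = c * disk_int u.
Proof.
by move=> pu; apply: RintegralZl; [exact: measurable_disk|exact: polyfun_integrable].
Qed.

(** A nonempty slice of the disk is an open interval whose endpoints lie on the circle, where the
    primitive vanishes. With Fubini this makes the integral over the disk of a derivative zero when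
    the function vanishes on the circle. *)
Lemma slice_FTC (h h' : R -> R) (s : R) : (forall x, is_derive x (1 : R) h (h' x)) ->
  continuous h' -> (forall x, x ^+ 2 + s = 1 -> h x = 0) ->
  (\int[leb]_x (((EFin \o h') \_ [set x | (x ^+ 2 + s < 1)%R]) x) = 0)%E.
Proof.
move=> dh ch' h0; rewrite -integral_mkcond.
have [s1|s1] := ltP s 1; last first.
  rewrite (_ : [set x | _] = set0) ?integral_set0//.
  apply/seteqP; split => // x /=; have := sqr_ge0 x; lra.
pose c := Num.sqrt (1 - s).
have c0 : 0 < c by rewrite sqrtr_gt0 subr_gt0.
have c2 : c ^+ 2 = 1 - s by rewrite sqr_sqrtr// ltW// subr_gt0.
rewrite (_ : [set x | _] = `]- c, c[%classic); last first.
  apply/seteqP; split => x /=; rewrite in_itv/=.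
    move=> xs; rewrite -ltr_norml -(@ltr_pXn2r _ 2) ?nnegrE ?(ltW c0)//.
    by rewrite real_normK ?num_real// c2; lra.
  by rewrite -ltr_norml -(@ltr_pXn2r _ 2) ?nnegrE ?(ltW c0)// real_normK ?num_real// c2; lra.
have ch : continuous h.
  by move=> x; apply: differentiable_continuous; apply/derivable1_diffP; have [] := dh x.
have mh : measurable_fun `]- c, c[%classic h'.
  by apply: measurable_funS (continuous_measurable_fun ch') => //.
rewrite -(@integral_itv_bndoo _ _ _ _ true false); last exact/measurable_EFinP.
rewrite (@continuous_FTC2 _ h' h).
- by rewrite h0 ?h0 ?subee// ?sqrrN c2; ring.
- by lra.
- exact: continuous_subspaceT.
- split.
  + by move=> x _; have [] := dh x.
  + by apply: cvg_at_right_filter; exact: ch.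
  + by apply: cvg_at_left_filter; exact: ch.
- by move=> x _; rewrite derive1E; have [] := dh x.
Qed.

Lemma sigma_finite_leb2_integral (f : R * R -> R) (F := (EFin \o f) \_ (@disk R)) :
  polyfun f -> leb2.-integrable [set: R * R] F.
Proof.
move=> pf; apply/integrable_restrict => //; first exact: measurable_disk.
by rewrite setTI; exact: polyfun_integrable.
Qed.

Lemma disk_int_derive_x g g' : polyfun g -> polyfun g' ->
  (forall p, is_derive p (@dirx R) g (g' p)) -> (forall p, sqmod p = 1 -> g p = 0) ->
  disk_int g' = 0.
Proof.
move=> pg pg' dg g0; rewrite /disk_int /Rintegral integral_mkcond.
rewrite -(integral21_prod_meas1 (sigma_finite_leb2_integral pg')).
rewrite [X in fine X](_ : _ = 0%E)//; apply: integral0_eq => y _.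
rewrite /fubini_G.
pose h x := g (x, y).
Transparent dirx.
have E x : (0, y) + x *: @dirx R = (x, y).
  by rewrite /dirx; congr pair; rewrite /= ?scaler0 ?addr0// add0r [x *: 1]mulr1.
Opaque dirx.
have dh x : is_derive x (1 : R) h (g' (x, y)).
  have [d1 d2] := dg ((0, y) + x *: @dirx R).
  have := @is_derive_line _ g (0, y) (@dirx R) x d1.
  rewrite d2 E (_ : (fun s : R => g ((0, y) + s *: @dirx R)) = h)//.
  by apply/funext => s; rewrite E.
rewrite -(@slice_FTC h (fun x => g' (x, y)) (y ^+ 2) dh).
- by apply: eq_integral => x _; rewrite !patchE /= !mem_setE.
- move=> x; apply: (@continuous_comp _ _ _ (fun x => (x, y)) g'); last exact: polyfun_continuous.
  by apply: (@cvg_pair _ _ _ (nbhs x) (nbhs x) (nbhs y)); [exact: cvg_id|exact: cvg_cst].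
- by move=> x xy; apply: g0.
Qed.

Lemma disk_int_derive_y g g' : polyfun g -> polyfun g' ->
  (forall p, is_derive p (@diry R) g (g' p)) -> (forall p, sqmod p = 1 -> g p = 0) ->
  disk_int g' = 0.
Proof.
move=> pg pg' dg g0; rewrite /disk_int /Rintegral integral_mkcond.
rewrite -(integral12_prod_meas1 (sigma_finite_leb2_integral pg')).
rewrite [X in fine X](_ : _ = 0%E)//; apply: integral0_eq => x _.
rewrite /fubini_F.
pose h y := g (x, y).
Transparent diry.
have E y : (x, 0) + y *: @diry R = (x, y).
  by rewrite /diry; congr pair; rewrite /= ?scaler0 ?addr0// add0r [y *: 1]mulr1.
Opaque diry.
have dh y : is_derive y (1 : R) h (g' (x, y)).
  have [d1 d2] := dg ((x, 0) + y *: @diry R).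
  have := @is_derive_line _ g (x, 0) (@diry R) y d1.
  rewrite d2 E (_ : (fun s : R => g ((x, 0) + s *: @diry R)) = h)//.
  by apply/funext => s; rewrite E.
rewrite -(@slice_FTC h (fun y => g' (x, y)) (x ^+ 2) dh).
- apply: eq_integral => y _; rewrite !patchE.
  have -> // : ((x, y) \in @disk R) = (y \in [set y | (y ^+ 2 + x ^+ 2 < 1)%R]).
  by apply/idP/idP; rewrite !inE /disk /sqmod /= addrC.
- move=> y; apply: (@continuous_comp _ _ _ (fun y => (x, y)) g'); last exact: polyfun_continuous.
  by apply: (@cvg_pair _ _ _ (nbhs y) (nbhs x) (nbhs y)); [exact: cvg_cst|exact: cvg_id].
- by move=> y xy; apply: g0; rewrite /sqmod addrC.
Qed.


Definition cdisk_int (u : R * R -> C) : C :=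
  (disk_int (fun p => complex.Re (u p)) +i* disk_int (fun p => complex.Im (u p)))%C.

Lemma eq_cdisk_int (u v : R * R -> C) : (forall p, disk p -> u p = v p) ->
  cdisk_int u = cdisk_int v.
Proof.
move=> uv; rewrite /cdisk_int /disk_int; congr (_ +i* _)%C.
  by apply: eq_Rintegral => p /set_mem dp; rewrite uv.
by apply: eq_Rintegral => p /set_mem dp; rewrite uv.
Qed.

Lemma cdisk_intD (u v : R * R -> C) : cpolyfun u -> cpolyfun v ->
  cdisk_int (fun p => u p + v p) = cdisk_int u + cdisk_int v.
Proof.
move=> [ru iu] [rv iv]; rewrite /cdisk_int.
have -> : (fun p => complex.Re (u p + v p)) = (fun p => complex.Re (u p) + complex.Re (v p)).
  by apply/funext => p; case: (u p) (v p) => a b [c d].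
have -> : (fun p => complex.Im (u p + v p)) = (fun p => complex.Im (u p) + complex.Im (v p)).
  by apply/funext => p; case: (u p) (v p) => a b [c d].
by rewrite !disk_intD.
Qed.

Lemma cdisk_intZ (c : C) (u : R * R -> C) : cpolyfun u ->
  cdisk_int (fun p => c * u p) = c * cdisk_int u.
Proof.
move=> [ru iu]; rewrite /cdisk_int; case: c => a b.
have -> : (fun p => complex.Re ((a +i* b)%C * u p)) =
    (fun p => a * complex.Re (u p) + (- b) * complex.Im (u p)).
  by apply/funext => p; case: (u p) => c d /=; ring.
have -> : (fun p => complex.Im ((a +i* b)%C * u p)) =
    (fun p => a * complex.Im (u p) + b * complex.Re (u p)).
  by apply/funext => p; case: (u p) => c d /=; ring.
rewrite !disk_intD; try (by apply: polyfunM => //; exact: polyfun_cst).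
by rewrite !disk_intZ//; simpc; congr (_ +i* _)%C; ring.
Qed.

Lemma cdisk_int_sum n (F : 'I_n -> R * R -> C) : (forall i, cpolyfun (F i)) ->
  cdisk_int (fun p => \sum_(i < n) F i p) = \sum_(i < n) cdisk_int (F i).
Proof.
elim: n F => [|n IH] F pF.
  rewrite big_ord0 (_ : (fun p => _) = fun p => 0 * (fun=> 0) p); last first.
    by apply/funext => p; rewrite big_ord0 mul0r.
  by rewrite cdisk_intZ ?mul0r//; exact: cpolyfun_cst.
rewrite big_ord_recr/= -IH// -cdisk_intD//; last exact: cpolyfun_sum.
by apply: eq_cdisk_int => p _; rewrite big_ord_recr.
Qed.

(* The divergence theorem: [w] vanishes on the unit circle. *)
Lemma cdisk_int_wirtinger (w a b : R * R -> C) : has_wirtinger w a b ->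
  cpolyfun w -> cpolyfun a -> cpolyfun b -> (forall p, sqmod p = 1 -> w p = 0) ->
  cdisk_int a = 0 /\ cdisk_int b = 0.
Proof.
move=> hw pw pa pb w0.
have pab : cpolyfun (fun p => a p + b p) by exact: cpolyfunD.
have piab : cpolyfun (fun p => 'i%C * (a p - b p)).
  apply: cpolyfunM; first exact: cpolyfun_cst.
  rewrite (_ : (fun p => _) = fun p => a p + (-1) * b p); last first.
    by apply/funext => p; rewrite mulN1r.
  by apply: cpolyfunD => //; apply: cpolyfunM => //; exact: cpolyfun_cst.
have r0 p : sqmod p = 1 -> complex.Re (w p) = 0 by move=> /w0 ->.
have i0 p : sqmod p = 1 -> complex.Im (w p) = 0 by move=> /w0 ->.
have w1 p : is_derive p (@dirx R) (fun q => complex.Re (w q)) (complex.Re (a p + b p)) by have [] := hw p.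
have w2 p : is_derive p (@dirx R) (fun q => complex.Im (w q)) (complex.Im (a p + b p)) by have [] := hw p.
have w3 p : is_derive p (@diry R) (fun q => complex.Re (w q)) (complex.Re ('i%C * (a p - b p))) by have [] := hw p.
have w4 p : is_derive p (@diry R) (fun q => complex.Im (w q)) (complex.Im ('i%C * (a p - b p))) by have [] := hw p.
have S : cdisk_int (fun p => a p + b p) = 0.
  exact: (congr2 (fun x y => (x +i* y)%C) (disk_int_derive_x pw.1 pab.1 w1 r0)
                                          (disk_int_derive_x pw.2 pab.2 w2 i0)).
have D : cdisk_int (fun p => 'i%C * (a p - b p)) = 0.
  exact: (congr2 (fun x y => (x +i* y)%C) (disk_int_derive_y pw.1 piab.1 w3 r0)
                                          (disk_int_derive_y pw.2 piab.2 w4 i0)).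
have i2 : 'i%C * 'i%C = -1 :> C by rewrite -expr2 sqr_i.
have Ea : cdisk_int a = 2^-1 * (cdisk_int (fun p => a p + b p) - 'i%C * cdisk_int (fun p => 'i%C * (a p - b p))).
  rewrite -mulNr -cdisk_intZ// -cdisk_intD//; last by apply: cpolyfunM => //; exact: cpolyfun_cst.
  rewrite -cdisk_intZ.
    apply: eq_cdisk_int => p _; rewrite mulrA [- 'i%C * _]mulNr i2 opprK mul1r.
    by field.
  by apply: cpolyfunD => //; apply: cpolyfunM => //; exact: cpolyfun_cst.
rewrite S D mulr0 subr0 mulr0 in Ea.
split => //; move: S; rewrite cdisk_intD// Ea add0r => //.
Qed.

Definition area : R := disk_int (fun=> 1).

Lemma areaE : area = fine (leb2 (@disk R)).
Proof.
by rewrite /area /disk_int Rintegral_cst ?mul1r//; exact: measurable_disk.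
Qed.

(** The area stays symbolic throughout. An inscribed and a circumscribed square give these bounds,
    and all later constants are derived from them. *)
Lemma area_bounds : 1 <= area <= 4.
Proof.
have h1 := disk_measure_ge; have h2 := disk_measure_le.
have fin : leb2 (@disk R) \is a fin_num.
  by rewrite ge0_fin_numE// (le_lt_trans h2)// ltry.
by rewrite areaE -!lee_fin fineK// h1 h2.
Qed.

(** The divergence theorem for z^a' zbar^b' (1 - |z|^2) gives two recurrences that lower both
    exponents together. They end at 0 when the exponents differ and at the area when they agree. *)
Lemma cdisk_int_zmon a b : cdisk_int (zmon a b) = if a == b then (area / a.+1%:R)%:C%C else 0.
Proof.
have recs a' b' : b'%:R * cdisk_int (zmon a' b'.-1) = b'.+1%:R * cdisk_int (zmon a'.+1 b') /\
   a'%:R * cdisk_int (zmon a'.-1 b') = a'.+1%:R * cdisk_int (zmon a' b'.+1).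
  have h := has_wirtingerD (@has_wirtinger_zmon R a' b')
    (has_wirtingerM (has_wirtinger_cst (-1 : C)) (@has_wirtinger_zmon R a'.+1 b'.+1)).
  have pz n m : cpolyfun (@zmon R n m) by exact: cpolyfun_zmon.
  have pc (c : C) (f : R * R -> C) : cpolyfun f -> cpolyfun (fun p => c * f p).
    by move=> pu; apply: cpolyfunM => //; exact: cpolyfun_cst.
  have := cdisk_int_wirtinger h; rewrite /=.
  rewrite (_ : (fun p => a'%:R * _ + _) = fun p => a'%:R * zmon a'.-1 b' p + (- a'.+1%:R) * zmon a' b'.+1 p); last first.
    by apply/funext => p; ring.
  rewrite (_ : (fun p => b'%:R * _ + _) = fun p => b'%:R * zmon a' b'.-1 p + (- b'.+1%:R) * zmon a'.+1 b' p); last first.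
    by apply/funext => p; ring.
  case.
  - by apply: cpolyfunD => //; exact: pc.
  - by apply: cpolyfunD; exact: pc.
  - by apply: cpolyfunD; exact: pc.
  - by move=> p p1; rewrite zmonS p1; ring.
  - rewrite !cdisk_intD; try exact: pc.
    rewrite !cdisk_intZ//.
    by move=> E1 E2; split; apply/eqP; rewrite -subr_eq0 -mulNr ?E1 ?E2.
have S0 n : n.+1%:R != 0 :> C by rewrite pnatr_eq0.
elim: b a => [|b IH] [|a].
- rewrite eqxx divr1 /cdisk_int /area.
  rewrite (_ : (fun p => complex.Re _) = fun=> 1); last by apply/funext => p; rewrite /zmon !expr0 mulr1.
  rewrite (_ : (fun p => complex.Im _) = fun=> 0 * 1); last by apply/funext => p; rewrite /zmon !expr0 mulr1 mul0r.
  by rewrite disk_intZ ?mul0r//; exact: polyfun_cst.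
- by have [+ _] := recs a 0%N; rewrite mul0r => /esym/eqP; rewrite mulf_eq0 (negPf (S0 _)) /= => /eqP.
- by have [_ +] := recs 0%N b; rewrite mul0r => /esym/eqP; rewrite mulf_eq0 (negPf (S0 _)) /= => /eqP.
- have [+ _] := recs a b.+1; rewrite /= IH => E.
  apply: (mulfI (S0 b.+1)); rewrite -E eqSS; case: eqP => [->|_]; last by rewrite !mulr0.
  have -> : (b.+1%:R : C) = (b.+1%:R : R)%:C%C by rewrite rmorph_nat.
  have -> : (b.+2%:R : C) = (b.+2%:R : R)%:C%C by rewrite rmorph_nat.
  by rewrite -!rmorphM/=; congr (_%:C)%C; rewrite !(mulrCA _ area) !mulfV// pnatr_eq0.
Qed.

End DiskIntegral.

(** * Entries of the curvature tensor *)

Section CurvatureEntries.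
Context (R : realType).
Local Notation C := R[i].
Implicit Types (p q : R * R) (P Q n t : nat).

Lemma is_opDZ (k : C) (f u l : R * R -> C) : cpolyfun u -> has_ddbar u l -> is_opD f u ->
  is_opD (fun p => k * f p) (fun p => k * u p).
Proof.
move=> pu hu [_ _ eu].
have pku : cpolyfun (fun p => k * u p) by apply: cpolyfunM => //; exact: cpolyfun_cst.
split; [exact: cpolyfun_smooth|exact: cpolyfun_bounded|move=> p dp].
have := eu p dp; rewrite /laplacian (has_ddbarE _ hu) (has_ddbarE _ (has_ddbarZ k hu)) => E.
transitivity (k * ((4 / rho p)%:C%C * l p - 2 * u p)); first by ring.
by rewrite E; ring.
Qed.

Lemma cpolyfun_bump_mon P Q t : cpolyfun (@bump_mon R P Q t).
Proof.
apply: cpolyfunD; last exact: cpolyfun_zmon.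
rewrite (_ : (fun p => _) = fun p => zmon (P + t) (Q + t) p + (-2) * zmon (P + t.+1) (Q + t.+1) p).
  apply: cpolyfunD; first exact: cpolyfun_zmon.
  by apply: cpolyfunM; [exact: cpolyfun_cst|exact: cpolyfun_zmon].
by apply/funext => p; rewrite mulNr.
Qed.

Lemma cpolyfun_green_poly P Q n : cpolyfun (@green_poly R P Q n).
Proof.
rewrite (_ : green_poly P Q n = fun p => green_coef C P Q n *
    \sum_(t < n.+1) ((wt P Q t.+1)%:R * bump_mon P Q t p)
    + - (2 / (wt P Q n.+3)%:R) * bump_mon P Q n.+1 p); last first.
  by apply/funext => p; rewrite mulNr.
apply: cpolyfunD; apply: cpolyfunM; try exact: cpolyfun_cst; last exact: cpolyfun_bump_mon.
by apply: cpolyfun_sum => i; apply: cpolyfunM; [exact: cpolyfun_cst|exact: cpolyfun_bump_mon].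
Qed.

Lemma has_ddbar_green_poly P Q n : exists l, has_ddbar (@green_poly R P Q n) l.
Proof.
have h := has_ddbarD (has_ddbarZ (green_coef C P Q n)
  (has_ddbar_sum (fun t : 'I_n.+1 => has_ddbarZ (wt P Q t.+1)%:R (@has_ddbar_bump_mon R P Q t))))
  (has_ddbarZ (- (2 / (wt P Q n.+3)%:R)) (@has_ddbar_bump_mon R P Q n.+1)).
have E : green_poly P Q n = fun p => green_coef C P Q n *
      (\sum_(t < n.+1) ((wt P Q t.+1)%:R * bump_mon P Q t p))
      + - (2 / (wt P Q n.+3)%:R) * bump_mon P Q n.+1 p.
  by apply/funext => q; rewrite mulNr.
by rewrite E; eexists; exact: h.
Qed.

(** The Beta value B(n + 1, 5), that is the integral of x^n (1 - x)^4 over [0, 1]. *)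
Definition beta5 (F : fieldType) n : F :=
  24 / (n.+1%:R * n.+2%:R * n.+3%:R * n.+4%:R * n.+4.+1%:R).

Lemma cdisk_int_zmon_weight a b :
  cdisk_int (fun p => zmon a b p * (1 - (sqmod p)%:C%C) ^+ 4) =
  if a == b then (area R * beta5 R a)%:C%C else 0.
Proof.
have pz n m : cpolyfun (@zmon R n m) by exact: cpolyfun_zmon.
have pc (c : C) n m : cpolyfun (fun p => c * @zmon R n m p).
  by apply: cpolyfunM => //; exact: cpolyfun_cst.
transitivity (cdisk_int (fun p => @zmon R a b p + ((-4) * zmon a.+1 b.+1 p +
    (6 * zmon a.+2 b.+2 p + ((-4) * zmon a.+3 b.+3 p + 1 * zmon a.+4 b.+4 p))))).
  by apply: eq_cdisk_int => p _; rewrite !zmonS; ring.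
rewrite !cdisk_intD; try by [|do ?[apply: cpolyfunD => //]].
rewrite !cdisk_intZ// !cdisk_int_zmon !eqSS; case: eqP => _; last by rewrite !mulr0 !addr0.
rewrite -[-4]/(- (4%:R)) -[6]/(6%:R) -!(rmorph_nat (real_complex R)) -!rmorphN -!rmorphM.
rewrite mul1r -!rmorphD/=; congr (_%:C)%C.
rewrite /beta5 -[a.+4.+1]/(5 + a)%N -[a.+4]/(4 + a)%N -[a.+3]/(3 + a)%N -[a.+2]/(2 + a)%N -[a.+1]/(1 + a)%N !natrD.
move: (a%:R : R) (ler0n R a) => x x0.
field.
by do ?[apply/andP; split]; apply: lt0r_neq0; lra.
Qed.

Definition cn k : R := Num.sqrt ((2 * k.+2%:R ^+ 3 - 2 * k.+2%:R) / pi).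

Definition energy P Q n N : R :=
  green_coef R P Q n * (\sum_(t < n.+1) (wt P Q t.+1)%:R * beta5 R (N + t))
  - 2 / (wt P Q n.+3)%:R * beta5 R (N + n.+1).

Lemma mu_mulC i j p : mu i p * (mu j p)^*%C =
  (cn i * cn j / 16)%:C%C * ((1 - (sqmod p)%:C%C) ^+ 4 * zmon j i p) :> C.
Proof.
rewrite /mu -/(cn i) -/(cn j) /zmon.
have cj (x y : C) : (x * y)^*%C = x^*%C * y^*%C by exact: rmorphM.
have cX (x : C) k : (x ^+ k)^*%C = x^*%C ^+ k by exact: rmorphXn.
rewrite cj cX conjcK conjc_real.
have E : 1 - (sqmod p)%:C%C = (1 - sqmod p)%:C%C :> C by rewrite rmorphB rmorph1.
have K : (cn i * cn j / 16)%:C%C * (1 - (sqmod p)%:C%C) ^+ 4 =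
  (((1 - sqmod p) ^+ 2 / 4) * cn i)%:C%C * (((1 - sqmod p) ^+ 2 / 4) * cn j)%:C%C :> C.
  by rewrite E -rmorphXn -!rmorphM; congr (_%:C)%C; rewrite /=; field.
by rewrite [RHS]mulrA K; ring.
Qed.

Lemma green_coefC P Q n : green_coef C P Q n = (green_coef R P Q n)%:C%C.
Proof. by rewrite /green_coef fmorph_div !rmorphM !rmorph_nat. Qed.

Lemma cdisk_int_bump P Q t l k :
  cdisk_int (fun p => bump_mon P Q t p * (zmon l k p * (1 - (sqmod p)%:C%C) ^+ 2)) =
  if (P + l == Q + k)%N then (area R * beta5 R (P + l + t))%:C%C else 0.
Proof.
transitivity (cdisk_int (fun p => @zmon R (P + l + t) (Q + k + t) p * (1 - (sqmod p)%:C%C) ^+ 4)).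
  apply: eq_cdisk_int => p _; rewrite bump_monE /zmon.
  by rewrite -!addnA ![(_ + t)%N]addnC !exprD; ring.
by rewrite cdisk_int_zmon_weight eqn_add2r.
Qed.

Lemma cdisk_int_green P Q n l k :
  cdisk_int (fun p => green_poly P Q n p * (zmon l k p * (1 - (sqmod p)%:C%C) ^+ 2)) =
  if (P + l == Q + k)%N then (area R * energy P Q n (P + l))%:C%C else 0.
Proof.
have pw : cpolyfun (fun p => @zmon R l k p * (1 - (sqmod p)%:C%C) ^+ 2).
  rewrite (_ : (fun p => _) = @bump_mon R l k 0); first exact: cpolyfun_bump_mon.
  by apply/funext => p; rewrite bump_monE !addn0.
have pb t : cpolyfun (fun p => @bump_mon R P Q t p * (zmon l k p * (1 - (sqmod p)%:C%C) ^+ 2)).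
  by apply: cpolyfunM => //; exact: cpolyfun_bump_mon.
have pc (c : C) t : cpolyfun (fun p => c * (@bump_mon R P Q t p * (zmon l k p * (1 - (sqmod p)%:C%C) ^+ 2))).
  by apply: cpolyfunM => //; exact: cpolyfun_cst.
have ps : cpolyfun (fun p => \sum_(t < n.+1) ((wt P Q t.+1)%:R *
    (@bump_mon R P Q t p * (zmon l k p * (1 - (sqmod p)%:C%C) ^+ 2)))).
  by apply: cpolyfun_sum => t; exact: pc.
transitivity (cdisk_int (fun p => green_coef C P Q n * (\sum_(t < n.+1) ((wt P Q t.+1)%:R *
    (@bump_mon R P Q t p * (zmon l k p * (1 - (sqmod p)%:C%C) ^+ 2))))
    + (- (2 / (wt P Q n.+3)%:R)) * (@bump_mon R P Q n.+1 p * (zmon l k p * (1 - (sqmod p)%:C%C) ^+ 2)))).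
  apply: eq_cdisk_int => p _; rewrite /green_poly; set W := zmon l k p * _.
  rewrite [X in _ = _ * X + _](_ : _ = (\sum_(t < n.+1) (wt P Q t.+1)%:R * bump_mon P Q t p) * W).
    by ring.
  by rewrite mulr_suml; apply: eq_bigr => t _; rewrite mulrA.
rewrite cdisk_intD//; last first.
  by apply: cpolyfunM => //; exact: cpolyfun_cst.
rewrite !cdisk_intZ// cdisk_int_sum//.
under eq_bigr do rewrite cdisk_intZ// cdisk_int_bump.
rewrite cdisk_int_bump; case: eqP => _; last first.
  by rewrite big1 ?mulr0 ?addr0// => t _; rewrite mulr0.
rewrite green_coefC -!(rmorph_nat (real_complex R)) -fmorph_div -rmorphN.
under eq_bigr do rewrite -(rmorph_nat (real_complex R)) -rmorphM.
rewrite -rmorph_sum -!rmorphM -rmorphD; congr (_%:C)%C; rewrite /energy /=.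
rewrite [X in _ * X + _ = _](_ : _ = area R * (\sum_(t < n.+1) (wt P Q t.+1)%:R * beta5 R (P + l + t))).
  by ring.
by rewrite mulr_sumr; apply: eq_bigr => t _; rewrite mulrCA.
Qed.

(** The product of mu_i and the conjugate of mu_j is a multiple of (1 - |z|^2)^4 z^j zbar^i.
    Extracting the common power min(i, j) leaves exponents P, Q with P Q = 0, where [green_poly]
    applies. The factor 1/64 is 1/16 for each product times the 4 in [rho], whose denominator
    cancels half of the remaining fourth power. *)
Lemma integral_dA_entry i j k l :
  integral_dA (fun p => opD (fun q => mu i q * (mu j q)^*%C) p * (mu k p * (mu l p)^*%C)) =
  (if (i + k == j + l)%N then
     area R * (cn i * cn j * cn k * cn l / 64) *
     energy (j - minn i j) (i - minn i j) (minn i j) (j - minn i j + l)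
   else 0)%:C%C.
Proof.
set n := minn i j; set P := (j - n)%N; set Q := (i - n)%N.
have jE : j = (P + n)%N by rewrite /P /n; lia.
have iE : i = (Q + n)%N by rewrite /Q /n; lia.
have PQ : (P * Q = 0)%N by rewrite /P /Q /n; nia.
pose c : C := (cn i * cn j / 16)%:C%C.
have [L hL] := has_ddbar_green_poly P Q n.
have D : is_opD (fun q => mu i q * (mu j q)^*%C) (fun p => c * green_poly P Q n p).
  rewrite (_ : (fun q => _) = fun q => c * ((1 - (sqmod q)%:C%C) ^+ 4 * zmon (P + n) (Q + n) q)).
    by apply: is_opDZ hL _; [exact: cpolyfun_green_poly|exact: is_opD_green_poly].
  by apply/funext => q; rewrite mu_mulC -jE -iE.
have E p : disk p -> opD (fun q => mu i q * (mu j q)^*%C) p * (mu k p * (mu l p)^*%C) * (rho p)%:C%C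
    = (cn i * cn j * cn k * cn l / 64)%:C%C *
      (green_poly P Q n p * (zmon l k p * (1 - (sqmod p)%:C%C) ^+ 2)).
  move=> dp; rewrite (opDE D dp) mu_mulC /c.
  have p1 : 1 - sqmod p != 0 by rewrite subr_eq0 gt_eqF//; exact: dp.
  have e : 1 - (sqmod p)%:C%C = (1 - sqmod p)%:C%C :> C by rewrite rmorphB rmorph1.
  rewrite e -!rmorphXn.
  have -> : (cn i * cn j * cn k * cn l / 64)%:C%C * (green_poly P Q n p * (zmon l k p * ((1 - sqmod p) ^+ 2)%:C%C))
    = ((cn i * cn j * cn k * cn l / 64) * (1 - sqmod p) ^+ 2)%:C%C * (green_poly P Q n p * zmon l k p) :> C.
    by rewrite rmorphM; ring.
  have -> : (cn i * cn j * cn k * cn l / 64) * (1 - sqmod p) ^+ 2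
     = (cn i * cn j / 16) * (cn k * cn l / 16) * (1 - sqmod p) ^+ 4 * rho p.
    by rewrite /rho; field.
  by rewrite !rmorphM; ring.
have -> : integral_dA (fun p => opD (fun q => mu i q * (mu j q)^*%C) p * (mu k p * (mu l p)^*%C)) =
  cdisk_int (fun p => opD (fun q => mu i q * (mu j q)^*%C) p * (mu k p * (mu l p)^*%C) * (rho p)%:C%C).
  rewrite /integral_dA /cdisk_int /disk_int; congr (_ +i* _)%C; apply: eq_Rintegral => p _;
  by case: (opD _ _ * _) => x y /=; rewrite mulr0 ?subr0 ?add0r.
rewrite (eq_cdisk_int E) cdisk_intZ; last first.
  apply: cpolyfunM; first exact: cpolyfun_green_poly.
  rewrite (_ : (fun p => _) = @bump_mon R l k 0); first exact: cpolyfun_bump_mon.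
  by apply/funext => p; rewrite bump_monE !addn0.
rewrite cdisk_int_green.
have -> : (P + l == Q + k)%N = (i + k == j + l)%N by apply/eqP/eqP; lia.
case: eqP => _; last by rewrite mulr0.
by rewrite -rmorphM; congr (_%:C)%C; rewrite /=; ring.
Qed.

End CurvatureEntries.

(** * The entries as rational functions of the indices *)

Section ClosedForm.
Context (R : realType).
Local Notation C := R[i].

(** Closed form of [energy], with m = |i - j|, a = min(i, j) and b = min(k, l). Real arguments turn
    symmetry and rescaling into identities between rational functions. *)
Definition Iker_num (m a b : R) : R :=
  4 * (2 * a + m + 4) / ((a + 1) * (a + 2) * (a + 3) * (a + m + 1) * (a + m + 2) * (a + m + 3))
   * (2 * (2 * m + 2 + b) / ((m + b + 1) * (m + b + 2) * (m + b + 3))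
      - 24 * (1 / (2 * (m + a + b + 2) * (m + a + b + 3))
              - (7 + m + 2 * b) / (3 * (m + a + b + 2) * (m + a + b + 3) * (m + a + b + 4))
              + (4 + m + b) * (4 + b) /
                (4 * (m + a + b + 2) * (m + a + b + 3) * (m + a + b + 4) * (m + a + b + 5))))
  - 48 / ((a + 3) * (a + m + 3) * (m + a + b + 2) * (m + a + b + 3) * (m + a + b + 4)
          * (m + a + b + 5) * (m + a + b + 6)).

(** This reflects the self-adjointness of D: the pair (i, j) under D may be exchanged with the pair
    (k, l). Here it is a verified rational identity. *)
Lemma Iker_num_sym (m a b : R) : 0 <= m -> 0 <= a -> 0 <= b ->
  Iker_num m a b = Iker_num m b a.
Proof.
move=> m0 a0 b0; rewrite /Iker_num.
field.
by do ![apply/andP; split]; apply: lt0r_neq0; lra.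
Qed.

(* Antiderivative of the summand, found by expanding [(t+1)(t+1+m)] in rising factors of
   [u = m + b + t + 1]. *)
Definition Iker_prim (m b u : R) : R :=
  1 / (2 * u * (u + 1)) - (7 + m + 2 * b) / (3 * u * (u + 1) * (u + 2))
  + (4 + m + b) * (4 + b) / (4 * u * (u + 1) * (u + 2) * (u + 3)).

Lemma Iker_primB (m b t : R) : 0 <= m -> 0 <= b -> 0 <= t ->
  (t + 1) * (t + 1 + m) / ((m + b + t + 1) * (m + b + t + 2) * (m + b + t + 3)
     * (m + b + t + 4) * (m + b + t + 5))
  = Iker_prim m b (m + b + t + 1) - Iker_prim m b (m + b + t + 2).
Proof.
move=> m0 b0 t0; rewrite /Iker_prim; field.
by do ![apply/andP; split]; apply: lt0r_neq0; lra.
Qed.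

Lemma beta5_natr n (x : R) : x = n%:R ->
  beta5 R n = 24 / ((x + 1) * (x + 2) * (x + 3) * (x + 4) * (x + 5)).
Proof.
move=> ->; rewrite /beta5 -[n.+4.+1]/(5 + n)%N -[n.+4]/(4 + n)%N -[n.+3]/(3 + n)%N.
by rewrite -[n.+2]/(2 + n)%N -[n.+1]/(1 + n)%N !natrD ![_ + n%:R]addrC.
Qed.

Lemma wt_natr P Q t (m s : R) : (P * Q = 0)%N -> m = (P + Q)%:R -> s = t%:R ->
  (wt P Q t)%:R = s * (s + m).
Proof.
move=> PQ -> ->; rewrite -natrD -natrM; congr _%:R; rewrite /wt; nia.
Qed.

Lemma sum_wt_beta5 P Q n b (m y : R) : (P * Q = 0)%N -> m = (P + Q)%:R -> y = b%:R ->
  \sum_(t < n.+1) (wt P Q t.+1)%:R * beta5 R (P + Q + b + t) =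
  24 * (Iker_prim m y (m + y + 1) - Iker_prim m y (m + y + n%:R + 2)).
Proof.
move=> PQ mE yE; have m0 : 0 <= m by rewrite mE. have y0 : 0 <= y by rewrite yE.
have term t : (wt P Q t.+1)%:R * beta5 R (P + Q + b + t) =
    24 * (Iker_prim m y (m + y + t%:R + 1) - Iker_prim m y (m + y + t%:R + 2)).
  rewrite -(Iker_primB m0 y0 (ler0n R t)).
  rewrite (@wt_natr P Q t.+1 m (t%:R + 1) PQ mE) ?natr1//.
  rewrite (@beta5_natr _ (m + y + t%:R)); last by rewrite mE yE !natrD.
  by rewrite mulrC; ring.
elim: n => [|n IH]; first by rewrite big_ord1 term addr0.
have e : n.+1%:R = n%:R + 1 :> R by rewrite natr1.
rewrite big_ord_recr/= IH term e.
have -> : m + y + (n%:R + 1) + 1 = m + y + n%:R + 2 by ring.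
by ring.
Qed.

Definition Iker (m a b : nat) : R := Iker_num m%:R a%:R b%:R.

Lemma IkerC m a b : Iker m a b = Iker m b a.
Proof. exact: Iker_num_sym. Qed.

Lemma Iker_numE (m a b : R) : 0 <= m -> 0 <= a -> 0 <= b ->
  4 * (2 * a + 4 + m) / ((a + 1) * (a + 1 + m) * ((a + 2) * (a + 2 + m)) * ((a + 3) * (a + 3 + m)))
    * (24 * (Iker_prim m b (m + b + 1) - Iker_prim m b (m + b + a + 2)))
  - 2 / ((a + 3) * (a + 3 + m)) * (24 / ((m + b + a + 1 + 1) * (m + b + a + 1 + 2) *
     (m + b + a + 1 + 3) * (m + b + a + 1 + 4) * (m + b + a + 1 + 5))) = Iker_num m a b.
Proof.
move=> m0 a0 b0; rewrite /Iker_num.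
have -> : Iker_prim m b (m + b + 1) =
    2 * (2 * m + 2 + b) / ((m + b + 1) * (m + b + 2) * (m + b + 3)) / 24.
  rewrite /Iker_prim; field.
  by do ![apply/andP; split]; apply: lt0r_neq0; lra.
have -> : Iker_prim m b (m + b + a + 2) =
    1 / (2 * (m + a + b + 2) * (m + a + b + 3))
     - (7 + m + 2 * b) / (3 * (m + a + b + 2) * (m + a + b + 3) * (m + a + b + 4))
     + (4 + m + b) * (4 + b) /
       (4 * (m + a + b + 2) * (m + a + b + 3) * (m + a + b + 4) * (m + a + b + 5)).
  by rewrite /Iker_prim; congr (_ / _ - _ / _ + _ / _); ring.
set X := _ / (_ * _ * _) / 24; set Y := _ - _ + _.
have -> : 24 * (X - Y) = 24 * X - 24 * Y by ring.
congr (_ * (_ - _) - _).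
- by congr (_ / _); ring.
- by rewrite /X; field; do ![apply/andP; split]; apply: lt0r_neq0; lra.
- by field; do ![apply/andP; split]; apply: lt0r_neq0; lra.
Qed.

Lemma energyE P Q n b : (P * Q = 0)%N -> energy R P Q n (P + Q + b) = Iker (P + Q) n b.
Proof.
move=> PQ; rewrite /energy (sum_wt_beta5 _ PQ erefl erefl) /green_coef.
have s1 : n%:R + 1 = n.+1%:R :> R by rewrite natr1.
have s2 : n%:R + 2 = n.+2%:R :> R by rewrite -natrD addn2.
have s3 : n%:R + 3 = n.+3%:R :> R by rewrite -natrD addn3.
rewrite (wt_natr PQ erefl s1) (wt_natr PQ erefl s2) (wt_natr PQ erefl s3).
rewrite (@beta5_natr _ ((P + Q)%:R + b%:R + n%:R + 1)); last first.
  by rewrite -!natrD natr1; congr _%:R; lia.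
have -> : (2 * n + 4 + P + Q)%:R = 2 * n%:R + 4 + (P + Q)%:R :> R.
  rewrite (_ : (2 * n + 4 + P + Q)%N = (n + n + 4 + (P + Q))%N); last by lia.
  by rewrite (natrD _ (n + n + 4)) (natrD _ (n + n)) (natrD _ n); ring.
rewrite /Iker.
move: (P + Q)%:R n%:R b%:R (ler0n R (P + Q)) (ler0n R n) (ler0n R b) => m a y m0 a0 y0.
exact: Iker_numE.
Qed.

(** One of the two integrals of the curvature tensor. The formula is meant for i + k = j + l, where
    |i - j| = |k - l| and a single m describes both pairs. *)
Definition curv_entry i j k l : R :=
  area R * (cn R i * cn R j * cn R k * cn R l / 64) *
  Iker (maxn i j - minn i j) (minn i j) (minn k l).

Lemma curv_tE i j k l : curv_t R i j k l =
  (if (i + k == j + l)%N then curv_entry i j k l + curv_entry i l k j else 0)%:C%C.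
Proof.
have E i' j' k' l' : (i' + k' = j' + l')%N ->
    energy R (j' - minn i' j') (i' - minn i' j') (minn i' j') (j' - minn i' j' + l') =
    Iker (maxn i' j' - minn i' j') (minn i' j') (minn k' l').
  move=> h; have -> : (maxn i' j' - minn i' j' = (j' - minn i' j') + (i' - minn i' j'))%N by lia.
  by rewrite -energyE; [congr energy; lia|nia].
rewrite /curv_t !integral_dA_entry [(l + j)%N]addnC.
case: eqP => h; last by rewrite addr0.
by rewrite -rmorphD (E i j k l)// (E i l k j) ?h 1?addnC.
Qed.

Lemma curv_entryC i j k l : (i + k = j + l)%N -> curv_entry i j k l = curv_entry k l i j.
Proof.
move=> h; rewrite /curv_entry.
have -> : (maxn k l - minn k l = maxn i j - minn i j)%N by lia.
rewrite IkerC; congr (_ * _ * _); ring.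
Qed.

Lemma curv_entry_conj i j k l : (i + k = j + l)%N -> curv_entry i j k l = curv_entry j i l k.
Proof.
by move=> h; rewrite /curv_entry ![minn j i]minnC ![maxn j i]maxnC [minn l k]minnC; congr (_ * _ * _); ring.
Qed.

End ClosedForm.

(** * Size estimates for the entries *)

Section Bounds.
Context (R : realType).

(** With N = n + 2, this is (N - 1) N (N + 1) = (2 N^3 - 2 N) / 2, so [cn] is its square root up to
    the factor sqrt(2 / pi). *)
Definition cube (n : nat) : R := (n%:R + 1) * (n%:R + 2) * (n%:R + 3).
Definition cubert n : R := Num.sqrt (cube n).

Lemma cube_gt0 n : 0 < cube n.
Proof. by rewrite /cube !mulr_gt0// ltr_wpDl. Qed.

Lemma cnE n : cn R n = Num.sqrt (2 / pi) * cubert n.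
Proof.
rewrite /cn /cubert -sqrtrM; last by rewrite divr_ge0// pi_ge0.
congr Num.sqrt; rewrite /cube.
have -> : n.+2%:R = n%:R + 2 :> R by rewrite -natrD addn2.
have := lt0r_neq0 (pi_gt0 R); move: pi => x x0; by field.
Qed.

Lemma kappa_bounds : 0 <= 2 / pi :> R /\ 2 / pi <= 1 :> R.
Proof.
split; first by rewrite divr_ge0// pi_ge0.
by rewrite ler_pdivrMr ?pi_gt0// mul1r pi_ge2.
Qed.

Lemma cn4 a b c d : cn R a * cn R b * cn R c * cn R d =
  (2 / pi) ^+ 2 * (cubert a * cubert b) * (cubert c * cubert d).
Proof.
rewrite !cnE -[X in X ^+ 2](@sqr_sqrtr _ (2 / pi)); last exact: (kappa_bounds).1.
by ring.
Qed.

Lemma cubert_sqr n : cubert n ^+ 2 = cube n.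
Proof. by rewrite sqr_sqrtr// ltW// cube_gt0. Qed.

Lemma cubert_ge0 n : 0 <= cubert n. Proof. exact: sqrtr_ge0. Qed.

(** The true size is ((a + 1)(a + m + 1))^(3/2). Shifting half a power towards the smaller factor
    gives a lower bound without roots; shifting it towards the larger one gives the upper bound that
    follows. *)
Lemma cubert2_ge a m :
  (a%:R + 1) ^+ 2 * (a%:R + m%:R + 1) <= cubert a * cubert (a + m).
Proof.
have a0 : 0 <= a%:R :> R by []. have m0 : 0 <= m%:R :> R by [].
rewrite -(@ler_pXn2r _ 2) ?nnegrE ?mulr_ge0 ?cubert_ge0 ?exprn_ge0//; try lra.
rewrite [X in _ <= X]exprMn !cubert_sqr /cube natrD.
move: a%:R m%:R a0 m0 => x y x0 y0.
have h1 : (x + 1) ^+ 3 <= (x + 1) * (x + 2) * (x + 3) by nra.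
have h2 : (x + 1) * (x + y + 1) ^+ 2 <= (x + y + 1) * (x + y + 2) * (x + y + 3) by nra.
apply: le_trans (ler_pM _ _ h1 h2); last 2 first.
- by rewrite exprn_ge0//; lra.
- by rewrite mulr_ge0 ?exprn_ge0//; lra.
by rewrite le_eqVlt; apply/orP; left; apply/eqP; ring.
Qed.

Lemma cubert2_le a m :
  cubert a * cubert (a + m) <= 6 * (a%:R + 1) * (a%:R + m%:R + 1) ^+ 2.
Proof.
have a0 : 0 <= a%:R :> R by []. have m0 : 0 <= m%:R :> R by [].
rewrite -(@ler_pXn2r _ 2) ?nnegrE ?mulr_ge0 ?cubert_ge0 ?exprn_ge0//; try lra.
rewrite [X in X <= _]exprMn !cubert_sqr /cube natrD.
move: a%:R m%:R a0 m0 => x y x0 y0.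
have h1 : (x + 1) * (x + 2) * (x + 3) <= 6 * ((x + 1) ^+ 2 * (x + y + 1)) by nra.
have h2 : (x + y + 1) * (x + y + 2) * (x + y + 3) <= 6 * (x + y + 1) ^+ 3 by nra.
apply: le_trans (ler_pM _ _ h1 h2) _.
- by rewrite !mulr_ge0//; lra.
- by rewrite !mulr_ge0//; lra.
by rewrite le_eqVlt; apply/orP; left; apply/eqP; ring.
Qed.


Lemma beta5_le N (B : R) : 0 < B -> B <= N%:R + 1 -> 0 <= beta5 R N <= 24 / B ^+ 5.
Proof.
move=> B0 BN; rewrite (@beta5_natr _ N N%:R erefl).
have D0 : 0 < (N%:R + 1) * (N%:R + 2) * (N%:R + 3) * (N%:R + 4) * (N%:R + 5) :> R.
  by rewrite !mulr_gt0// ltr_wpDl.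
apply/andP; split; first by rewrite divr_ge0// ltW.
rewrite ler_pM2l// lef_pV2 ?posrE ?exprn_gt0//.
have -> : B ^+ 5 = B * B * B * B * B by ring.
by do 4![apply: ler_pM; [by rewrite ?mulr_ge0 ?(ltW B0)|exact: ltW| |by lra]]; lra.
Qed.

(** The closed form hides cancellations, so the estimate is made on the sum in [energy] with P = 0
    and Q = m: it has a + 1 nonnegative terms, each at most (a + 1) A * 24 / B^5. *)
Lemma Iker_le m a b (A B : R) : A = a%:R + m%:R + 1 -> B = b%:R + m%:R + 1 ->
  `|Iker R m a b| <= 16 * A / (cubert a * cubert (a + m)) ^+ 2 *
     ((a%:R + 1) ^+ 2 * A * (24 / B ^+ 5)) + 2 / ((a%:R + 1) * A) * (24 / B ^+ 5).
Proof.
move=> AE BE; have a0 : 0 <= a%:R :> R by []. have m0 : 0 <= m%:R :> R by [].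
have b0 : 0 <= b%:R :> R by [].
have B0 : 0 < B by lra. have A0 : 0 < A by lra.
rewrite -[m in Iker _ m]add0n -(@energyE R 0 m a b)// /energy !add0n.
have w0 t : 0 <= (wt 0 m t)%:R :> R by [].
have wtE t : (wt 0 m t.+1)%:R = (t%:R + 1) * (t%:R + 1 + m%:R) :> R.
  by rewrite (@wt_natr R 0 m t.+1 m%:R (t%:R + 1))// natr1.
have bt t : 0 <= beta5 R (m + b + t) <= 24 / B ^+ 5.
  by apply: beta5_le => //; rewrite BE !natrD; have : 0 <= t%:R :> R by []; lra.
have prodE : (wt 0 m a.+1)%:R * (wt 0 m a.+2)%:R * (wt 0 m a.+3)%:R
    = (cubert a * cubert (a + m)) ^+ 2 :> R.
  have a21 : a.+1%:R = a%:R + 1 :> R by rewrite natr1.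
  have a22 : a.+2%:R = a%:R + 2 :> R by rewrite -natrD addn2.
  by rewrite exprMn !cubert_sqr /cube !wtE natrD a21 a22; ring.
have g0 : 0 <= green_coef R 0 m a.
  by rewrite /green_coef divr_ge0// !mulr_ge0.
have gle : green_coef R 0 m a <= 16 * A / (cubert a * cubert (a + m)) ^+ 2.
  rewrite /green_coef prodE ler_wpM2r ?invr_ge0 ?sqr_ge0//.
  rewrite (_ : (2 * a + 4 + 0 + m)%N = (a + a + 4 + m)%N); last by lia.
  by rewrite !natrD AE; lra.
have s0 : 0 <= \sum_(t < a.+1) (wt 0 m t.+1)%:R * beta5 R (m + b + t).
  by apply: sumr_ge0 => t _; rewrite mulr_ge0//; have /andP[] := bt t.
have sle : \sum_(t < a.+1) (wt 0 m t.+1)%:R * beta5 R (m + b + t) <=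
    (a%:R + 1) ^+ 2 * A * (24 / B ^+ 5).
  apply: (@le_trans _ _ (\sum_(t < a.+1) (a%:R + 1) * A * (24 / B ^+ 5))).
    apply: ler_sum => t _; have /andP[h1 h2] := bt t.
    apply: ler_pM => //; rewrite wtE AE.
    have ta : t%:R <= a%:R :> R by rewrite ler_nat -ltnS.
    have t0 : 0 <= t%:R :> R by [].
    by apply: ler_pM; lra.
  rewrite sumr_const card_ord -mulr_natl -natr1 le_eqVlt; apply/orP; left.
  by apply/eqP; ring.
rewrite (le_trans (ler_normB _ _))// lerD//.
  by rewrite ger0_norm ?mulr_ge0// ler_pM.
have /andP[h1 h2] := bt a.+1.
rewrite ger0_norm; last by rewrite mulr_ge0 ?divr_ge0.
apply: ler_pM => //.
have a23 : a.+2%:R = a%:R + 2 :> R by rewrite -natrD addn2.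
have aA0 : 0 < (a%:R + 1) * A by rewrite mulr_gt0//; lra.
have aAw : (a%:R + 1) * A <= (wt 0 m a.+3)%:R by rewrite wtE a23 AE; nra.
by rewrite ler_pM2l// lef_pV2 ?posrE//; apply: lt_le_trans aAw.
Qed.

(** The lower bound on s absorbs s^2 in the first term of [Iker_le], the upper bound treats the
    second. The constants are 672 = 16 * 24 + 6 * 2 * 24 and 4032 = 6 * 672, the last 6 coming from
    the upper bound on r. *)
Lemma curv_entry_aux m a b (A B : R) : A = a%:R + m%:R + 1 -> B = b%:R + m%:R + 1 ->
  (cubert a * cubert (a + m)) * (cubert b * cubert (b + m)) * `|Iker R m a b| <=
  4032 * (A * (b%:R + 1) / B ^+ 3).
Proof.
move=> AE BE; have a0 : 0 <= a%:R :> R by []. have m0 : 0 <= m%:R :> R by [].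
have b0 : 0 <= b%:R :> R by [].
have B0 : 0 < B by lra. have A0 : 0 < A by lra.
have := Iker_le AE BE.
have := cubert2_ge a m; have := cubert2_le a m; have := cubert2_le b m.
rewrite -AE -BE.
set s := cubert a * _; set r := cubert b * _; set a1 := a%:R + 1; set b1 := b%:R + 1.
have a10 : 0 < a1 by rewrite /a1; lra. have b10 : 0 < b1 by rewrite /b1; lra.
have r0 : 0 <= r by rewrite mulr_ge0 ?cubert_ge0.
move=> rle sle sge Ile.
have s0 : 0 < s by apply: lt_le_trans sge; rewrite mulr_gt0 ?exprn_gt0.
have h1 : s * (16 * A / s ^+ 2 * (a1 ^+ 2 * A * (24 / B ^+ 5))) <= 384 * A / B ^+ 5.
  have -> : s * (16 * A / s ^+ 2 * (a1 ^+ 2 * A * (24 / B ^+ 5))) =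
      384 * A / B ^+ 5 * ((a1 ^+ 2 * A) / s) by field; rewrite !gt_eqF.
  have c0 : 0 <= 384 * A / B ^+ 5 by apply: divr_ge0; [lra|apply: exprn_ge0; lra].
  by apply: ler_piMr c0 _; rewrite ler_pdivrMr// mul1r.
have h2 : s * (2 / (a1 * A) * (24 / B ^+ 5)) <= 288 * A / B ^+ 5.
  have -> : 288 * A / B ^+ 5 = 6 * a1 * A ^+ 2 * (2 / (a1 * A) * (24 / B ^+ 5)).
    by field; rewrite !gt_eqF.
  by rewrite ler_wpM2r// !mulr_ge0// ?invr_ge0 ?exprn_ge0 ?mulr_ge0// ltW.
have h3 : s * `|Iker R m a b| <= 672 * A / B ^+ 5.
  apply: le_trans (ler_wpM2l (ltW s0) Ile) _; rewrite mulrDr.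
  by apply: le_trans (lerD h1 h2) _; lra.
rewrite mulrAC; apply: le_trans (ler_pM _ _ h3 rle) _ => //.
  by rewrite mulr_ge0// ltW.
rewrite le_eqVlt; apply/orP; left; apply/eqP.
by field; rewrite gt_eqF.
Qed.

(** The constant is 4032 * 4 / 64, from an area of at most 4 and 2 / pi <= 1. The index relation
    lets both pairs share the same m. *)
Lemma curv_entry_le i j k l (A B : R) : (i + k = j + l)%N ->
  A = (maxn i j)%:R + 1 -> B = (maxn k l)%:R + 1 ->
  `|curv_entry R i j k l| <= 252 * (A * ((minn k l)%:R + 1) / B ^+ 3).
Proof.
move=> h AE BE; rewrite /curv_entry.
set m := (maxn i j - minn i j)%N.
have mi : maxn i j = (minn i j + m)%N by rewrite /m; lia.
have mk : maxn k l = (minn k l + m)%N by rewrite /m; lia.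
have -> : cn R i * cn R j * cn R k * cn R l =
    cn R (minn i j) * cn R (minn i j + m) * cn R (minn k l) * cn R (minn k l + m).
  rewrite -mi -mk; have [ij|/ltnW ij] := leqP i j; have [kl|/ltnW kl] := leqP k l; ring.
rewrite cn4; set s := cubert _ * _; set r := cubert _ * _.
have sr0 : 0 <= s * r by rewrite !mulr_ge0 ?cubert_ge0.
have /andP[ar1 ar4] := area_bounds R.
have [k0 k1] := kappa_bounds.
have AE' : A = (minn i j)%:R + m%:R + 1 by rewrite AE mi natrD.
have BE' : B = (minn k l)%:R + m%:R + 1 by rewrite BE mk natrD.
have := curv_entry_aux AE' BE'; rewrite -/s -/r.
set X := A * _ / _ => hX.
have -> : area R * ((2 / pi) ^+ 2 * s * r / 64) * Iker R m (minn i j) (minn k l)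
    = (area R / 64 * (2 / pi) ^+ 2) * (s * r * Iker R m (minn i j) (minn k l)).
  by rewrite !mulrA; ring.
have -> : 252 * X = (4 / 64 * 1) * (4032 * X) by field.
rewrite normrM; apply: ler_pM => //.
  rewrite ger0_norm; last by rewrite mulr_ge0 ?sqr_ge0// divr_ge0//; lra.
  apply: ler_pM; rewrite ?sqr_ge0 ?divr_ge0//; [lra|lra|].
  by rewrite exprn_ile1.
by rewrite normrM ger0_norm.
Qed.

End Bounds.

(** * Uniformly bounded row sums *)

Section RowSums.
Context (R : realType).
Local Notation C := R[i].

(** A majorant of degree -1 in (i + 1, l + 1), the same homogeneity as the limit kernel, yet with
    bounded row sums. *)
Definition decay (i l : nat) : R := ((minn i l)%:R + 1) / ((maxn i l)%:R + 1) ^+ 2.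

Lemma decay_ge0 i l : 0 <= decay i l.
Proof. by rewrite divr_ge0// ?exprn_ge0// addr_ge0. Qed.

(** Up to l = i the terms sum to at most N / (i + 1); beyond, (i + 1) / (l + 1)^2 is at most (i + 1)
    / l - (i + 1) / (l + 1) and telescopes. The two-branch bound lets one induction cover both
    regimes; its branches agree at N = i + 1. *)
Lemma sum_decay_le i N : \sum_(l < N) decay i l <= 2.
Proof.
suff : \sum_(l < N) decay i l <= if (N <= i.+1)%N then N%:R / (i%:R + 1) else 2 - (i%:R + 1) / N%:R.
  move=> /le_trans; apply; have i0 : 0 < i%:R + 1 :> R by rewrite ltr_wpDl.
  case: ifPn => [Ni|_].
    rewrite ler_pdivrMr//; have : N%:R <= i.+1%:R :> R by rewrite ler_nat.
    by rewrite -natr1; have : 0 <= i%:R :> R by []; lra.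
  by rewrite gerBl divr_ge0// ltW.
have i0 : 0 <= i%:R :> R by [].
elim: N => [|N IH]; first by rewrite big_ord0 mul0r.
rewrite big_ord_recr/=; apply: le_trans (lerD IH (lexx _)) _.
have N0 : 0 <= N%:R :> R by [].
have NS : N.+1%:R = N%:R + 1 :> R by rewrite natr1.
rewrite NS /decay ltnS; case: (ltngtP N i.+1) => [Ni|iN|->].
- have {}Ni : (N <= i)%N by lia.
  rewrite ifT; last by lia. rewrite (minn_idPr Ni) (maxn_idPl Ni).
  have Nr : N%:R <= i%:R :> R by rewrite ler_nat.
  rewrite -subr_ge0.
  have -> : (N%:R + 1) / (i%:R + 1) - (N%:R / (i%:R + 1) + (N%:R + 1) / (i%:R + 1) ^+ 2) =
    (i%:R - N%:R) / (i%:R + 1) ^+ 2 :> R by field; apply: lt0r_neq0; lra.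
  by rewrite divr_ge0 ?exprn_ge0//; lra.
- rewrite ifF; last by lia.
  have iN' : (i <= N)%N by lia.
  rewrite (minn_idPl iN') (maxn_idPr iN').
  have Np : 0 < N%:R :> R by rewrite ltr0n; lia.
  rewrite -subr_ge0.
  have -> : 2 - (i%:R + 1) / (N%:R + 1) - (2 - (i%:R + 1) / N%:R + (i%:R + 1) / (N%:R + 1) ^+ 2)
    = (i%:R + 1) / (N%:R * (N%:R + 1) ^+ 2) :> R.
    by field; apply/andP; split; apply: lt0r_neq0; lra.
  by rewrite divr_ge0 ?mulr_ge0 ?exprn_ge0//; lra.
- rewrite ?ltnn ?leqnn.
  have ii : (i <= i.+1)%N by lia.
  rewrite (minn_idPl ii) (maxn_idPr ii) -natr1 divff; last by apply: lt0r_neq0; lra.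
  rewrite -subr_ge0.
  have -> : 2 - (i%:R + 1) / (i%:R + 1 + 1) - (1 + (i%:R + 1) / (i%:R + 1 + 1) ^+ 2)
    = 1 / (i%:R + 1 + 1) ^+ 2 :> R.
    by field; apply: lt0r_neq0; lra.
  by rewrite divr_ge0 ?exprn_ge0//; lra.
Qed.

Definition curv_r i j k l : R :=
  if (i + k == j + l)%N then curv_entry R i j k l + curv_entry R i l k j else 0.

Lemma curv_tr i j k l : curv_t R i j k l = (curv_r i j k l)%:C%C.
Proof. exact: curv_tE. Qed.

Lemma curv_rC i j k l : curv_r i j k l = curv_r k l i j.
Proof.
rewrite /curv_r [(k + i)%N]addnC [(l + j)%N]addnC; case: eqP => // h.
rewrite (@curv_entryC _ i j k l) // (@curv_entryC _ i l k j)//; last by rewrite h addnC.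
Qed.

Lemma curv_r_conj i j k l : curv_r i j k l = curv_r j i l k.
Proof.
rewrite /curv_r [(j + l)%N == _]eq_sym; case: eqP => // h.
rewrite (@curv_entry_conj _ i j k l) //; congr (_ + _).
by rewrite (@curv_entry_conj _ i l k j) ?(@curv_entryC _ l i j k)//; lia.
Qed.

(* Of the two bounds given by [curv_entry_le] and its mirror image, one always has the larger
   index in the denominator. *)
Lemma curv_r_le i j k l : (j <= i)%N -> `|curv_r i j k l| <= 504 * decay i l.
Proof.
move=> ji; rewrite /curv_r; case: eqP => h; last first.
  by rewrite normr0; apply: mulr_ge0; [exact: ler0n|exact: decay_ge0].
have kl : (k <= l)%N by lia.
have i0 : 0 <= i%:R :> R by []. have j0 : 0 <= j%:R :> R by [].
have l0 : 0 <= l%:R :> R by []. have k0 : 0 <= k%:R :> R by [].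
have jir : j%:R <= i%:R :> R by rewrite ler_nat.
have klr : k%:R <= l%:R :> R by rewrite ler_nat.
have E1 : `|curv_entry R i j k l| <= 252 * decay i l.
  rewrite /decay; have [il|/ltnW li] := leqP i l.
    have := @curv_entry_le R i j k l _ _ h erefl erefl.
    rewrite (maxn_idPl ji) (minn_idPl kl) (maxn_idPr kl) => /le_trans; apply.
    apply: ler_wpM2l; first exact: ler0n.
    have -> : (i%:R + 1) / (l%:R + 1) ^+ 2 = (i%:R + 1) * (l%:R + 1) / (l%:R + 1) ^+ 3 :> R.
      by field; apply: lt0r_neq0; lra.
    by rewrite ler_wpM2r ?invr_ge0 ?exprn_ge0 ?ler_wpM2l//; lra.
  have := @curv_entry_le R k l i j _ _ _ erefl erefl; rewrite (@curv_entryC R k l i j); last by lia.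
  rewrite (maxn_idPl ji) (minn_idPr ji) (maxn_idPr kl) => /(_ _)/le_trans; apply; first by lia.
  apply: ler_wpM2l; first exact: ler0n.
  have -> : (l%:R + 1) / (i%:R + 1) ^+ 2 = (l%:R + 1) * (i%:R + 1) / (i%:R + 1) ^+ 3 :> R.
    by field; apply: lt0r_neq0; lra.
  by rewrite ler_wpM2r ?invr_ge0 ?exprn_ge0 ?ler_wpM2l//; lra.
have E2 : `|curv_entry R i l k j| <= 252 * decay i l.
  have := @curv_entry_le R k j i l _ _ _ erefl erefl; rewrite (@curv_entryC R k j i l); last by lia.
  move=> /(_ _)/le_trans; apply; first by lia.
  apply: ler_wpM2l; first exact: ler0n.
  rewrite /decay.
  set M := (maxn i l)%:R; set m := (minn i l)%:R.
  have M0 : 0 <= M by []. have m0 : 0 <= m by [].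
  have -> : (m + 1) / (M + 1) ^+ 2 = (M + 1) * (m + 1) / (M + 1) ^+ 3 :> R.
    by field; apply: lt0r_neq0; lra.
  rewrite ler_wpM2r ?invr_ge0 ?exprn_ge0 ?ler_wpM2r//; [lra|lra|].
  by rewrite lerD2r ler_nat; lia.
by apply: le_trans (ler_normD _ _) _; apply: le_trans (lerD E1 E2) _; lra.
Qed.

(** For given i, j and l at most one k satisfies i + k = j + l, so the double sum is bounded by 504
    times a row sum of [decay], hence by 504 * 2. Conjugation symmetry reduces to j <= i. *)
Lemma sum_curv_r_le i j N : \sum_(k < N) \sum_(l < N) `|curv_r i j k l| <= 1008.
Proof.
wlog ji : i j / (j <= i)%N => [H|].
  have [ij|/ltnW ij] := leqP j i; first exact: H.
  rewrite exchange_big/=; apply: le_trans (H j i ij).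
  by apply: ler_sum => k _; apply: ler_sum => l _; rewrite curv_r_conj.
rewrite exchange_big/=.
apply: (@le_trans _ _ (\sum_(l < N) 504 * decay i l)); last first.
  by rewrite -mulr_sumr; have := sum_decay_le i N; lra.
apply: ler_sum => l _.
have d0 : 0 <= 504 * decay i l by apply: mulr_ge0; [exact: ler0n|exact: decay_ge0].
have [h|h] := pselect (exists k : 'I_N, (i + k = j + l)%N); last first.
  rewrite big1// => k _; rewrite /curv_r; case: eqP => [e|]; last by rewrite normr0.
  by case: h; exists k.
have [k0 hk] := h; rewrite (bigD1 k0)//= big1 ?addr0; first exact: curv_r_le.
move=> k kk; rewrite /curv_r; case: eqP => [e|]; last by rewrite normr0.
by case/eqP: kk; apply/val_inj => /=; lia.
Qed.

End RowSums.

(** * Schur test *)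

Section Schur.
Context (R : realType) (I : choiceType) (E : nat -> seq I).
Hypothesis E_uniq : forall N, uniq (E N).
Hypothesis E_mono : forall M N, (M <= N)%N -> {subset E M <= E N}.
Hypothesis E_cover : forall i, exists N, i \in E N.
Implicit Types (V W : ell2 R I).

Lemma sum_uniq_subset (s t : seq I) (F : I -> R) : uniq s -> uniq t -> {subset s <= t} ->
  \sum_(i <- t) F i = \sum_(i <- s) F i + \sum_(i <- t | i \notin s) F i.
Proof.
move=> us ut st; rewrite (bigID (mem s))/=; congr (_ + _).
rewrite -big_filter; apply: perm_big; apply: uniq_perm => //; first exact: filter_uniq.
by move=> i; rewrite mem_filter; case: (boolP (i \in s)) => //= /st ->.
Qed.

Lemma ler_sum_subset (s t : seq I) (F : I -> R) : uniq s -> uniq t -> {subset s <= t} ->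
  (forall i, 0 <= F i) -> \sum_(i <- s) F i <= \sum_(i <- t) F i.
Proof.
by move=> us ut st F0; rewrite (sum_uniq_subset F us ut st) lerDl sumr_ge0.
Qed.

(** [sqsum] is a supremum over arbitrary finite sets, while all limits run along the exhaustion [E];
    this connects the two. *)
Lemma finite_set_sub_cover (A : set I) : finite_set A ->
  exists N, forall i, A i -> i \in E N.
Proof.
move=> /finite_seqP[s ->]; elim: s => [|i s [N hN]]; first by exists 0%N.
have [M hM] := E_cover i; exists (maxn M N) => j /=; rewrite inE => /orP[/eqP->|js].
  by apply: (E_mono (leq_maxl M N)).
by apply: (E_mono (leq_maxr M N)); exact: hN.
Qed.

Definition psum (f : I -> R) N : R := \sum_(i <- E N) f i ^+ 2.

Lemma psum_mono f : {homo psum f : M N / (M <= N)%N >-> M <= N}.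
Proof.
by move=> M N MN; apply: ler_sum_subset => // [|i]; [exact: E_mono|exact: sqr_ge0].
Qed.

Lemma sqsum_le (f : I -> R) (M : R) : (forall N, psum f N <= M) -> (sqsum f <= M%:E)%E.
Proof.
move=> fM; apply: ge_ereal_sup => _ [A [fA _] <-].
have [N hN] := finite_set_sub_cover fA.
rewrite fsbig_finite//= sumEFin lee_fin; apply: le_trans (fM N).
apply: ler_sum_subset => //= [i|i]; last exact: sqr_ge0.
by rewrite in_fset_set// => /set_mem /hN.
Qed.

Lemma psum_le_sqsum (f : I -> R) N : ((psum f N)%:E <= sqsum f)%E.
Proof.
apply: ereal_sup_ubound; exists [set` E N]; first by split => //; exact: finite_seq.
by rewrite -fsbig_seq// sumEFin.
Qed.

Lemma psum_le V N : psum V N <= `|V| ^+ 2.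
Proof. by have := psum_le_sqsum V N; rewrite ell2_normE lee_fin. Qed.

Lemma sqsummable_psum (f : I -> R) (M : R) : (forall N, psum f N <= M) -> f \in @sqsummable R I.
Proof. by move=> /sqsum_le h; apply/asboolP; apply: le_lt_trans h _; rewrite ltry. Qed.

Lemma norm_le_psum V (M : R) : (forall N, psum V N <= M) -> `|V| ^+ 2 <= M.
Proof. by move=> /sqsum_le; rewrite ell2_normE lee_fin. Qed.

Lemma cvg_psum V : psum V N @[N --> \oo] --> `|V| ^+ 2.
Proof.
have c : cvgn (psum V).
  apply: nondecreasing_is_cvgn; first exact: psum_mono.
  by exists (`|V| ^+ 2) => _ [N _ <-]; exact: psum_le.
suff <- : limn (psum V) = `|V| ^+ 2 by exact: c.
apply/eqP; rewrite eq_le; apply/andP; split.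
  by apply: limr_le => //; apply: nearW => N; exact: psum_le.
by apply: norm_le_psum => N; apply: nondecreasing_cvgn_le => //; exact: psum_mono.
Qed.

Lemma ell2_coord_le V i : `|V i| <= `|V|.
Proof.
have [N iN] := E_cover i.
rewrite -(@ler_pXn2r _ 2) ?nnegrE// real_normK ?num_real//.
apply: le_trans (psum_le V N); rewrite /psum (bigD1_seq i)//= lerDl.
by apply: sumr_ge0 => j _; exact: sqr_ge0.
Qed.

Variables (B : I -> I -> R) (C : R).
Hypothesis C_gt0 : 0 < C.
Hypothesis B_sym : forall i j, B i j = B j i.
Hypothesis B_row : forall i N, \sum_(j <- E N) `|B i j| <= C.

Definition prow (V : I -> R) N i : R := \sum_(j <- E N) B i j * V j.

(** Cauchy-Schwarz with weights |b j|: with S the weighted sum of |v j|, expand the nonnegative sum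
    of |b j| (|v j| - S / C)^2 and bound the total weight by C. *)
Lemma weighted_cauchy (s : seq I) (b v : I -> R) : \sum_(j <- s) `|b j| <= C ->
  (\sum_(j <- s) b j * v j) ^+ 2 <= C * \sum_(j <- s) `|b j| * v j ^+ 2.
Proof.
move=> bC; set S := \sum_(j <- s) `|b j| * `|v j|.
have h1 : (\sum_(j <- s) b j * v j) ^+ 2 <= S ^+ 2.
  rewrite -[X in X <= _]real_normK ?num_real// ler_pXn2r ?nnegrE//.
    by apply: le_trans (ler_norm_sum _ _ _) _; apply: ler_sum => j _; rewrite normrM.
  by apply: sumr_ge0 => j _; rewrite mulr_ge0.
apply: le_trans h1 _.
have : 0 <= \sum_(j <- s) `|b j| * (`|v j| - S / C) ^+ 2.
  by apply: sumr_ge0 => j _; rewrite mulr_ge0// sqr_ge0.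
have -> : \sum_(j <- s) `|b j| * (`|v j| - S / C) ^+ 2 =
   \sum_(j <- s) `|b j| * v j ^+ 2 - 2 * (S / C) * S + (S / C) ^+ 2 * \sum_(j <- s) `|b j|.
  rewrite {3}/S !mulr_sumr -sumrB -big_split/=; apply: eq_bigr => j _.
  by rewrite -[in RHS](real_normK (num_real (v j))); ring.
set T := \sum_(j <- s) _ * _; set w := \sum_(j <- s) _ => h.
have h2 : (S / C) ^+ 2 * w <= (S / C) ^+ 2 * C by rewrite ler_wpM2l// sqr_ge0.
have h3 : 2 * (S / C) * S - (S / C) ^+ 2 * C = S ^+ 2 / C by field; rewrite gt_eqF.
have : S ^+ 2 / C <= T by rewrite -h3; lra.
by rewrite ler_pdivrMr// mulrC.
Qed.

(** Weighted Cauchy-Schwarz costs one factor C per row; after exchanging the sums, symmetry of [B]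
    turns column sums into row sums and costs the second. *)
Lemma schur_finite (s : seq I) (V : I -> R) M : (forall i, \sum_(j <- s) `|B i j| <= C) ->
  \sum_(i <- E M) (\sum_(j <- s) B i j * V j) ^+ 2 <= C ^+ 2 * \sum_(j <- s) V j ^+ 2.
Proof.
move=> hs.
apply: (@le_trans _ _ (\sum_(i <- E M) C * \sum_(j <- s) `|B i j| * V j ^+ 2)).
  by apply: ler_sum => i _; exact: weighted_cauchy.
rewrite -mulr_sumr expr2 -mulrA ler_pM2l// exchange_big/= mulr_sumr.
apply: ler_sum => j _; rewrite -mulr_suml ler_wpM2r ?sqr_ge0//.
by under eq_bigr do rewrite B_sym.
Qed.

Lemma prow_le V N M : \sum_(i <- E M) prow V N i ^+ 2 <= C ^+ 2 * psum V N.
Proof. by apply: schur_finite. Qed.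

Lemma prowB_le V N K M : (N <= K)%N ->
  \sum_(i <- E M) (prow V K i - prow V N i) ^+ 2 <= C ^+ 2 * (psum V K - psum V N).
Proof.
move=> NK; set s := [seq j <- E K | j \notin E N].
have prowB i : prow V K i - prow V N i = \sum_(j <- s) B i j * V j.
  rewrite /prow (sum_uniq_subset _ (E_uniq N) (E_uniq K) (E_mono NK)) addrAC subrr add0r.
  by rewrite big_filter.
have psumB : psum V K - psum V N = \sum_(j <- s) V j ^+ 2.
  rewrite /psum (sum_uniq_subset _ (E_uniq N) (E_uniq K) (E_mono NK)) addrAC subrr add0r.
  by rewrite big_filter.
rewrite psumB; under eq_bigr do rewrite prowB.
apply: schur_finite => i; apply: le_trans (B_row i K).
by apply: ler_sum_subset => //; [exact: filter_uniq|move=> j; rewrite mem_filter => /andP[]].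
Qed.

(** Absolute convergence: x is written as (|x| + x) - |x|, and both parts have nondecreasing bounded
    partial sums along the exhaustion. *)
Lemma cvgn_prow V i : cvgn (prow V ^~ i).
Proof.
have sub (M N : nat) : (M <= N)%N -> forall F : I -> R, (forall j, 0 <= F j) ->
    \sum_(j <- E M) F j <= \sum_(j <- E N) F j.
  by move=> MN F F0; apply: ler_sum_subset => //; exact: E_mono.
have bnd N : \sum_(j <- E N) `|B i j * V j| <= C * `|V|.
  apply: (@le_trans _ _ (\sum_(j <- E N) `|B i j| * `|V|)).
    by apply: ler_sum => j _; rewrite normrM ler_wpM2l// ell2_coord_le.
  by rewrite -mulr_suml ler_wpM2r.
have c1 : cvgn (fun N => \sum_(j <- E N) `|B i j * V j|).
  apply: nondecreasing_is_cvgn; first by move=> M N MN; exact: sub.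
  by exists (C * `|V|) => _ [N _ <-].
have c2 : cvgn (fun N => \sum_(j <- E N) (`|B i j * V j| + B i j * V j)).
  apply: nondecreasing_is_cvgn.
    move=> M N MN; apply: sub => // j.
    by have := ler_norm (- (B i j * V j)); rewrite normrN; lra.
  exists (2 * (C * `|V|)) => _ [N _ <-]; apply: le_trans (_ : 2 * \sum_(j <- E N) `|B i j * V j| <= _).
    by rewrite mulr_sumr; apply: ler_sum => j _; have := ler_norm (B i j * V j); lra.
  by rewrite ler_pM2l.
have -> : prow V ^~ i = (fun N => \sum_(j <- E N) (`|B i j * V j| + B i j * V j))
    - (fun N => \sum_(j <- E N) `|B i j * V j|).
  apply/funext => N; rewrite fctE /= -sumrB /prow.
  by apply: eq_bigr => j _; rewrite [X in X - _]addrC addrK.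
exact: is_cvgB c2 c1.
Qed.

Definition schur_fun V i : R := limn (prow V ^~ i).

Lemma cvg_sum_seq (s : seq I) (u : nat -> I -> R) (l : I -> R) :
  (forall i, u N i @[N --> \oo] --> l i) ->
  (fun N => \sum_(i <- s) u N i) @ \oo --> \sum_(i <- s) l i.
Proof.
move=> ul; elim: s => [|i s IH].
  by rewrite big_nil; under eq_fun do rewrite big_nil; exact: cvg_cst.
rewrite big_cons; under eq_fun do rewrite big_cons.
by apply: cvgD; [exact: ul|exact: IH].
Qed.

Lemma psum_schur_fun V M : psum (schur_fun V) M <= C ^+ 2 * `|V| ^+ 2.
Proof.
have c : (fun N => \sum_(i <- E M) prow V N i ^+ 2) @ \oo --> psum (schur_fun V) M.
  apply: (@cvg_sum_seq _ (fun N i => prow V N i ^+ 2)) => i.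
  by apply: cvgM; exact: cvgn_prow.
rewrite -(cvg_lim _ c)//; apply: limr_le; first by apply/cvg_ex; eexists; exact: c.
apply: nearW => N; apply: le_trans (prow_le V N M) _.
by rewrite ler_wpM2l ?sqr_ge0// psum_le.
Qed.

Definition schur_op V : ell2 R I := Ell2 (sqsummable_psum (psum_schur_fun V)).

Lemma schur_tail V N M :
  \sum_(i <- E M) (schur_op V i - prow V N i) ^+ 2 <= C ^+ 2 * (`|V| ^+ 2 - psum V N).
Proof.
have c : (fun K => \sum_(i <- E M) (prow V K i - prow V N i) ^+ 2) @ \oo -->
    \sum_(i <- E M) (schur_op V i - prow V N i) ^+ 2.
  apply: (@cvg_sum_seq _ (fun K i => (prow V K i - prow V N i) ^+ 2)) => i.
  by apply: cvgM; apply: cvgB; do [exact: cvgn_prow|exact: cvg_cst].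
rewrite -(cvg_lim _ c)//; apply: limr_le; first by apply/cvg_ex; eexists; exact: c.
near=> K; apply: le_trans (@prowB_le V N K M _) _; first by near: K; exists N.
by rewrite ler_wpM2l ?sqr_ge0// lerD2r psum_le.
Unshelve. all: by end_near. Qed.

Lemma cvgn_dot V W : cvgn (fun N => \sum_(i <- E N) V i * W i).
Proof.
have c (U : ell2 R I) : cvgn (psum U) by apply/cvg_ex; eexists; exact: cvg_psum.
(* Polarisation reduces the convergence to that of partial sums of squares. *)
have -> : (fun N => \sum_(i <- E N) V i * W i) =
    (fun N => 4^-1 * (psum (V + W) N - psum (V - W) N)); last first.
  by apply: is_cvgM; [exact: is_cvg_cst|apply: is_cvgB; exact: c].
apply/funext => N; rewrite /psum -sumrB mulr_sumr; apply: eq_bigr => i _.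
have -> : (V + W) i = V i + W i by [].
have -> : (V - W) i = V i - W i by [].
by field.
Qed.

(** The form is a limit over square truncations, whereas [schur_op] takes the full row first. Their
    difference pairs W with the row tails; the weighted arithmetic-geometric inequality with
    parameter t, followed by [schur_tail], makes it tend to 0. *)
Lemma schur_op_form V W :
  limn (fun N => \sum_(i <- E N) schur_op V i * W i) =
  limn (fun N => \sum_(i <- E N) \sum_(j <- E N) V i * W j * B i j).
Proof.
set D := fun N => \sum_(i <- E N) schur_op V i * W i.
set F := fun N => \sum_(i <- E N) _.
have DF N (t : R) : 0 < t -> `|D N - F N| <= t * `|W| ^+ 2 + C ^+ 2 * (`|V| ^+ 2 - psum V N) / t.
  move=> t0; have -> : D N - F N = \sum_(i <- E N) W i * (schur_op V i - prow V N i).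
    rewrite /D /F exchange_big/= -sumrB; apply: eq_bigr => i _.
    rewrite mulrBr [W i * prow _ _ _]mulr_sumr [W i * _]mulrC; congr (_ - _).
    by apply: eq_bigr => j _; rewrite B_sym; ring.
  apply: le_trans (ler_norm_sum _ _ _) _.
  apply: (@le_trans _ _ (\sum_(i <- E N) (t * W i ^+ 2 + (schur_op V i - prow V N i) ^+ 2 / t))).
    apply: ler_sum => i _; rewrite normrM.
    set x := W i; set y := schur_op V i - _.
    have t0' : t != 0 by rewrite gt_eqF.
    have : 0 <= (t * `|x| - `|y|) ^+ 2 / t by rewrite divr_ge0 ?sqr_ge0// ltW.
    have -> : (t * `|x| - `|y|) ^+ 2 / t = t * x ^+ 2 + y ^+ 2 / t - 2 * (`|x| * `|y|).
      by rewrite -(real_normK (num_real x)) -(real_normK (num_real y)); field.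
    have : 0 <= `|x| * `|y| by rewrite mulr_ge0.
    lra.
  rewrite big_split/= -mulr_sumr -mulr_suml; apply: lerD.
    by rewrite ler_pM2l// psum_le.
  by rewrite ler_pM2r ?invr_gt0// schur_tail.
have DF0 : (fun N => D N - F N) @ \oo --> 0.
  apply/cvgr0Pnorm_le => e e0.
  have w0 : 0 < `|W| ^+ 2 + 1 by rewrite ltr_wpDl ?sqr_ge0.
  pose t := e / 2 / (`|W| ^+ 2 + 1).
  have t0 : 0 < t by rewrite !divr_gt0.
  have c2 : 0 < C ^+ 2 by rewrite exprn_gt0.
  have et : 0 < e / 2 * t / C ^+ 2 by rewrite !divr_gt0// mulr_gt0// divr_gt0.
  have := @cvg_psum V; move=> /cvgrPdist_le /(_ _ et) h.
  near=> N; apply: le_trans (DF N t t0) _.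
  have h1 : t * `|W| ^+ 2 <= e / 2.
    rewrite /t mulrAC ler_pdivrMr// ler_wpM2l//; [by rewrite divr_ge0// ltW|lra].
  have h2 : C ^+ 2 * (`|V| ^+ 2 - psum V N) / t <= e / 2.
    rewrite ler_pdivrMr// mulrC -ler_pdivlMr//; apply: le_trans (ler_norm _) _.
    by near: N.
  lra.
apply/esym/cvg_lim => //.
have -> : F = D - (fun N => D N - F N).
  by apply/funext => N; rewrite fctE /= opprB addrC subrK.
rewrite -[X in _ --> X]subr0; apply: cvgB; [exact: cvgn_dot|exact: DF0].
Unshelve. all: by end_near. Qed.

End Schur.

(** * Existence and coordinates of the curvature operator *)

Section CurvatureOperator.
Context (R : realType).
Local Notation C := R[i].

Lemma mem_frame_trunc (a : frame) N : (a \in frame_trunc N) = (frame_idx a < N)%N.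
Proof.
rewrite /frame_trunc mem_cat; case: a => k /=.
  rewrite (mem_map (inl_inj (B := nat))) mem_iota add0n.
  by rewrite [X in _ || X](_ : _ = false) ?orbF//; apply/negbTE/mapP => -[].
rewrite (mem_map (inr_inj (A := nat))) mem_iota add0n.
by rewrite [X in X || _](_ : _ = false)//; apply/negbTE/mapP => -[].
Qed.

Lemma uniq_frame_trunc N : uniq (frame_trunc N).
Proof.
rewrite cat_uniq !map_inj_uniq ?iota_uniq/=; [|by move=> ? ? []|by move=> ? ? []].
by rewrite andbT; apply/hasPn => x /mapP[k _ ->]; apply/mapP => -[].
Qed.

Lemma mem_wedge_trunc (e : wedge_basis) N :
  (e \in wedge_trunc N) = (frame_idx (val e).1 < N)%N && (frame_idx (val e).2 < N)%N.
Proof.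
rewrite mem_pmap_sub -!mem_frame_trunc; apply/allpairsP/andP => [[p [h1 h2 ->]]//|[h1 h2]].
by exists (val e); split => //; case: (val e).
Qed.

Lemma wedge_trunc_uniq N : uniq (wedge_trunc N).
Proof.
apply: pmap_sub_uniq; apply: allpairs_uniq; [exact: uniq_frame_trunc..|].
by move=> [? ?] [? ?] _ _ /=.
Qed.

Lemma wedge_trunc_mono M N : (M <= N)%N -> {subset wedge_trunc M <= wedge_trunc N}.
Proof.
move=> MN e; rewrite !mem_wedge_trunc => /andP[h1 h2].
by rewrite !(leq_trans _ MN).
Qed.

Lemma wedge_trunc_cover e : exists N, e \in wedge_trunc N.
Proof.
exists (maxn (frame_idx (val e).1) (frame_idx (val e).2)).+1.
by rewrite mem_wedge_trunc !ltnS leq_maxl leq_maxr.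
Qed.

Lemma sum_wedge_trunc_le (F : frame -> frame -> R) N : (forall a b, 0 <= F a b) ->
  \sum_(e <- wedge_trunc N) F (val e).1 (val e).2 <=
  \sum_(a <- frame_trunc N) \sum_(b <- frame_trunc N) F a b.
Proof.
move=> F0.
have -> : \sum_(a <- frame_trunc N) \sum_(b <- frame_trunc N) F a b =
    \sum_(p <- [seq (a, b) | a <- frame_trunc N, b <- frame_trunc N]) F p.1 p.2.
  by rewrite big_allpairs_dep.
rewrite /wedge_trunc; elim: [seq _ | _ <- _, _ <- _] => [|p s IH]; first by rewrite !big_nil.
rewrite big_cons/=; case: insubP => [u _ <-|_] /=; last by rewrite -[X in X <= _]add0r lerD.
by rewrite big_cons lerD.
Qed.

Lemma sum_frame_trunc (F : nat -> R) N :
  \sum_(a <- frame_trunc N) F (frame_idx a) = 2 * \sum_(k < N) F k.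
Proof.
have iE : iota 0 N = index_iota 0 N by rewrite /index_iota subn0.
by rewrite /frame_trunc big_cat/= !big_map /= iE big_mkord; ring.
Qed.

Definition curv_bound i j k l : R :=
  `|curv_r R i j k l| + `|curv_r R i j l k| + `|curv_r R j i k l| + `|curv_r R j i l k|.

Lemma Re_le_norm (z : C) (r : R) : `|z| <= r%:C%C -> `|complex.Re z| <= r.
Proof. by move=> zr; rewrite -lecR; apply: le_trans zr; exact: normc_ge_Re. Qed.

Lemma norm_frame_coef e s : `|frame_coef R e s| = 1.
Proof.
have ni : `|'i%C : C| = 1 by rewrite normc_def /= expr0n expr1n add0r sqrtr1.
by case: e s => k [] /=; rewrite ?normrN ?normr1 ?ni.
Qed.

Lemma curv_le a b c d :
  `|curv R a b c d| <= curv_bound (frame_idx a) (frame_idx b) (frame_idx c) (frame_idx d).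
Proof.
apply: Re_le_norm; move: (frame_idx a) (frame_idx b) (frame_idx c) (frame_idx d) => i j k l.
rewrite !big_bool/= !mulr0 !addr0 !add0r.
have nr (x : R) : `|x%:C%C| = `|x|%:C%C :> C by rewrite normc_def /= expr0n addr0 sqrtr_sqr.
have t s1 s2 s3 s4 (z : C) : `|frame_coef R a s1 * frame_coef R b s2 * frame_coef R c s3 * frame_coef R d s4 * z| = `|z|.
  by rewrite !normrM !norm_frame_coef !mul1r.
rewrite /curv_bound !rmorphD/= -!nr -!curv_tr.
rewrite (le_trans (ler_normD _ _))//.
rewrite [leRHS](_ : _ = (`|curv_t R j i l k| + `|- curv_t R j i k l|) +
   (`|- curv_t R i j l k| + `|curv_t R i j k l|)); last by rewrite !normrN; ring.
by apply: lerD; rewrite (le_trans (ler_normD _ _))// !t.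
Qed.

Lemma curv_sym a b c d : curv R a b c d = curv R c d a b.
Proof.
rewrite /curv !big_bool/= !mulr0 !addr0 !add0r !curv_tr.
rewrite ![curv_r R (frame_idx c) _ _ _]curv_rC ![curv_r R (frame_idx d) _ _ _]curv_rC.
by congr complex.Re; ring.
Qed.

(** The factor 16 counts two frame vectors for each of the two summed indices, times the four terms
    of [curv_bound]. *)
Definition row_const : R := 16 * 1008.

Definition curvB (e f : wedge_basis) : R := curv R (val e).1 (val e).2 (val f).1 (val f).2.

Lemma curvB_sym e f : curvB e f = curvB f e. Proof. exact: curv_sym. Qed.

Lemma row_const_gt0 : 0 < row_const.
Proof. by apply: mulr_gt0; rewrite ltr0n. Qed.

Lemma curvB_row e N : \sum_(f <- wedge_trunc N) `|curvB e f| <= row_const.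
Proof.
case: e => [[a b] hab]; rewrite /curvB /=.
set i := frame_idx a; set j := frame_idx b.
apply: (@le_trans _ _ (\sum_(f <- wedge_trunc N) curv_bound i j (frame_idx (val f).1) (frame_idx (val f).2))).
  by apply: ler_sum => f _; exact: curv_le.
have cb0 k l : 0 <= curv_bound i j k l by rewrite /curv_bound !addr_ge0.
apply: le_trans (sum_wedge_trunc_le (F := fun c d => curv_bound i j (frame_idx c) (frame_idx d)) N _) _.
  by move=> c d; exact: cb0.
under eq_bigr do rewrite sum_frame_trunc.
rewrite (sum_frame_trunc (fun k => 2 * \sum_(l < N) curv_bound i j k l)).
under eq_bigr do rewrite mulr_sumr.
have S (i' j' : nat) : \sum_(k < N) \sum_(l < N) `|curv_r R i' j' k l| <= 1008 by exact: sum_curv_r_le.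
have S' (i' j' : nat) : \sum_(k < N) \sum_(l < N) `|curv_r R i' j' l k| <= 1008.
  by rewrite exchange_big/=; exact: sum_curv_r_le.
under eq_bigr do rewrite -mulr_sumr.
rewrite -mulr_sumr /curv_bound.
under eq_bigr do rewrite !big_split/=.
rewrite !big_split/= /row_const.
have := S i j; have := S' i j; have := S j i; have := S' j i.
move: (\sum_(k < N) _) (\sum_(k < N) _) (\sum_(k < N) _) (\sum_(k < N) _) => s1 s2 s3 s4.
lra.
Qed.

(** The definition by choice would return the zero operator if nothing represented the form; the
    operator given by the Schur test rules this out. *)
Lemma curvature_operator_spec V W : dot_eu (@curvature_operator R V) W = curvature_form V W.
Proof.
have ex : exists Q : wedge2 R -> wedge2 R, forall V W, dot_eu (Q V) W = curvature_form V W.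
  exists (schur_op wedge_trunc_uniq wedge_trunc_mono wedge_trunc_cover row_const_gt0 curvB_sym curvB_row).
  move=> V' W'; rewrite /dot_eu schur_op_form /curvature_form.
  by congr (lim (_ @ _)).
exact: (@xgetPex _ (fun=> 0) [set Q | forall V W, dot_eu (Q V) W = curvature_form V W] ex).
Qed.

Lemma delta_sqsummable (e : wedge_basis) : (fun f => (f == e)%:R : R) \in @sqsummable R wedge_basis.
Proof.
apply: (sqsummable_psum wedge_trunc_uniq wedge_trunc_mono wedge_trunc_cover (M := 1)) => N.
rewrite /psum; have [eN|eN] := boolP (e \in wedge_trunc N).
  rewrite (bigD1_seq e) ?wedge_trunc_uniq//= eqxx expr1n big1 ?addr0// => f /negPf ->.
  by rewrite expr0n.
rewrite big_seq big1// => f fN; case: eqP => [fe|_]; last by rewrite expr0n.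
by move: eN; rewrite -fe fN.
Qed.

Definition delta (e : wedge_basis) : wedge2 R := Ell2 (delta_sqsummable e).

Lemma sum_delta (F : wedge_basis -> R) e N : e \in wedge_trunc N ->
  \sum_(f <- wedge_trunc N) F f * delta e f = F e.
Proof.
move=> eN; rewrite (bigD1_seq e) ?wedge_trunc_uniq//= eqxx mulr1 big1 ?addr0//.
by move=> f /negPf ->; rewrite mulr0.
Qed.

Lemma lim_near_eq (u v : nat -> R) : (\forall N \near \oo, u N = v N) -> limn u = limn v.
Proof.
move=> uv; congr (lim _); apply/seteqP; split; apply: near_eq_cvg => //.
by near=> N; apply/esym; near: N.
Unshelve. all: by end_near. Qed.

(** Pairing with the basis bivector [delta e] isolates one coordinate, on the operator side as well
    as in the truncated form. All coordinates of the chosen operator are thereby known. *)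
Lemma curvature_operatorE V e :
  @curvature_operator R V e = limn (fun N => \sum_(f <- wedge_trunc N) curvB e f * V f).
Proof.
have := curvature_operator_spec V (delta e); rewrite /dot_eu /curvature_form.
have [M eM] := wedge_trunc_cover e.
have near_e : \forall N \near \oo, e \in wedge_trunc N.
  by near=> N; apply: (wedge_trunc_mono (M := M)) => //; near: N; exists M.
have -> : lim ((fun N => \sum_(f <- wedge_trunc N) @curvature_operator R V f * delta e f) @ \oo)
    = @curvature_operator R V e.
  by apply: cvg_lim => //; apply: cvg_near_cst; near=> N; rewrite sum_delta//; near: N.
move=> ->; apply: lim_near_eq; near=> N.
have eN : e \in wedge_trunc N by near: N.
apply: eq_bigr => f _; rewrite -(sum_delta (fun g => curvB e f * V f) eN).
rewrite [RHS](_ : _ = \sum_(g <- wedge_trunc N) (V f * curvB f g) * delta e g).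
  by apply: eq_bigr => g _; rewrite -/(curvB f g); ring.
by rewrite !sum_delta// curvB_sym mulrC.
Unshelve. all: by end_near. Qed.

End CurvatureOperator.

(** * Riemann sums and the limit kernel *)

Section StepIntegral.
Context (R : realType).
Local Notation leb := (@lebesgue_measure R).

Definition inv_sq (t : R) : R := (1 + t)^-1 ^+ 2.

Lemma inv_sq_ge0 t : 0 <= inv_sq t. Proof. exact: sqr_ge0. Qed.

Lemma is_derive_inv1 (t : R) : 0 <= t ->
  is_derive t (1 : R) (fun x : R => - (1 + x)^-1) (inv_sq t).
Proof.
move=> t0; have n0 : 1 + t != 0 by apply: lt0r_neq0; lra.
have D : is_derive t (1 : R) (fun x : R => 1 + x) 1.
  by apply: is_derive_eq; rewrite /GRing.scale /=; ring.
have := is_deriveN (@is_derive_inv R (fun x => 1 + x) t 1 n0 D).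
by rewrite /= mulNr opprK mulr1.
Qed.

Lemma inv_sq_continuous_at (t : R) : 0 <= t -> {for t, continuous inv_sq}.
Proof.
move=> t0; apply: cvgM; apply: cvgV; try (by apply: lt0r_neq0; lra);
by apply: cvgD; [exact: cvg_cst|exact: cvg_id].
Qed.

Lemma integral_inv_sq (a : R) : 0 <= a ->
  (\int[leb]_(t in `[a, +oo[) (inv_sq t)%:E = ((1 + a)^-1)%:E)%E.
Proof.
move=> a0; rewrite (@ge0_continuous_FTC2y _ inv_sq (fun x => - (1 + x)^-1) a 0).
- by rewrite EFinN oppeK add0e.
- by move=> x _; exact: inv_sq_ge0.
- apply: continuous_in_subspaceT => t /set_mem/=; rewrite in_itv/= andbT => at_.
  by apply: inv_sq_continuous_at; lra.
- rewrite -oppr0; apply: cvgN; apply/cvgr0Pnorm_le => e e0; near=> x.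
  have x0 : e^-1 <= x by near: x; apply: nbhs_pinfty_ge; rewrite num_real.
  have ei : 0 < e^-1 by rewrite invr_gt0.
  have x1 : 0 < 1 + x by lra.
  by rewrite gtr0_norm ?invr_gt0// -[e]invrK lef_pV2 ?posrE//; lra.
- by move=> x ax; have [] := @is_derive_inv1 x (le_trans a0 (ltW ax)).
- apply: cvg_at_right_filter.
  have [d _] := is_derive_inv1 a0.
  exact/(@differentiable_continuous _ _ _ a (fun x : R => - (1 + x)^-1))/derivable1_diffP.
- move=> x; rewrite in_itv/= andbT => ax; rewrite derive1E.
  by have [] := @is_derive_inv1 x (le_trans a0 (ltW ax)).
Unshelve. all: by end_near. Qed.

Lemma measurable_inv_sq (a : R) : 0 <= a -> measurable_fun `[a, +oo[ inv_sq.
Proof.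
move=> a0; apply: subspace_continuous_measurable_fun => //.
apply: continuous_in_subspaceT => t /set_mem/=; rewrite in_itv/= andbT => at_.
by apply: inv_sq_continuous_at; lra.
Qed.

Lemma integrable_inv_sq (D a : R) : 0 <= D -> 0 <= a ->
  leb.-integrable `[a, +oo[ (EFin \o (fun t => D * inv_sq t)).
Proof.
move=> D0 a0; rewrite (_ : _ \o _ = (fun t => D%:E * (inv_sq t)%:E)%E); last first.
  by apply/funext => t /=; rewrite EFinM.
apply: integrableZl => //; apply/integrableP; split.
  by apply/measurable_EFinP; exact: measurable_inv_sq.
under eq_integral => t _ do rewrite gee0_abs ?lee_fin ?inv_sq_ge0//.
by rewrite integral_inv_sq// ltry.
Qed.

Lemma Rintegral_inv_sq (D a : R) : 0 <= D -> 0 <= a ->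
  \int[leb]_(t in `[a, +oo[) (D * inv_sq t) = D / (1 + a).
Proof.
move=> D0 a0; rewrite RintegralZl//; last first.
  by have := integrable_inv_sq ler01 a0; congr (_.-integrable _ _); apply/funext => t /=; rewrite mul1r.
by rewrite /Rintegral integral_inv_sq.
Qed.

(** Takes the value c n on [n / x, (n + 1) / x[, so that sums of c n / x become integrals over a
    domain independent of x. *)
Definition step_fun (x : R) (c : nat -> R) (t : R) : R := c (Num.truncn (x * t)).

Lemma step_fun_cell (x : R) (c : nat -> R) n t : 0 < x -> n%:R / x <= t -> t < n.+1%:R / x -> step_fun x c t = c n.
Proof.
move=> x0; rewrite ler_pdivrMr// ltr_pdivlMr// => h1 h2; congr c.
by apply: truncn_def; rewrite mulrC h1 h2.
Qed.

Definition cell (x : R) (n : nat) : set R := `[n%:R / x, n.+1%:R / x[%classic.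

Lemma bigcup_cell (x : R) : 0 < x -> \bigcup_n cell x n = `[0, +oo[%classic.
Proof.
move=> x0; apply/seteqP; split => t /=.
  move=> [n _]; rewrite /cell/= !in_itv/= andbT => /andP[+ _]; apply: le_trans.
  by rewrite divr_ge0// ltW.
rewrite in_itv/= andbT => t0; have xt : 0 <= x * t by rewrite mulr_ge0// ltW.
exists (Num.truncn (x * t)) => //; rewrite /cell/= in_itv/= ler_pdivrMr// ltr_pdivlMr//.
by have := truncn_itv xt; rewrite mulrC.
Qed.

Lemma measurable_step_fun (x : R) (c : nat -> R) : 0 < x ->
  measurable_fun (`[0, +oo[%classic : set R) (step_fun x c).
Proof.
move=> x0; rewrite -(bigcup_cell x0); apply/measurable_fun_bigcup.
  by move=> n; exact: measurable_itv.
move=> n; apply: (eq_measurable_fun (cst (c n))); last exact: measurable_cst.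
by move=> t /set_mem; rewrite /cell/= in_itv/= => /andP[h1 h2]; rewrite (@step_fun_cell x c n t).
Qed.

Section Dominated.
Variables (x D : R) (c : nat -> R).
Hypothesis (x0 : 0 < x) (D0 : 0 <= D).
Hypothesis cD : forall n, `|c n| <= D * inv_sq (n.+1%:R / x).

(** The hypothesis bounds c n by the majorant at the right end of the cell, where it is smallest, so
    the bound holds on the whole cell. *)
Lemma step_fun_le t : 0 <= t -> `|step_fun x c t| <= D * inv_sq t.
Proof.
move=> t0; apply: le_trans (cD _) _; rewrite ler_wpM2l//.
have h : t <= (Num.truncn (x * t)).+1%:R / x.
  by rewrite ler_pdivlMr// mulrC ltW// truncnS_gt.
have : 0 < 1 + t by lra.
have : 0 < 1 + (Num.truncn (x * t)).+1%:R / x by lra.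
move=> h1 h2; apply: lerXn2r; rewrite ?nnegrE ?invr_ge0 ?(ltW h1) ?(ltW h2)//.
by rewrite lef_pV2 ?posrE//; lra.
Qed.

Lemma integrable_step_fun : leb.-integrable `[0, +oo[ (EFin \o step_fun x c).
Proof.
apply: le_integrable (integrable_inv_sq D0 (lexx 0)) => //.
- by apply/measurable_EFinP; exact: measurable_step_fun.
- move=> t; rewrite /= in_itv/= andbT => t0; rewrite lee_fin.
  by apply: le_trans (step_fun_le t0) _; exact: ler_norm.
Qed.

Lemma integral_step_fun_finite N :
  \int[leb]_(t in `[0, N%:R / x[) step_fun x c t = \sum_(n < N) c n / x.
Proof.
elim: N => [|N IH].
  by rewrite mul0r set_itv_ge ?Rintegral_set0 ?big_ord0// bnd_simp ltxx.
have i0 : 0 <= N%:R / x by rewrite divr_ge0// ltW.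
have iN : N%:R / x <= N.+1%:R / x by rewrite ler_pM2r ?invr_gt0// ler_nat.
have sub : `[0, N.+1%:R / x[%classic `<=` (`[0, +oo[%classic : set R).
  by move=> t /=; rewrite !in_itv/= andbT => /andP[].
rewrite (@itv_bndbnd_setU _ _ _ (BLeft (N%:R / x))) ?bnd_simp//.
rewrite Rintegral_setU//=.
- rewrite IH big_ord_recr/=; congr (_ + _).
  rewrite (@eq_Rintegral _ _ _ _ _ (fun=> c N)); last first.
    move=> t /set_mem/=; rewrite in_itv/= => /andP[h1 h2].
    exact: step_fun_cell.
  rewrite Rintegral_cst//= lebesgue_measure_itv/= lte_fin.
  rewrite ifT; last by rewrite ltr_pM2r ?invr_gt0// ltr_nat.
  by rewrite -EFinB/= -mulrBl -natr1 addrAC subrr add0r mul1r.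
- by rewrite -itv_bndbnd_setU ?bnd_simp//; apply: integrableS integrable_step_fun.
- apply/disj_setPS => t [/=]; rewrite !in_itv/= => /andP[_ h1] /andP[h2 _].
  by move: h1; rewrite ltNge h2.
Qed.

(** Past N / x the majorant has integral D / (1 + N / x). This explicit error for a truncated sum is
    what later keeps the boundary effects summable. *)
Lemma integral_step_fun_tail N :
  `|\int[leb]_(t in `[0, +oo[) step_fun x c t - \sum_(n < N) c n / x| <= D * x / (x + N%:R).
Proof.
have i0 : 0 <= N%:R / x by rewrite divr_ge0// ltW.
rewrite -integral_step_fun_finite.
rewrite [in X in X - _](@itv_bndbnd_setU _ _ _ (BLeft (N%:R / x))) ?bnd_simp//.
have sub : `[N%:R / x, +oo[%classic `<=` (`[0, +oo[%classic : set R).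
  by move=> t /=; rewrite !in_itv/= !andbT; exact: le_trans.
have it : leb.-integrable `[N%:R / x, +oo[ (EFin \o step_fun x c).
  by apply: integrableS integrable_step_fun.
rewrite Rintegral_setU//=; last 2 first.
- by rewrite -itv_bndbnd_setU ?bnd_simp//; exact: integrable_step_fun.
- apply/disj_setPS => t [/=]; rewrite !in_itv/= => /andP[_ h1] /andP[h2 _].
  by move: h1; rewrite ltNge h2.
rewrite addrC addKr; apply: le_trans (le_normr_Rintegral _ it) _ => //.
have -> : D * x / (x + N%:R) = D / (1 + N%:R / x).
  have : 0 <= N%:R :> R by [].
  move: N%:R => y y0; field.
  by rewrite (lt0r_neq0 x0) (lt0r_neq0 (ltr_pwDl x0 y0)).
rewrite -Rintegral_inv_sq//; apply: le_Rintegral => //.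
- exact: (integrable_norm it).
- exact: integrable_inv_sq.
- move=> t /=; rewrite in_itv/= andbT => ht; apply: step_fun_le.
  exact: le_trans ht.
Qed.
End Dominated.

(* Dominated convergence for the step functions turns the scaled sums into Riemann sums of [f]. *)
Lemma cvg_step_integral (xs : nat -> R) (c : nat -> nat -> R) (f : R -> R) (D : R) :
  (forall k, 0 < xs k) -> 0 <= D ->
  (forall k n, `|c k n| <= D * inv_sq (n.+1%:R / xs k)) ->
  (forall t, 0 < t -> c k (Num.truncn (xs k * t)) @[k --> \oo] --> f t) ->
  leb.-integrable `]0, +oo[ (EFin \o f) /\
  \int[leb]_(t in `[0, +oo[) step_fun (xs k) (c k) t @[k --> \oo] -->
  \int[leb]_(t in `]0, +oo[) f t.
Proof.
move=> x0 D0 cD cf.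
have sub : `]0, +oo[%classic `<=` (`[0, +oo[%classic : set R).
  by move=> t /=; rewrite !in_itv/= !andbT; exact: ltW.
have iD : leb.-integrable `]0, +oo[ (EFin \o (fun t => D * inv_sq t)).
  by apply: integrableS (integrable_inv_sq D0 (lexx 0)).
have is_ k : leb.-integrable `]0, +oo[ (EFin \o step_fun (xs k) (c k)).
  by apply: integrableS (integrable_step_fun (x0 k) D0 (cD k)).
have cfE t : `]0, +oo[%classic t -> (EFin \o step_fun (xs k) (c k)) t @[k --> \oo] --> (EFin \o f) t.
  by rewrite /= in_itv/= andbT => t0; apply/cvg_EFin; [exact: nearW|exact: cf].
have mk k : measurable_fun (`]0, +oo[%classic : set R) (EFin \o step_fun (xs k) (c k)).
  by have /measurable_int := is_ k.
have mf : measurable_fun (`]0, +oo[%classic : set R) (EFin \o f).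
  exact: (emeasurable_fun_cvg (fun k => EFin \o step_fun (xs k) (c k))).
have dom (t : R) k : (`]0, +oo[%classic : set R) t ->
    (`|(step_fun (xs k) (c k) t)%:E| <= (D * inv_sq t)%:E)%E.
  by rewrite /= in_itv/= andbT => t0; rewrite lee_fin (step_fun_le (x0 k) D0 (cD k) (ltW t0)).
have [||||| if_ _ key] := @dominated_convergence _ _ _ leb `]0, +oo[%classic (measurable_itv _)
  (fun k => EFin \o step_fun (xs k) (c k)) (EFin \o f) (EFin \o (fun t => D * inv_sq t)).
- exact: mk.
- exact: mf.
- by apply: aeW => t t0; exact: cfE.
- exact: iD.
- by apply: aeW => t k t0; exact: dom.
split=> //.
(* The pointwise limit is known only for t > 0, so dominated convergence ran on the open half-line;
   the point 0 has measure zero. *)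
have -> : (fun k => \int[leb]_(t in `[0, +oo[) step_fun (xs k) (c k) t) =
    (fun k => \int[leb]_(t in `]0, +oo[) step_fun (xs k) (c k) t).
  by apply/funext => k; rewrite Rintegral_itv_obnd_cbnd.
rewrite /Rintegral; apply: fine_cvg; rewrite fineK//.
exact: integrable_fin_num.
Qed.

End StepIntegral.

(** * The diagonal block in homogeneous variables *)

Section KernelLimit.
Context (R : realType).

Definition diagA k l : R := curv_r R k k l l.

Lemma diagA_sym k l : diagA k l = diagA l k. Proof. exact: curv_rC. Qed.

Lemma diagA_le k l : `|diagA k l| <= 504 * decay R k l.
Proof. exact: curv_r_le. Qed.

Definition kconst : R := area R * (2 / pi) ^+ 2 / 64.

(** The two curvature integrals behave differently here: one has m = 0, a = k, b = l, the other m =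
    |k - l| and a = b = min(k, l). They lead to the forms marked T and S below. *)
Lemma diagAE k l : diagA k l =
  kconst * (cube R k * cube R l * Iker R 0 k l
            + cube R k * cube R l * Iker R (maxn k l - minn k l) (minn k l) (minn k l)).
Proof.
rewrite /diagA /curv_r eqxx /curv_entry !maxnn !minnn subnn.
rewrite [minn l k]minnC.
have -> : cn R k * cn R k * cn R l * cn R l / 64 = (2 / pi) ^+ 2 * (cube R k * cube R l) / 64.
  by rewrite cn4 -!expr2 !cubert_sqr; ring.
have -> : cn R k * cn R l * cn R l * cn R k / 64 = (2 / pi) ^+ 2 * (cube R k * cube R l) / 64.
  by rewrite cn4 -!cubert_sqr; ring.
by rewrite /kconst; ring.
Qed.

(* Homogeneous forms of the kernel: [t] stands for [(l + 1) / (k + 1)] and [e] for [1 / (k + 1)]. *)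
Definition bracketT (t e : R) : R :=
  1 / (2 * (1 + t) * (1 + t + e)) - (2 * t + 5 * e) / (3 * (1 + t) * (1 + t + e) * (1 + t + 2 * e))
  + (t + 3 * e) * (t + 3 * e) / (4 * (1 + t) * (1 + t + e) * (1 + t + 2 * e) * (1 + t + 3 * e)).

Definition bracketS (t e : R) : R :=
  1 / (2 * (1 + t) * (1 + t + e)) - (1 + t + 5 * e) / (3 * (1 + t) * (1 + t + e) * (1 + t + 2 * e))
  + (1 + 3 * e) * (t + 3 * e) / (4 * (1 + t) * (1 + t + e) * (1 + t + 2 * e) * (1 + t + 3 * e)).

Definition prod5 (t e : R) : R :=
  (1 + t) * (1 + t + e) * (1 + t + 2 * e) * (1 + t + 3 * e) * (1 + t + 4 * e).

Definition scaledT (t e : R) : R :=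
  t * (t + e) * (t + 2 * e) * (8 * (1 + e)) / ((1 + e) * (1 + 2 * e))
    * (2 / (t * (t + 2 * e)) - 24 * bracketT t e)
  - 48 * (1 + e) * (t * (t + e) * (t + 2 * e)) / ((1 + 2 * e) * prod5 t e).

Definition scaledS (th t e : R) : R :=
  4 * (1 + t + 2 * e) * (th - 24 * bracketS t e)
  - 48 * ((1 + e) * t * (t + e)) / prod5 t e.

(** The only part of the S form that depends on which index is larger: the fraction 2 (2 q - p + 1)
    / (q (q + 1) (q + 2)) multiplied by x^2, where x = k + 1, q is the larger and p the smaller of x
    and x t. The other factors are symmetric in p and q. *)
Definition theta_lt (t e : R) : R := 2 * (2 - t + e) / ((1 + e) * (1 + 2 * e)).
Definition theta_ge (t e : R) : R := 2 * (2 * t - 1 + e) / (t * (t + e) * (t + 2 * e)).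

Definition cube_num (a : R) := (a + 1) * (a + 2) * (a + 3).

Lemma bracketT_scale (x t : R) : 0 < x -> 0 < t ->
  1 / (2 * (0 + (x - 1) + (x * t - 1) + 2) * (0 + (x - 1) + (x * t - 1) + 3))
  - (7 + 0 + 2 * (x * t - 1)) / (3 * (0 + (x - 1) + (x * t - 1) + 2) * (0 + (x - 1) + (x * t - 1) + 3)
       * (0 + (x - 1) + (x * t - 1) + 4))
  + (4 + 0 + (x * t - 1)) * (4 + (x * t - 1)) / (4 * (0 + (x - 1) + (x * t - 1) + 2)
       * (0 + (x - 1) + (x * t - 1) + 3) * (0 + (x - 1) + (x * t - 1) + 4) * (0 + (x - 1) + (x * t - 1) + 5))
  = bracketT t x^-1 / x / x.
Proof.
move=> x0 t0; have xt : 0 < x * t by rewrite mulr_gt0.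
rewrite /bracketT; field.
by do ![apply/andP; split]; apply: lt0r_neq0; nra.
Qed.

Lemma scaledT_eq (x t : R) : 0 < x -> 0 < t ->
  x * (cube_num (x - 1) * cube_num (x * t - 1) * Iker_num 0 (x - 1) (x * t - 1)) = scaledT t x^-1.
Proof.
move=> x0 t0; have xt : 0 < x * t by rewrite mulr_gt0.
rewrite /Iker_num bracketT_scale// /scaledT /prod5 /cube_num.
move: (bracketT t x^-1) => B; field.
by do ![apply/andP; split]; apply: lt0r_neq0; nra.
Qed.

(** [Iker_num] at a = b, rewritten in the shifted smaller index p and the shifted larger index q. *)
Definition diag_expr (p q : R) : R :=
  4 * (p + q + 2) / ((p * (p + 1) * (p + 2)) * (q * (q + 1) * (q + 2))) *
   (2 * (2 * q - p + 1) / (q * (q + 1) * (q + 2))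
    - 24 * (1 / (2 * (p + q) * (p + q + 1)) - (p + q + 5) / (3 * (p + q) * (p + q + 1) * (p + q + 2))
            + (q + 3) * (p + 3) / (4 * (p + q) * (p + q + 1) * (p + q + 2) * (p + q + 3))))
  - 48 / ((p + 2) * (q + 2) * (p + q) * (p + q + 1) * (p + q + 2) * (p + q + 3) * (p + q + 4)).

Lemma Iker_num_diag (m b p q : R) : p = b + 1 -> q = m + b + 1 -> Iker_num m b b = diag_expr p q.
Proof.
move=> -> ->; rewrite /Iker_num /diag_expr.
congr (_ / _ * (_ / _ - 24 * (_ / _ - _ / _ + _ / _)) - _ / _); ring.
Qed.

Lemma bracketS_scale (p q x t : R) : 0 < x -> 0 < t ->
  p + q = x + x * t -> (q + 3) * (p + 3) = (x + 3) * (x * t + 3) ->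
  1 / (2 * (p + q) * (p + q + 1)) - (p + q + 5) / (3 * (p + q) * (p + q + 1) * (p + q + 2))
    + (q + 3) * (p + 3) / (4 * (p + q) * (p + q + 1) * (p + q + 2) * (p + q + 3))
  = bracketS t x^-1 / x / x.
Proof.
move=> x0 t0 -> ->; have xt : 0 < x * t by rewrite mulr_gt0.
rewrite /bracketS; field.
by do ![apply/andP; split]; apply: lt0r_neq0; nra.
Qed.

Lemma scaledS_lt (x t : R) : 0 < x -> 0 < t ->
  x * (x * (x + 1) * (x + 2) * ((x * t) * (x * t + 1) * (x * t + 2)) * diag_expr (x * t) x)
  = scaledS (theta_lt t x^-1) t x^-1.
Proof.
move=> x0 t0; have xt : 0 < x * t by rewrite mulr_gt0.
rewrite /diag_expr (bracketS_scale x0 t0); [|by ring|by ring].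
rewrite /scaledS /theta_lt /prod5; move: (bracketS t x^-1) => B; field.
by do ![apply/andP; split]; apply: lt0r_neq0; nra.
Qed.

Lemma scaledS_ge (x t : R) : 0 < x -> 0 < t ->
  x * (x * (x + 1) * (x + 2) * ((x * t) * (x * t + 1) * (x * t + 2)) * diag_expr x (x * t))
  = scaledS (theta_ge t x^-1) t x^-1.
Proof.
move=> x0 t0; have xt : 0 < x * t by rewrite mulr_gt0.
rewrite /diag_expr (bracketS_scale x0 t0); [|by ring|by ring].
rewrite /scaledS /theta_ge /prod5; move: (bracketS t x^-1) => B; field.
by do ![apply/andP; split]; apply: lt0r_neq0; nra.
Qed.

Definition kernT (t : R) : R := 16 * t * (1 + 5 * t + t ^+ 2) / (1 + t) ^+ 5.
Definition kernS (t : R) : R :=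
  if t < 1 then 8 * t ^+ 3 * (14 + 8 * t - 3 * t ^+ 2 - 4 * t ^+ 3 - t ^+ 4) / (1 + t) ^+ 5
  else 8 * (14 * t ^+ 4 + 8 * t ^+ 3 - 3 * t ^+ 2 - 4 * t - 1) / (t ^+ 3 * (1 + t) ^+ 5).

Lemma scaledT0 (t : R) : 0 < t -> scaledT t 0 = kernT t.
Proof.
move=> t0; rewrite /scaledT /bracketT /prod5 /kernT !mulr0 !addr0; field.
by do ![apply/andP; split]; apply: lt0r_neq0; nra.
Qed.

Lemma scaledS0 (t : R) : 0 < t ->
  scaledS (if t < 1 then theta_lt t 0 else theta_ge t 0) t 0 = kernS t.
Proof.
move=> t0; rewrite /scaledS /theta_lt /theta_ge /bracketS /prod5 /kernS !mulr0 !addr0.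
by case: ifP => _; field; do ?[apply/andP; split]; apply: lt0r_neq0; nra.
Qed.

(** A named predicate, so that the tactic below can recurse on the syntactic shape of the sequence
    and leave only nonvanishing denominators as goals. *)
Definition seq_cvg (u : nat -> R) (l : R) : Prop := u @ \oo --> l.

Lemma seq_cvg_cst (a : R) : seq_cvg (fun=> a) a. Proof. exact: cvg_cst. Qed.

Lemma seq_cvgD u v l m : seq_cvg u l -> seq_cvg v m -> seq_cvg (fun k => u k + v k) (l + m).
Proof. exact: cvgD. Qed.

Lemma seq_cvgN u l : seq_cvg u l -> seq_cvg (fun k => - u k) (- l).
Proof. exact: cvgN. Qed.

Lemma seq_cvgM u v l m : seq_cvg u l -> seq_cvg v m -> seq_cvg (fun k => u k * v k) (l * m).
Proof. exact: cvgM. Qed.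

Lemma seq_cvgV u l : l != 0 -> seq_cvg u l -> seq_cvg (fun k => (u k)^-1) l^-1.
Proof. exact: cvgV. Qed.

Ltac seq_cvg_tac := lazymatch goal with
  | |- seq_cvg (fun k => @?a k + @?b k) _ => apply: (@seq_cvgD a b); seq_cvg_tac
  | |- seq_cvg (fun k => @?a k * @?b k) _ => apply: (@seq_cvgM a b); seq_cvg_tac
  | |- seq_cvg (fun k => - @?a k) _ => apply: (@seq_cvgN a); seq_cvg_tac
  | |- seq_cvg (fun k => (@?a k)^-1) _ => apply: (@seq_cvgV a); [|seq_cvg_tac]
  | |- seq_cvg _ _ => first [assumption | exact (@seq_cvg_cst _)]
  end.

Lemma cvg_scaledT (ts es : nat -> R) (t : R) : 0 < t -> seq_cvg ts t -> seq_cvg es 0 ->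
  seq_cvg (fun k => scaledT (ts k) (es k)) (scaledT t 0).
Proof.
move=> t0 ct ce; rewrite /scaledT /bracketT /prod5.
seq_cvg_tac; rewrite ?mulr0 ?addr0; apply: lt0r_neq0; do ?apply: mulr_gt0; lra.
Qed.

Lemma cvg_scaledS (th ts es : nat -> R) (t h : R) : 0 < t -> seq_cvg ts t -> seq_cvg es 0 ->
  seq_cvg th h -> seq_cvg (fun k => scaledS (th k) (ts k) (es k)) (scaledS h t 0).
Proof.
move=> t0 ct ce ch; rewrite /scaledS /bracketS /prod5.
seq_cvg_tac; rewrite ?mulr0 ?addr0; apply: lt0r_neq0; do ?apply: mulr_gt0; lra.
Qed.

Lemma cvg_theta_lt (ts es : nat -> R) (t : R) : 0 < t -> seq_cvg ts t -> seq_cvg es 0 ->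
  seq_cvg (fun k => theta_lt (ts k) (es k)) (theta_lt t 0).
Proof.
move=> t0 ct ce; rewrite /theta_lt.
seq_cvg_tac; rewrite ?mulr0 ?addr0; apply: lt0r_neq0; do ?apply: mulr_gt0; lra.
Qed.

Lemma cvg_theta_ge (ts es : nat -> R) (t : R) : 0 < t -> seq_cvg ts t -> seq_cvg es 0 ->
  seq_cvg (fun k => theta_ge (ts k) (es k)) (theta_ge t 0).
Proof.
move=> t0 ct ce; rewrite /theta_ge.
seq_cvg_tac; rewrite ?mulr0 ?addr0; apply: lt0r_neq0; do ?apply: mulr_gt0; lra.
Qed.

End KernelLimit.

(** * Rows of the diagonal block as Riemann sums *)

Section ScaledRows.
Context (R : realType).
Local Notation leb := (@lebesgue_measure R).

Definition quot (k n : nat) : R := n.+1%:R / k.+1%:R.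

Lemma quot_gt0 k n : 0 < quot k n. Proof. by rewrite divr_gt0. Qed.

Lemma scaled_diagA k n : k.+1%:R * diagA R k n =
  kconst R * (scaledT (quot k n) k.+1%:R^-1
    + scaledS (if (n <= k)%N then theta_lt (quot k n) k.+1%:R^-1 else theta_ge (quot k n) k.+1%:R^-1)
        (quot k n) k.+1%:R^-1).
Proof.
have x0 : 0 < k.+1%:R :> R by [].
have t0 := quot_gt0 k n.
have kE : k%:R = k.+1%:R - 1 :> R by rewrite -natr1 addrK.
have nE : n%:R = k.+1%:R * quot k n - 1 :> R.
  by rewrite /quot mulrC divfK ?gt_eqF// -natr1 addrK.
rewrite diagAE mulrCA; congr (_ * _).
rewrite [LHS]mulrDr; congr (_ + _).
  by rewrite -scaledT_eq// /Iker -kE -nE /cube_num /cube.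
have ck : cube R k = k.+1%:R * (k.+1%:R + 1) * (k.+1%:R + 2) by rewrite /cube kE; ring.
have cn : cube R n = k.+1%:R * quot k n * (k.+1%:R * quot k n + 1) * (k.+1%:R * quot k n + 2).
  by rewrite /cube nE; ring.
rewrite ck cn /Iker; case: ifPn => [nk|]; last rewrite -ltnNge => nk.
  rewrite (maxn_idPl nk) (minn_idPr nk) natrB//.
  rewrite (@Iker_num_diag _ _ _ (k.+1%:R * quot k n) k.+1%:R); first exact: scaledS_lt.
    by rewrite nE subrK.
  by rewrite subrK kE subrK.
rewrite (maxn_idPr (ltnW nk)) (minn_idPl (ltnW nk)) natrB ?(ltnW nk)//.
rewrite (@Iker_num_diag _ _ _ k.+1%:R (k.+1%:R * quot k n)); first exact: scaledS_ge.
  by rewrite kE subrK.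
by rewrite subrK nE subrK.
Qed.

(* The limit of [(k + 1) * diagA k l] as [k] tends to infinity and [l / k] to [t]. *)
Definition kern (t : R) : R := kconst R * (kernT t + kernS t).

(** The cell of mesh 1 / (k + 1) that contains t; it is the index at which [step_fun] reads the
    row. *)
Definition idx (k : nat) (t : R) := Num.truncn (k.+1%:R * t).

Lemma cvg_inv_succ : seq_cvg (fun k => k.+1%:R^-1 : R) 0.
Proof. exact: cvg_harmonic. Qed.

Lemma cvg_quot (t : R) : 0 < t -> seq_cvg (fun k => quot k (idx k t)) t.
Proof.
move=> t0; apply: (@squeeze_cvgr _ _ _ _ (fun=> t) (fun k => t + k.+1%:R^-1)).
- apply: nearW => k; have x0 : 0 < k.+1%:R :> R by [].
  have xt : 0 <= k.+1%:R * t by rewrite mulr_ge0// ltW.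
  have /andP[h1 h2] := truncn_itv xt.
  rewrite /quot ler_pdivlMr// ler_pdivrMr// mulrDl mulVf ?gt_eqF// [t * _]mulrC (ltW h2) /=.
  by rewrite -natr1 lerD2r.
- exact: cvg_cst.
- rewrite -[X in _ --> X]addr0; apply: cvgD; [exact: cvg_cst|exact: cvg_inv_succ].
Qed.

(** The condition does not depend on k, so one of the two branches of [scaled_diagA] is selected for
    the entire sequence. *)
Lemma idx_le (k : nat) (t : R) : 0 < t -> (idx k t <= k)%N = (t < 1).
Proof.
move=> t0; have x0 : 0 < k.+1%:R :> R by [].
by rewrite -ltnS /idx truncn_lt_nat// ?mulr_ge0 ?(ltW t0)// -[X in _ < X]mulr1 ltr_pM2l.
Qed.

Lemma cvg_diagA (t : R) : 0 < t ->
  seq_cvg (fun k => k.+1%:R * diagA R k (idx k t)) (kern t).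
Proof.
move=> t0; under eq_fun do rewrite scaled_diagA.
apply: (@seq_cvgM _ (fun=> kconst R)); first exact: seq_cvg_cst.
apply: seq_cvgD.
  by rewrite -scaledT0//; apply: cvg_scaledT => //; [exact: cvg_quot|exact: cvg_inv_succ].
rewrite -scaledS0//; apply: cvg_scaledS => //; [exact: cvg_quot|exact: cvg_inv_succ|].
under eq_fun do rewrite idx_le//.
case: ifP => _; [apply: cvg_theta_lt|apply: cvg_theta_ge] => //; by [exact: cvg_quot|exact: cvg_inv_succ].
Qed.

(** With t = [quot k n], the left side is sqrt(t) for t <= 1 and t^(-5/2) for t >= 1; the constant 4
    is attained at t = 1. *)
Lemma scaled_decay k n : k.+1%:R * decay R k n * (Num.sqrt (quot k n))^-1 <= 4 * inv_sq (quot k n).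
Proof.
have x0 : 0 < k.+1%:R :> R by [].
have t0 := quot_gt0 k n.
have nE : n.+1%:R = quot k n * k.+1%:R :> R by rewrite /quot divfK ?gt_eqF.
rewrite /inv_sq; have s0 : 0 < Num.sqrt (quot k n) by rewrite sqrtr_gt0.
case: (leqP n k) => nk.
  have t1 : quot k n <= 1 by rewrite ler_pdivrMr// mul1r ler_nat.
  have -> : k.+1%:R * decay R k n = quot k n.
    rewrite /decay (maxn_idPl nk) (minn_idPr nk) !natr1 nE; move: x0; move: k.+1%:R => x x0; field.
    exact: lt0r_neq0.
  rewrite -[X in X / _](sqr_sqrtr (ltW t0)) expr2 mulfK ?gt_eqF//.
  apply: (@le_trans _ _ 1); first by rewrite -sqrtr1 ler_wsqrtr.
  rewrite exprVn ler_pdivlMr; last by rewrite exprn_gt0//; lra.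
  by nra.
have t1 : 1 <= quot k n by rewrite ler_pdivlMr// mul1r ler_nat ltnW// ltnS.
have -> : k.+1%:R * decay R k n = (quot k n ^+ 2)^-1.
  rewrite /decay (maxn_idPr (ltnW nk)) (minn_idPl (ltnW nk)) !natr1 nE.
  move: x0 t0; move: k.+1%:R (quot k n) => x y x0 y0; field.
  by rewrite !lt0r_neq0.
apply: (@le_trans _ _ (quot k n ^+ 2)^-1).
  rewrite ler_piMr// ?invr_ge0 ?sqr_ge0//; rewrite invf_le1//.
  by rewrite -[X in X <= _]sqrtr1 ler_wsqrtr.
have t2 : 0 < quot k n ^+ 2 by rewrite exprn_gt0.
rewrite exprVn -[X in X <= _]mul1r ler_pdivrMr// mulrAC ler_pdivlMr; last by rewrite exprn_gt0//; lra.
by nra.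
Qed.

Section Weight.
Variable h : R -> R.
Hypothesis h_le : forall t, 0 < t -> `|h t| <= (Num.sqrt t)^-1.
Hypothesis h_cont : forall t, 0 < t -> {for t, continuous h}.

Definition row_integral : R := \int[leb]_(t in `]0, +oo[) (kern t * h t).

Definition row_step k n : R := k.+1%:R * diagA R k n * h (quot k n).

Lemma row_step_le k n : `|row_step k n| <= 2016 * inv_sq (quot k n).
Proof.
have x0 : 0 <= k.+1%:R :> R by [].
have t0 := quot_gt0 k n.
rewrite /row_step !normrM ger0_norm//.
apply: (@le_trans _ _ (k.+1%:R * (504 * decay R k n) * (Num.sqrt (quot k n))^-1)).
  apply: ler_pM; rewrite ?mulr_ge0//; last exact: h_le.
  by apply: ler_wpM2l => //; exact: diagA_le.
have := scaled_decay k n; set y := Num.sqrt _; lra.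
Qed.

Lemma cvg_row_step t : 0 < t -> seq_cvg (fun k => row_step k (idx k t)) (kern t * h t).
Proof.
move=> t0; apply: (@seq_cvgM _ (fun k => k.+1%:R * diagA R k (idx k t))); first exact: cvg_diagA.
exact: (cvg_comp _ _ (cvg_quot t0) (h_cont t0)).
Qed.

(** The error e comes from the convergence of the complete Riemann sum and depends on k only; the
    second term is the tail cut off at N. The constant 2016 is 504 * 4, and the estimate is uniform
    in N. *)
Lemma row_integralP : leb.-integrable `]0, +oo[ (EFin \o (fun t => kern t * h t)) /\
  forall e, 0 < e -> exists k0 : nat, forall k N, (k0 <= k)%N ->
  `|\sum_(l < N) diagA R k l * h (quot k l) - row_integral| <= e + 2016 * k.+1%:R / (k.+1%:R + N%:R).
Proof.
have D0 : 0 <= 2016 :> R by exact: ler0n.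
have x0 (k : nat) : 0 < k.+1%:R :> R by [].
have [i c] := cvg_step_integral x0 D0 row_step_le cvg_row_step.
split=> // e e0; move/cvgrPdist_le: c => /(_ e e0)[k0 _ ck].
exists k0 => k N k0k.
have -> : \sum_(l < N) diagA R k l * h (quot k l) = \sum_(n < N) row_step k n / k.+1%:R.
  by apply: eq_bigr => n _; rewrite /row_step [_ * diagA _ _ _]mulrC mulrAC mulfK// gt_eqF.
have h1 := ck k k0k; have h2 := integral_step_fun_tail (x0 k) D0 (row_step_le k) N.
apply: le_trans (lerD h1 h2).
rewrite distrC -[X in `|X - _|](subrK (\int[leb]_(t in `[0, +oo[) step_fun k.+1%:R (row_step k) t)).
by rewrite -addrA; exact: ler_normD.
Qed.

End Weight.
End ScaledRows.

(** * The symbol, and positivity and size of the kernel *)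

Section SymbolIntegral.
Context (R : realType).
Local Notation leb := (@lebesgue_measure R).

Definition hcos (s t : R) : R := (Num.sqrt t)^-1 * cos (s * ln t).
Definition hsin (s t : R) : R := (Num.sqrt t)^-1 * sin (s * ln t).

Lemma hcos_le s t : 0 < t -> `|hcos s t| <= (Num.sqrt t)^-1.
Proof.
move=> t0; have s0 : 0 <= (Num.sqrt t)^-1 by rewrite invr_ge0 sqrtr_ge0.
by rewrite /hcos normrM ger0_norm// ler_piMr// cos_max.
Qed.

Lemma hsin_le s t : 0 < t -> `|hsin s t| <= (Num.sqrt t)^-1.
Proof.
move=> t0; have s0 : 0 <= (Num.sqrt t)^-1 by rewrite invr_ge0 sqrtr_ge0.
by rewrite /hsin normrM ger0_norm// ler_piMr// sin_max.
Qed.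

Lemma cvg_phase (s t : R) : 0 < t -> s * ln x @[x --> t] --> s * ln t.
Proof. by move=> t0; apply: cvgM; [exact: cvg_cst|exact: continuous_ln]. Qed.

Lemma cvg_invsqrt (t : R) : 0 < t -> (Num.sqrt x)^-1 @[x --> t] --> (Num.sqrt t)^-1.
Proof. by move=> t0; apply: cvgV; [rewrite gt_eqF// sqrtr_gt0|exact: sqrt_continuous]. Qed.

Lemma hcos_continuous s t : 0 < t -> {for t, continuous (hcos s)}.
Proof.
move=> t0; apply: cvgM; first exact: cvg_invsqrt.
apply: (@cvg_comp _ _ _ (fun x => s * ln x) cos _ (nbhs (s * ln t))); first exact: cvg_phase.
exact: continuous_cos.
Qed.

Lemma hsin_continuous s t : 0 < t -> {for t, continuous (hsin s)}.
Proof.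
move=> t0; apply: cvgM; first exact: cvg_invsqrt.
apply: (@cvg_comp _ _ _ (fun x => s * ln x) sin _ (nbhs (s * ln t))); first exact: cvg_phase.
exact: continuous_sin.
Qed.

(* The Mellin transform of the kernel on the critical line; the diagonal block acts on the
   generalized eigenvector [(l + 1) ^ (- 1/2 + i s)] as multiplication by [- 4 * symb s]. *)
Definition symb (s : R) : R := row_integral (hcos s).

Lemma symb_integrable s : leb.-integrable `]0, +oo[ (EFin \o (fun t => kern t * hcos s t)).
Proof. exact: (row_integralP (@hcos_le s) (@hcos_continuous s)).1. Qed.

Lemma hcos0 t : hcos 0 t = (Num.sqrt t)^-1.
Proof. by rewrite /hcos mul0r cos0 mulr1. Qed.

Lemma kconst_gt0 : 0 < kconst R.
Proof.
have /andP[a1 a2] := @area_bounds R.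
by rewrite /kconst divr_gt0// mulr_gt0 ?(lt_le_trans ltr01 a1)// exprn_gt0// divr_gt0// pi_gt0.
Qed.

Lemma kconst_le : kconst R <= 16^-1.
Proof.
have /andP[a1 a2] := @area_bounds R. have [k0 k1] := @kappa_bounds R.
have k2 : (2 / pi) ^+ 2 <= 1 :> R by rewrite exprn_ile1.
have k3 : 0 <= (2 / pi) ^+ 2 :> R by exact: sqr_ge0.
rewrite /kconst; move: k2 k3; set y := (2 / pi) ^+ 2 => k2 k3.
rewrite ler_pdivrMr//; nra.
Qed.

Lemma kernT_ge (t : R) : 0 < t -> 16 * t / (1 + t) ^+ 5 <= kernT t.
Proof.
move=> t0; rewrite /kernT ler_wpM2r//; first by rewrite invr_ge0 exprn_ge0//; lra.
by rewrite ler_peMr//; nra.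
Qed.

Lemma kernS_ge0 (t : R) : 0 < t -> 0 <= kernS t.
Proof.
move=> t0; rewrite /kernS; case: ltP => t1.
  apply: divr_ge0; last by apply: exprn_ge0; lra.
  apply: mulr_ge0; first by apply: mulr_ge0; [exact: ler0n|apply: exprn_ge0; lra].
  have t2 : t ^+ 2 <= 1 by rewrite exprn_ile1// ltW.
  have t3 : t ^+ 3 <= 1 by rewrite exprn_ile1// ltW.
  have t4 : t ^+ 4 <= 1 by rewrite exprn_ile1// ltW.
  lra.
apply: divr_ge0; last by apply: mulr_ge0; apply: exprn_ge0; lra.
apply: mulr_ge0; first exact: ler0n.
have t2 : 1 <= t ^+ 2 by rewrite exprn_ege1.
have t3 : t ^+ 2 <= t ^+ 3 by rewrite ler_weXn2l.
have t4 : t <= t ^+ 4 by rewrite -[X in X <= _]expr1 ler_weXn2l.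
have t5 : 1 <= t ^+ 4 by rewrite exprn_ege1.
lra.
Qed.

Lemma kern_ge (t : R) : 0 < t -> kconst R * (16 * t / (1 + t) ^+ 5) <= kern t.
Proof.
move=> t0; rewrite /kern ler_pM2l ?kconst_gt0//.
by have := kernT_ge t0; have := kernS_ge0 t0; set x := _ / _; lra.
Qed.

Lemma kern_ge0 (t : R) : 0 < t -> 0 <= kern t.
Proof.
move=> t0; apply: le_trans (kern_ge t0).
apply: mulr_ge0; first exact: ltW kconst_gt0.
by apply: divr_ge0; [apply: mulr_ge0; [exact: ler0n|exact: ltW]|apply: exprn_ge0; lra].
Qed.

(** With s = sqrt(t) and u = 1 + t, one has 2 s <= u and 1 + 5 t + t^2 <= 7/4 u^2; the constant 14
    is 16 * 7/4 / 2, and both inequalities are equalities at t = 1. *)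
Lemma kernT_sqrt_le (t : R) : 0 < t -> kernT t * (Num.sqrt t)^-1 <= 14 * inv_sq t.
Proof.
move=> t0; rewrite /kernT /inv_sq; have := sqr_sqrtr (ltW t0).
have : 0 < Num.sqrt t by rewrite sqrtr_gt0.
set s := Num.sqrt t => s0 <-.
have u0 : 0 < 1 + s ^+ 2 by nra.
have -> : 16 * s ^+ 2 * (1 + 5 * s ^+ 2 + (s ^+ 2) ^+ 2) / (1 + s ^+ 2) ^+ 5 / s =
    16 * s * (1 + 5 * s ^+ 2 + (s ^+ 2) ^+ 2) / (1 + s ^+ 2) ^+ 5.
  by field; rewrite !lt0r_neq0.
rewrite ler_pdivrMr ?exprn_gt0//.
have -> : 14 * (1 + s ^+ 2)^-1 ^+ 2 * (1 + s ^+ 2) ^+ 5 = 14 * (1 + s ^+ 2) ^+ 3.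
  by field; rewrite lt0r_neq0.
set u := 1 + s ^+ 2.
have h1 : 2 * s <= u by have := sqr_ge0 (1 - s); rewrite /u; nra.
have h2 : 4 * (1 + 5 * s ^+ 2 + (s ^+ 2) ^+ 2) <= 7 * u ^+ 2.
  by have := sqr_ge0 (1 - s ^+ 2); rewrite /u; nra.
have h3 : 0 <= 1 + 5 * s ^+ 2 + (s ^+ 2) ^+ 2 by have := sqr_ge0 s; nra.
move: h2 h3; set v := 1 + 5 * _ + _ => h2 h3.
have h4 : 2 * s * (4 * v) <= u * (7 * u ^+ 2) by apply: ler_pM => //; lra.
by rewrite exprS; nra.
Qed.

(** The negative terms of the numerator are dropped on each side of 1. The constant is 176 / 8,
    where the two simplified bounds meet at t = 1. *)
Lemma kernS_sqrt_le (t : R) : 0 < t -> kernS t * (Num.sqrt t)^-1 <= 22 * inv_sq t.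
Proof.
move=> t0; have u0 : 0 < 1 + t by lra.
have s0 : 0 < Num.sqrt t by rewrite sqrtr_gt0.
have k0 := kernS_ge0 t0; move: k0; rewrite /inv_sq /kernS; case: ltP => t1 k0.
  apply: (@le_trans _ _ (8 * t ^+ 2 * (14 + 8 * t) / (1 + t) ^+ 5)).
    have s1 : Num.sqrt t <= 1 by rewrite -sqrtr1 ler_wsqrtr// ltW.
    have ts : t <= Num.sqrt t by rewrite -[X in X <= _](sqr_sqrtr (ltW t0)) expr2 ler_piMl// ltW.
    rewrite ler_pdivrMr// [leRHS]mulrAC ler_wpM2r ?invr_ge0 ?exprn_ge0 ?(ltW u0)//.
    apply: (@le_trans _ _ (8 * t ^+ 2 * (14 + 8 * t) * t)); last first.
      by rewrite ler_wpM2l// !mulr_ge0//; nra.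
    rewrite (_ : 8 * t ^+ 3 * _ = 8 * t ^+ 2 * (14 + 8 * t) * t - 8 * t ^+ 3 * (3 * t ^+ 2 + 4 * t ^+ 3 + t ^+ 4)); last by ring.
    rewrite lerBlDr lerDl; have tn n : 0 <= t ^+ n by rewrite exprn_ge0// ltW.
    apply: mulr_ge0; first by apply: mulr_ge0; [exact: ler0n|exact: tn].
    by have := tn 2%N; have := tn 3%N; have := tn 4%N; lra.
  rewrite ler_pdivrMr ?exprn_gt0//.
  have -> : 22 * (1 + t)^-1 ^+ 2 * (1 + t) ^+ 5 = 22 * (1 + t) ^+ 3.
    by field; rewrite lt0r_neq0.
  nra.
apply: (@le_trans _ _ (8 * (14 * t + 8) / (1 + t) ^+ 5)).
  apply: (@le_trans _ _ (8 * (14 * t ^+ 4 + 8 * t ^+ 3 - 3 * t ^+ 2 - 4 * t - 1) / (t ^+ 3 * (1 + t) ^+ 5))).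
    rewrite ler_piMr// invf_le1//.
    by rewrite -[X in X <= _]sqrtr1 ler_wsqrtr.
  have -> : 8 * (14 * t + 8) / (1 + t) ^+ 5 = 8 * (14 * t ^+ 4 + 8 * t ^+ 3) / (t ^+ 3 * (1 + t) ^+ 5).
    by field; rewrite !lt0r_neq0.
  rewrite ler_wpM2r//; first by rewrite invr_ge0 mulr_ge0// exprn_ge0// ltW.
  by have := sqr_ge0 t; lra.
rewrite ler_pdivrMr ?exprn_gt0//.
have -> : 22 * (1 + t)^-1 ^+ 2 * (1 + t) ^+ 5 = 22 * (1 + t) ^+ 3.
  by field; rewrite lt0r_neq0.
have -> : 22 * (1 + t) ^+ 3 = 22 + 66 * t + 66 * t ^+ 2 + 22 * (t * t ^+ 2) by ring.
have t2 : 1 <= t ^+ 2 by rewrite exprn_ege1.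
have t3 : t <= t ^+ 2 by rewrite expr2 ler_peMr// ltW.
have t4 : t ^+ 2 <= t * t ^+ 2 by rewrite ler_peMl// sqr_ge0.
lra.
Qed.

Lemma kern_sqrt_le (t : R) : 0 < t -> kern t * (Num.sqrt t)^-1 <= 36 * kconst R * inv_sq t.
Proof.
move=> t0; rewrite /kern -[leLHS]mulrA (_ : 36 * _ * _ = kconst R * (36 * inv_sq t)); last by ring.
apply: ler_wpM2l; first exact: ltW kconst_gt0.
rewrite mulrDl.
by have := kernT_sqrt_le t0; have := kernS_sqrt_le t0; lra.
Qed.

(** The majorant (1 + t)^(-2) has integral 1 over the half-line, so the bound is 4 * 36 * [kconst]
    with [kconst] at most 1/16. It serves to keep the spectral points above -16 sqrt(3 / pi). *)
Lemma symb0_le : 4 * symb 0 <= 9.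
Proof.
have h : symb 0 <= 36 * kconst R.
  have D0 : 0 <= 36 * kconst R by rewrite mulr_ge0// ltW// kconst_gt0.
  have iD : leb.-integrable `]0, +oo[ (EFin \o (fun t => 36 * kconst R * inv_sq t)).
    apply: integrableS (integrable_inv_sq D0 (lexx 0)) => //.
    by move=> t /=; rewrite !in_itv/= !andbT; exact: ltW.
  have := @Rintegral_inv_sq R _ 0 D0 (lexx 0); rewrite addr0 divr1 => <-.
  rewrite -Rintegral_itv_obnd_cbnd; last first.
    exact: iD.
  by apply: le_Rintegral => //; [exact: symb_integrable|move=> t /=; rewrite in_itv/= andbT => t0; rewrite hcos0; exact: kern_sqrt_le].
by have := kconst_le; lra.
Qed.

End SymbolIntegral.

(** * Strict maximum and continuity of the symbol at zero *)

Section SymbolStrict.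
Context (R : realType).
Local Notation leb := (@lebesgue_measure R).

Lemma symb_abs_le (s : R) : `|symb s| <= symb 0.
Proof.
apply: le_trans (le_normr_Rintegral _ (symb_integrable s)) _ => //.
apply: le_Rintegral => //.
- exact: (integrable_norm (symb_integrable s)).
- exact: symb_integrable.
- move=> t /=; rewrite in_itv/= andbT => t0; rewrite normrM hcos0 ger0_norm ?kern_ge0//.
  by apply: ler_wpM2l; [exact: kern_ge0|exact: hcos_le].
Qed.

Lemma cos_le0_quarter (x : R) : pi / 2 <= x -> x <= pi -> cos x <= 0.
Proof.
move=> x1 x2; rewrite -[x](subKr pi) cosB cospi sinpi mul0r addr0 mulN1r oppr_le0.
apply: cos_ge0_pihalf; have := pi_ge0 R; move: (pi : R) x1 x2 => y x1 x2 y0.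
by apply/andP; split; lra.
Qed.

(* The integrand of the difference is nonnegative, and bounded below where [s * ln t] lies in [pi / 2, pi]. *)
Lemma symb_lt (s : R) : 0 < s -> symb s < symb 0.
Proof.
move=> s0; rewrite -subr_gt0 /symb /row_integral.
have i0 := @symb_integrable R 0; have is_ := symb_integrable s.
rewrite -RintegralB//.
pose f (t : R) : R := kern t * hcos 0 t - kern t * hcos s t.
change (0 < \int[leb]_(t in `]0, +oo[) f t).
set a := expR (pi / 2 / s); set b := expR (pi / s).
have p0 : 0 < pi / 2 :> R by rewrite divr_gt0// pi_gt0.
have p1 : pi / 2 < pi :> R by rewrite ltr_pdivrMr// ltr_pMr ?pi_gt0// ltr1n.
have a1 : 1 < a by rewrite -expR0 ltr_expR divr_gt0.
have ab : a < b by rewrite ltr_expR ltr_pM2r ?invr_gt0.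
have b0 : 0 < b by exact: expR_gt0.
have fi : leb.-integrable `]0, +oo[ (EFin \o f).
  rewrite (_ : _ \o _ = (fun t => (EFin \o (fun t => kern t * hcos 0 t)%R) t - (EFin \o (fun t => kern t * hcos s t)%R) t)%E) //.
  exact: integrableB.
have f0 t : 0 < t -> 0 <= f t.
  move=> t0; rewrite subr_ge0 ler_wpM2l ?kern_ge0//.
  by rewrite hcos0; apply: le_trans (hcos_le s t0); exact: ler_norm.
(* A lower bound on [a, b] for the kernel times t^(-1/2): as t >= 1 there, the numerator in
   [kern_ge] is taken at 1 and the denominators at b. *)
pose m : R := kconst R * (16 * 1 / (1 + b) ^+ 5) * (Num.sqrt b)^-1.
have m0 : 0 < m.
  apply: mulr_gt0; last by rewrite invr_gt0 sqrtr_gt0.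
  apply: mulr_gt0; first exact: kconst_gt0.
  by rewrite mulr1 divr_gt0//; apply: exprn_gt0; lra.
have fm t : a <= t -> t <= b -> m <= f t.
  move=> at_ tb; have t1 : 1 <= t by lra.
  have t0 : 0 < t by lra.
  have lt1 : pi / 2 <= s * ln t.
    rewrite [s * _]mulrC -ler_pdivrMr// -ler_expR lnK ?posrE//.
  have lt2 : s * ln t <= pi.
    rewrite [s * _]mulrC -ler_pdivlMr// -ler_expR lnK ?posrE//.
  have c0 := cos_le0_quarter lt1 lt2.
  have sq0 : 0 <= (Num.sqrt t)^-1 by rewrite invr_ge0 sqrtr_ge0.
  apply: (@le_trans _ _ (kern t * (Num.sqrt t)^-1)); last first.
    rewrite /f hcos0 lerDl oppr_ge0 mulr_ge0_le0 ?kern_ge0// /hcos.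
    by rewrite mulr_ge0_le0.
  apply: ler_pM.
  - by apply: mulr_ge0; [exact: ltW (kconst_gt0 _)|apply: divr_ge0; rewrite ?mulr1 ?exprn_ge0//; lra].
  - by rewrite invr_ge0 sqrtr_ge0.
  - apply: le_trans (kern_ge t0); apply: ler_wpM2l; first exact: ltW (kconst_gt0 _).
    apply: ler_pM; [by rewrite mulr1|by rewrite invr_ge0 exprn_ge0//; lra|by rewrite ler_wpM2l|].
    rewrite lef_pV2 ?posrE ?exprn_gt0//; [|lra|lra].
    by apply: lerXn2r; rewrite ?nnegrE; lra.
  - by rewrite lef_pV2 ?posrE ?sqrtr_gt0// ler_wsqrtr.
pose P : set R := `]0, +oo[%classic.
have ifin : (\int[leb]_(t in P) (f t)%:E \is a fin_num)%E by apply: integrable_fin_num; [exact: measurable_itv|exact: fi].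
have mf : measurable_fun (`]0, +oo[%classic : set R) (EFin \o f) by have /measurable_int := fi.
have sub : `[a, b]%classic `<=` (`]0, +oo[%classic : set R).
  by move=> t /=; rewrite !in_itv/= andbT => /andP[h _]; lra.
have f0' (t : R) : (`]0, +oo[%classic : set R) t -> (0 <= (f t)%:E)%E.
  by rewrite /= in_itv/= andbT => t0; rewrite lee_fin f0.
have key : ((m * (b - a))%:E <= \int[leb]_(t in P) (f t)%:E)%E.
  apply: (@le_trans _ _ (\int[leb]_(t in `[a, b]) (f t)%:E)%E); last first.
    apply: ge0_subset_integral => //; rewrite /P; exact: measurable_itv.
  apply: (@le_trans _ _ (\int[leb]_(t in `[a, b]) m%:E)%E).
    by rewrite integral_cst//= lebesgue_measure_itv/= lte_fin ab -EFinD -EFinM.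
  apply: ge0_le_integral => //.
  - by move=> t _; rewrite lee_fin ltW.
  - exact: measurable_funS mf.
  - by move=> t /=; rewrite in_itv/= => /andP[h1 h2]; rewrite lee_fin fm.
rewrite /Rintegral -lte_fin fineK//; apply: lt_le_trans key.
by rewrite lte_fin mulr_gt0// subr_gt0.
Qed.

(** Combine -c(0) <= c(1) with c(1) < c(0). *)
Lemma symb0_gt0 : 0 < symb (0 : R).
Proof.
have := symb_lt (@ltr01 R); have := symb_abs_le 1; rewrite ler_norml => /andP[h _]; lra.
Qed.

Lemma cvg_symb : symb (n.+1%:R^-1 : R) @[n --> \oo] --> symb 0.
Proof.
have D0 : 0 <= 36 * kconst R by rewrite mulr_ge0// ltW// kconst_gt0.
have iD : leb.-integrable `]0, +oo[ (EFin \o (fun t => 36 * kconst R * inv_sq t)).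
  apply: integrableS (integrable_inv_sq D0 (lexx 0)) => //.
  by move=> t /=; rewrite !in_itv/= !andbT; exact: ltW.
have i0 := @symb_integrable R 0.
have [||||| if_ _ key] := @dominated_convergence _ _ _ leb `]0, +oo[%classic (measurable_itv _)
  (fun n => EFin \o (fun t => kern t * hcos (n.+1%:R^-1) t)) (EFin \o (fun t => kern t * hcos 0 t))
  (EFin \o (fun t => 36 * kconst R * inv_sq t)).
- by move=> n; have /measurable_int := @symb_integrable R n.+1%:R^-1.
- by have /measurable_int := i0.
- apply: aeW => t /=; rewrite in_itv/= andbT => t0.
  apply/cvg_EFin; first exact: nearW.
  apply: cvgM; first exact: cvg_cst.
  apply: cvgM; first exact: cvg_cst.
  apply: (@cvg_comp _ _ _ (fun n => n.+1%:R^-1 * ln t) cos _ (nbhs (0 * ln t))); last exact: continuous_cos.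
  by apply: cvgM; [exact: cvg_harmonic|exact: cvg_cst].
- exact: iD.
- apply: aeW => t n /=; rewrite in_itv/= andbT => t0; rewrite lee_fin normrM ger0_norm ?kern_ge0//.
  apply: le_trans (kern_sqrt_le t0).
  by apply: ler_wpM2l; [exact: kern_ge0|exact: hcos_le].
rewrite /symb /row_integral /Rintegral; apply: fine_cvg; rewrite fineK//.
exact: integrable_fin_num.
Qed.

End SymbolStrict.

(** * Weyl sequences *)

Section WeylSequences.
Context (R : realType) (s : R).

(** [wcos] and [wsin] are the real and imaginary parts of (l + 1)^(-1/2 + i s). *)
Definition wcos (l : nat) : R := hcos s l.+1%:R.
Definition wsin (l : nat) : R := hsin s l.+1%:R.

Definition arow (w : nat -> R) N k : R := \sum_(l < N) diagA R k l * w l.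

Definition symb_sin : R := row_integral (hsin s).
Local Notation c := (symb s).
Local Notation d := symb_sin.

(** Real part of the residual for the complex eigenvalue c + i d at the truncation to indices below
    N; [res_sin] is the imaginary part. The term d is kept because its vanishing is deduced from
    estimates on these residuals. *)
Definition res_cos N k : R := arow wcos N k - (k < N)%:R * (c * wcos k - d * wsin k).
Definition res_sin N k : R := arow wsin N k - (k < N)%:R * (c * wsin k + d * wcos k).

Definition harm N : R := \sum_(l < N) l.+1%:R^-1.

Lemma wcos_sin_sqr l : wcos l ^+ 2 + wsin l ^+ 2 = l.+1%:R^-1.
Proof.
rewrite /wcos /wsin /hcos /hsin !exprMn -mulrDr cos2Dsin2 mulr1 exprVn sqr_sqrtr//.
Qed.

Lemma sqrt_succ_gt0 (k : nat) : 0 < Num.sqrt k.+1%:R :> R.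
Proof. by rewrite sqrtr_gt0. Qed.

Lemma phase_quot k l : s * ln (quot R k l) = s * ln l.+1%:R - s * ln k.+1%:R.
Proof. by rewrite /quot ln_div ?posrE// mulrBr. Qed.

Lemma hcos_quot k l : hcos s (quot R k l) =
  Num.sqrt k.+1%:R * (wcos l * cos (s * ln k.+1%:R) + wsin l * sin (s * ln k.+1%:R)).
Proof.
rewrite /hcos /wcos /wsin /hcos /hsin phase_quot cosB /quot sqrtrM// sqrtrV//.
rewrite invfM invrK; ring.
Qed.

Lemma hsin_quot k l : hsin s (quot R k l) =
  Num.sqrt k.+1%:R * (wsin l * cos (s * ln k.+1%:R) - wcos l * sin (s * ln k.+1%:R)).
Proof.
rewrite /hsin /wcos /wsin /hcos /hsin phase_quot sinB /quot sqrtrM// sqrtrV//.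
rewrite invfM invrK; ring.
Qed.

Lemma sum_hcos_quot k N : \sum_(l < N) diagA R k l * hcos s (quot R k l) =
  Num.sqrt k.+1%:R * (arow wcos N k * cos (s * ln k.+1%:R) + arow wsin N k * sin (s * ln k.+1%:R)).
Proof.
rewrite /arow !mulr_suml -big_split/= mulr_sumr; apply: eq_bigr => l _.
by rewrite hcos_quot; ring.
Qed.

Lemma sum_hsin_quot k N : \sum_(l < N) diagA R k l * hsin s (quot R k l) =
  Num.sqrt k.+1%:R * (arow wsin N k * cos (s * ln k.+1%:R) - arow wcos N k * sin (s * ln k.+1%:R)).
Proof.
rewrite /arow !mulr_suml -sumrB mulr_sumr; apply: eq_bigr => l _.
by rewrite hsin_quot; ring.
Qed.

(* Passing from [l] to [(l + 1) / (k + 1)] rotates the pair (cos, sin) by the angle [s * ln (k + 1)]. *)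
Lemma res_sqr N k : (k < N)%N ->
  res_cos N k ^+ 2 + res_sin N k ^+ 2 =
  ((\sum_(l < N) diagA R k l * hcos s (quot R k l) - c) ^+ 2 +
   (\sum_(l < N) diagA R k l * hsin s (quot R k l) - d) ^+ 2) / k.+1%:R.
Proof.
move=> kN; rewrite /res_cos /res_sin kN !mul1r sum_hcos_quot sum_hsin_quot.
rewrite [wcos k]/wcos [wsin k]/wsin /hcos /hsin.
have := sqr_sqrtr (ler0n R k.+1); have := sqrt_succ_gt0 k.
have := cos2Dsin2 (s * ln k.+1%:R : R).
move: (cos _) (sin _) (Num.sqrt _) (arow wcos N k) (arow wsin N k) (symb s) symb_sin => co si q a b c' d' cs q0 qE.
rewrite -qE.
have -> : (q * (a * co + b * si) - c') ^+ 2 + (q * (b * co - a * si) - d') ^+ 2 =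
    (co ^+ 2 + si ^+ 2) * q ^+ 2 * (a ^+ 2 + b ^+ 2) + (c' ^+ 2 + d' ^+ 2)
    - 2 * q * (a * (c' * co - d' * si) + b * (c' * si + d' * co)) by ring.
have -> : (a - (c' * (q^-1 * co) - d' * (q^-1 * si))) ^+ 2 + (b - (c' * (q^-1 * si) + d' * (q^-1 * co))) ^+ 2
   = (a ^+ 2 + b ^+ 2) - 2 / q * (a * (c' * co - d' * si) + b * (c' * si + d' * co))
     + q^-1 ^+ 2 * (co ^+ 2 + si ^+ 2) * (c' ^+ 2 + d' ^+ 2) by ring.
by rewrite cs; field; rewrite lt0r_neq0.
Qed.

Lemma w_le l : `|wcos l| <= (Num.sqrt l.+1%:R)^-1 /\ `|wsin l| <= (Num.sqrt l.+1%:R)^-1.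
Proof. by split; [apply: hcos_le|apply: hsin_le]. Qed.

Lemma invsqrt_le1 (l : nat) : (Num.sqrt l.+1%:R)^-1 <= 1 :> R.
Proof.
rewrite invf_le1 ?sqrt_succ_gt0// -[X in X <= _]sqrtr1 ler_wsqrtr//.
by rewrite ler1n.
Qed.

Section Rows.
Variable w : nat -> R.
Hypothesis wle : forall l, `|w l| <= (Num.sqrt l.+1%:R)^-1.

Lemma arow_le N k : `|arow w N k| <= 1008.
Proof.
apply: le_trans (ler_norm_sum _ _ _) _.
apply: (@le_trans _ _ (\sum_(l < N) 504 * decay R k l)).
  apply: ler_sum => l _; rewrite normrM -[leRHS]mulr1.
  by apply: ler_pM => //; [exact: diagA_le|exact: le_trans (wle l) (invsqrt_le1 l)].
by rewrite -mulr_sumr; have := sum_decay_le R k N; lra.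
Qed.

(** For l < N <= k an entry times the weight is at most a multiple of sqrt(l + 1) / (k + 1)^2.
    Summing N terms and squaring gives N^3 / (k + 1)^4, and N <= k + 1 absorbs two powers. *)
Lemma arow_far_le N k : (N <= k)%N -> arow w N k ^+ 2 <= 504 ^+ 2 * (N%:R / k.+1%:R ^+ 2).
Proof.
move=> Nk; have x0 : 0 < k.+1%:R :> R by [].
have y0 : 0 <= N%:R :> R by [].
have h : `|arow w N k| <= 504 * (N%:R * Num.sqrt N%:R / k.+1%:R ^+ 2).
  apply: le_trans (ler_norm_sum _ _ _) _.
  apply: (@le_trans _ _ (\sum_(l < N) 504 * (Num.sqrt N%:R / k.+1%:R ^+ 2))); last first.
    by rewrite sumr_const card_ord -[_ *+ N]mulr_natl le_eqVlt; apply/orP; left; apply/eqP; ring.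
  apply: ler_sum => l _; rewrite normrM.
  apply: (@le_trans _ _ (504 * decay R k l * (Num.sqrt l.+1%:R)^-1)).
    by apply: ler_pM => //; exact: diagA_le.
  have lN := ltn_ord l.
  have lk : (l <= k)%N by apply: leq_trans (ltnW lN) Nk.
  rewrite -mulrA; apply: ler_wpM2l; first exact: ler0n.
  rewrite /decay (maxn_idPl lk) (minn_idPr lk) !natr1 mulrAC.
  apply: ler_wpM2r; first by rewrite invr_ge0 exprn_ge0.
  rewrite -{1}(sqr_sqrtr (ler0n R l.+1)) expr2 mulfK ?lt0r_neq0 ?sqrt_succ_gt0//.
  by rewrite ler_wsqrtr// ler_nat.
apply: (@le_trans _ _ ((504 * (N%:R * Num.sqrt N%:R / k.+1%:R ^+ 2)) ^+ 2)).
  rewrite -[leLHS]real_normK ?num_real//; move: h; set B := 504 * _ => h.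
  by apply: lerXn2r; rewrite ?nnegrE//; apply: le_trans h.
have -> : (504 * (N%:R * Num.sqrt (N%:R : R) / k.+1%:R ^+ 2)) ^+ 2 =
  504 ^+ 2 * (N%:R / k.+1%:R ^+ 2 * (N%:R ^+ 2 / k.+1%:R ^+ 2)).
  have qE : Num.sqrt N%:R ^+ 2 = N%:R :> R by rewrite sqr_sqrtr.
  move: qE; move: (504 : R) (N%:R : R) (Num.sqrt (N%:R : R)) (k.+1%:R : R) x0 => z n q x x0 qE.
  have -> : (z * (n * q / x ^+ 2)) ^+ 2 = z ^+ 2 * (n / x ^+ 2 * (n * q ^+ 2 / x ^+ 2)) by field; exact: lt0r_neq0.
  by rewrite qE -expr2.
apply: ler_wpM2l; first exact: sqr_ge0.
rewrite ler_piMr ?divr_ge0 ?sqr_ge0 ?ler0n//.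
rewrite ler_pdivrMr ?exprn_gt0// mul1r; apply: lerXn2r; rewrite ?nnegrE//.
by rewrite ler_nat ltnW// ltnS.
Qed.

End Rows.

(** Comparison of N / (k + 1)^2 with N / k - N / (k + 1), which telescopes; the induction carries
    the telescoped value 1 - N / M. *)
Lemma sum_far_le N M : \sum_(k < M) (N <= k)%:R * (N%:R / k.+1%:R ^+ 2) <= 1 :> R.
Proof.
suff h : \sum_(k < M) (N <= k)%:R * (N%:R / k.+1%:R ^+ 2) <= (N <= M)%:R * (1 - N%:R / M%:R) :> R.
  apply: le_trans h _; case: leqP => _; rewrite ?mul0r// mul1r.
  by rewrite gerBl divr_ge0.
elim: M => [|M IH].
  by rewrite big_ord0 leqn0; case: eqP => [->|_]; rewrite ?mul0r// invr0 mulr0 subr0 mulr1.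
rewrite big_ord_recr/=; apply: le_trans (lerD IH (lexx _)) _ => {IH}.
have [NM|MN] := leqP N M; last first.
  rewrite !mul0r addr0; case: (leqP N M.+1) => NM; last by rewrite mul0r.
  by rewrite (_ : N = M.+1) ?divff ?subrr ?mulr0//; apply/eqP; rewrite eqn_leq NM MN.
rewrite leqW// !mul1r.
have [M0|M0] := posnP M.
  by move: NM; rewrite M0 leqn0 => /eqP ->; rewrite !mul0r; lra.
have m0 : 0 < M%:R :> R by rewrite ltr0n.
rewrite -natr1; move: (M%:R : R) m0 => m m0.
have -> : 1 - N%:R / m + N%:R / (m + 1) ^+ 2 = 1 - N%:R / (m + 1) - N%:R / (m * (m + 1) ^+ 2).
  by move: (N%:R : R) => n; field; rewrite !lt0r_neq0//; lra.
by rewrite gerBl divr_ge0// mulr_ge0 ?exprn_ge0 ?addr_ge0 ?(ltW m0).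
Qed.

Lemma sum_truncate_le (g : nat -> R) N M : (forall k, 0 <= g k) ->
  \sum_(k < M) (k < N)%:R * g k <= \sum_(k < N) g k.
Proof.
move=> g0; have -> : \sum_(k < M) (k < N)%:R * g k = \sum_(k < minn M N) g k.
  elim: M => [|M IH]; first by rewrite min0n !big_ord0.
  rewrite big_ord_recr/= IH; have [MN|NM] := ltnP M N.
    by rewrite (minn_idPl MN) big_ord_recr/= mul1r.
  by rewrite mul0r addr0 (minn_idPr (leqW NM)).
rewrite -(subnKC (geq_minr M N)) big_split_ord/= (subnKC (geq_minr M N)) lerDl.
by apply: sumr_ge0.
Qed.

(** The boundary error squared and divided by x is at most 2016^2 / N, because x N <= (x + N)^2.
    Summed over the N rows it therefore stays bounded, while the first term sums to a small multiple
    of the harmonic sum. *)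
Lemma near_term_le (e x N a : R) : 0 <= e -> 0 < x -> x <= N -> `|a| <= e + 2016 * x / (x + N) ->
  a ^+ 2 / x <= 2 * e ^+ 2 / x + 2 * 2016 ^+ 2 / N.
Proof.
move=> e0 x0 xN ha; have N0 : 0 < N by lra.
set b := 2016 * x / (x + N) in ha *.
have b0 : 0 <= b by rewrite /b; apply: divr_ge0; lra.
have a2 : a ^+ 2 <= 2 * e ^+ 2 + 2 * b ^+ 2.
  rewrite -[a ^+ 2]real_normK ?num_real//; have := sqr_ge0 (e - b).
  have : `|a| ^+ 2 <= (e + b) ^+ 2 by apply: lerXn2r; rewrite ?nnegrE//; lra.
  by rewrite !expr2; lra.
have b2 : b ^+ 2 / x <= 2016 ^+ 2 / N.
  have -> : b ^+ 2 / x = 2016 ^+ 2 * (x / (x + N) ^+ 2).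
    by rewrite /b; move: (2016 : R) => z; field; rewrite !lt0r_neq0//; lra.
  apply: ler_wpM2l; first exact: sqr_ge0.
  rewrite ler_pdivrMr ?exprn_gt0//; last by lra.
  rewrite mulrC ler_pdivlMr//; nra.
apply: (@le_trans _ _ ((2 * e ^+ 2 + 2 * b ^+ 2) / x)); first by rewrite ler_pM2r ?invr_gt0.
by rewrite mulrDl -[2 * b ^+ 2 / x]mulrA -[2 * 2016 ^+ 2 / N]mulrA; lra.
Qed.

(** Rows fall into three ranges: the first k0, where only boundedness is known; the rows up to N,
    governed by the Riemann sums; and the rows beyond N, seen only through decay. Only the middle
    range grows with N, and its rate e is arbitrarily small. *)
Lemma res_sum_le e : 0 < e -> exists K, forall N M,
  \sum_(k < M) (res_cos N k ^+ 2 + res_sin N k ^+ 2) <= e * harm N + K.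
Proof.
(* The divisor 4 accounts for the factor 2 in [near_term_le] and for the two parts, cosine and
   sine. *)
move=> e0; pose e1 := Num.sqrt (e / 4).
have e10 : 0 < e1 by rewrite sqrtr_gt0 divr_gt0.
have e1E : 4 * e1 ^+ 2 = e by rewrite sqr_sqrtr ?divr_ge0 ?(ltW e0)//; field.
have [kc hc] := (row_integralP (@hcos_le R s) (@hcos_continuous R s)).2 e1 e10.
have [ks hs] := (row_integralP (@hsin_le R s) (@hsin_continuous R s)).2 e1 e10.
(* [K1] bounds each of the first k0 rows; [K2] and [K3] collect the boundary errors below N and the
   rows beyond N, each for both parts. *)
pose k0 := maxn kc ks; pose K1 := 2 * (1008 + `|c| + `|d|) ^+ 2.
pose K2 : R := 4 * 2016 ^+ 2; pose K3 : R := 2 * 504 ^+ 2.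
have K10 : 0 <= K1 by apply: mulr_ge0; [exact: ler0n|exact: sqr_ge0].
have K20 : 0 <= K2 by apply: mulr_ge0; [exact: ler0n|exact: sqr_ge0].
have K30 : 0 <= K3 by apply: mulr_ge0; [exact: ler0n|exact: sqr_ge0].
exists (K1 * k0%:R + K2 + K3) => N M.
have term k : res_cos N k ^+ 2 + res_sin N k ^+ 2 <=
    (k < k0)%:R * K1 + (k < N)%:R * (e / k.+1%:R + K2 / N%:R) + K3 * ((N <= k)%:R * (N%:R / k.+1%:R ^+ 2)).
  have p1 : 0 <= e / k.+1%:R + K2 / N%:R.
    by apply: addr_ge0; apply: divr_ge0 => //; exact: ltW.
  have [kN|Nk] := ltnP k N; last first.
    rewrite /res_cos /res_sin [(k < N)%N]ltnNge Nk/= !mul0r !subr0 addr0 mul1r.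
    have := arow_far_le (fun l => (w_le l).1) Nk; have := arow_far_le (fun l => (w_le l).2) Nk.
    rewrite /K3; move: (_ / _) (504 ^+ 2) => x y h1 h2.
    have : 0 <= (k < k0)%:R * K1 by rewrite mulr_ge0.
    lra.
  rewrite /= [0 * (N%:R / _)]mul0r mulr0 addr0 mul1r.
  have [kk0|k0k] := ltnP k k0.
    rewrite mul1r; apply: (@le_trans _ _ K1); last by rewrite lerDl.
    have w1 : `|wcos k| <= 1 /\ `|wsin k| <= 1.
      by have [h1 h2] := w_le k; split; [apply: le_trans h1 _|apply: le_trans h2 _]; exact: invsqrt_le1.
    have sq (B x y u v a : R) : `|a| <= B -> `|u| <= 1 -> `|v| <= 1 ->
       (a - (x * u + y * v)) ^+ 2 <= (B + `|x| + `|y|) ^+ 2.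
      move=> ha hu hv; rewrite -[leLHS]real_normK ?num_real//.
      apply: lerXn2r; rewrite ?nnegrE//; first by rewrite !addr_ge0//; exact: le_trans ha.
      apply: le_trans (ler_normB _ _) _; rewrite -addrA lerD//.
      by apply: le_trans (ler_normD _ _) _; rewrite !normrM lerD// ler_piMr.
    have := sq 1008 c (- d) (wcos k) (wsin k) (arow wcos N k) (arow_le (fun l => (w_le l).1) N k) w1.1 w1.2.
    have := sq 1008 c d (wsin k) (wcos k) (arow wsin N k) (arow_le (fun l => (w_le l).2) N k) w1.2 w1.1.
    rewrite /res_cos /res_sin kN !mul1r normrN mulNr /K1.
    move: (_ ^+ 2) (_ ^+ 2) (_ ^+ 2) => x y z; lra.
  rewrite mul0r add0r res_sqr// mulrDl.
  have x0 : 0 < k.+1%:R :> R by [].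
  have xN : k.+1%:R <= N%:R :> R by rewrite ler_nat.
  have h1 := near_term_le (ltW e10) x0 xN (hc k N (leq_trans (leq_maxl _ _) k0k)).
  have h2 := near_term_le (ltW e10) x0 xN (hs k N (leq_trans (leq_maxr _ _) k0k)).
  have e1E' : e / k.+1%:R = 2 * e1 ^+ 2 / k.+1%:R + 2 * e1 ^+ 2 / k.+1%:R by rewrite -e1E; ring.
  have K2E : K2 / N%:R = 2 * 2016 ^+ 2 / N%:R + 2 * 2016 ^+ 2 / N%:R by rewrite /K2; ring.
  rewrite e1E' K2E addrACA; exact: lerD.
apply: (@le_trans _ _ (\sum_(k < M) ((k < k0)%:R * K1 + (k < N)%:R * (e / k.+1%:R + K2 / N%:R)
    + K3 * ((N <= k)%:R * (N%:R / k.+1%:R ^+ 2))))); first by apply: ler_sum => k _; exact: term.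
rewrite !big_split/= -mulr_sumr.
have g0 k : 0 <= e / k.+1%:R + K2 / N%:R by apply: addr_ge0; apply: divr_ge0 => //; exact: ltW.
have h1 := sum_truncate_le k0 M (fun _ => K10); have h2 := sum_truncate_le N M g0.
have h3 : K3 * \sum_(k < M) (N <= k)%:R * (N%:R / k.+1%:R ^+ 2) <= K3.
  by rewrite ler_piMr// sum_far_le.
have h4 : \sum_(k < k0) K1 = K1 * k0%:R by rewrite sumr_const card_ord mulr_natr.
have h5 : \sum_(k < N) (e / k.+1%:R + K2 / N%:R) <= e * harm N + K2.
  rewrite big_split/= -mulr_sumr sumr_const card_ord lerD2l -[_ *+ N]mulr_natr.
  by have [->|N0] := posnP N; [rewrite mulr0|rewrite divfK// pnatr_eq0 -lt0n].
rewrite h4 in h1; rewrite -addrA [K1 * _ + K2 + K3]addrC !addrA.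
move: h1 (le_trans h2 h5) h3; move: (\sum_(k < M) _) (\sum_(k < M) _) (K3 * _) => x y z.
move: (K1 * _) (e * _) => p q; lra.
Qed.

End WeylSequences.

(** * Vanishing of the sine part and small relative residuals *)

Section WeylLimit.
Context (R : realType).

Lemma harm_unbounded (B : R) : exists N, B < harm R N.
Proof.
have hE : (fun N => harm R N) = series (@harmonic R).
  by apply/funext => N; rewrite /harm /series/= big_mkord.
have [//|/forallNP h] := pselect (exists N, B < harm R N).
exfalso; apply: (@dvg_harmonic R); rewrite -hE; apply: nondecreasing_is_cvgn.
  apply/nondecreasing_seqP => N; rewrite /harm big_ord_recr/= lerDl invr_ge0//.
by exists B => _ [N _ <-]; rewrite leNgt; apply/negP.
Qed.

Lemma weighted_amgm (t a b : R) : 0 < t -> `|a * b| <= t * a ^+ 2 + b ^+ 2 / t.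
Proof.
move=> t0; rewrite normrM -[a ^+ 2]real_normK ?num_real// -[b ^+ 2]real_normK ?num_real//.
move: (normr_ge0 a) (normr_ge0 b); move: `|a| `|b| => x y x0 y0.
have : 0 <= (t * x - y) ^+ 2 / t by rewrite divr_ge0 ?sqr_ge0// ltW.
have -> : (t * x - y) ^+ 2 / t = t * x ^+ 2 + y ^+ 2 / t - 2 * (x * y).
  by field; rewrite lt0r_neq0.
by have := mulr_ge0 x0 y0; lra.
Qed.

Variable s : R.
Local Notation wc := (wcos s).
Local Notation ws := (wsin s).

(** The right side is the cross pairing of the two truncated vectors with their residuals. The
    matrix terms cancel by symmetry and the c terms cancel pairwise, which leaves d times the sum of
    squares. *)
Lemma symb_sin_harm N : symb_sin s * harm R N =
  \sum_(k < N) (ws k * res_cos s N k - wc k * res_sin s N k).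
Proof.
have sym : \sum_(k < N) ws k * arow wc N k = \sum_(k < N) wc k * arow ws N k.
  rewrite /arow; under eq_bigr do rewrite mulr_sumr.
  rewrite exchange_big/=; apply: eq_bigr => l _; rewrite mulr_sumr; apply: eq_bigr => k _.
  by rewrite diagA_sym; ring.
have -> : \sum_(k < N) (ws k * res_cos s N k - wc k * res_sin s N k) =
    \sum_(k < N) (ws k * arow wc N k - wc k * arow ws N k + symb_sin s * k.+1%:R^-1).
  by apply: eq_bigr => k _; rewrite -(wcos_sin_sqr s) /res_cos /res_sin ltn_ord !mul1r; ring.
by rewrite big_split/= sumrB sym subrr add0r -mulr_sumr.
Qed.

(* Symmetry of the matrix forces the sine part of its symbol to vanish. *)
Lemma symb_sin0 : symb_sin s = 0.
Proof.
apply/eqP; rewrite -normr_eq0; apply/negPn/negP => d0.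
have {}d0 : 0 < `|symb_sin s| by rewrite lt0r d0 normr_ge0.
(* With this t the estimate below reads d H <= 2 t H + K / t = d H / 2 + K / t for the harmonic sum
   H, which fails once H exceeds 2 (K / t) / d. *)
move: d0; set d := `|_| => d0; pose t := d / 4.
have t0 : 0 < t by rewrite divr_gt0.
have [K hK] := res_sum_le s (exprn_gt0 2 t0).
have [N hN] := harm_unbounded (2 * (K / t) / d).
have : d * harm R N <= 2 * t * harm R N + K / t.
  have H0 : 0 <= harm R N by apply: sumr_ge0 => k _; rewrite invr_ge0.
  rewrite -[harm R N in leLHS]ger0_norm// -normrM symb_sin_harm.
  apply: le_trans (ler_norm_sum _ _ _) _.
  apply: (@le_trans _ _ (\sum_(k < N) (t * k.+1%:R^-1 + (res_cos s N k ^+ 2 + res_sin s N k ^+ 2) / t))).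
    apply: ler_sum => k _; rewrite -(wcos_sin_sqr s).
    have := weighted_amgm (ws k) (res_cos s N k) t0; have := weighted_amgm (wc k) (res_sin s N k) t0.
    have := ler_normB (ws k * res_cos s N k) (wc k * res_sin s N k).
    by rewrite mulrDr mulrDl; lra.
  rewrite big_split/= -mulr_sumr -mulr_suml -/(harm R N).
  have : (\sum_(k < N) (res_cos s N k ^+ 2 + res_sin s N k ^+ 2)) / t <= t * harm R N + K / t.
    rewrite ler_pdivrMr// mulrDl divfK ?gt_eqF//; have := hK N N.
    by rewrite expr2 [t * t * _]mulrAC.
  by lra.
have : 2 * (K / t) < harm R N * d by rewrite -ltr_pdivrMr.
by rewrite /t; nra.
Qed.

(** Divergence of the harmonic sum lets half of e absorb the constant K. The bound B leaves freedom
    to make the unnormalised vectors as long as desired. *)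
Lemma res_sum_small e B : 0 < e -> exists N, B < harm R N /\ forall M,
  \sum_(k < M) (res_cos s N k ^+ 2 + res_sin s N k ^+ 2) <= e * harm R N.
Proof.
move=> e0; have e20 : 0 < e / 2 by rewrite divr_gt0.
have [K hK] := res_sum_le s e20.
have [N hN] := harm_unbounded (Num.max B (K / (e / 2))).
move: hN; rewrite gt_max => /andP[hB]; rewrite ltr_pdivrMr// => hN.
by exists N; split => // M; apply: le_trans (hK N M) _; lra.
Qed.

End WeylLimit.

(** * The operator on the bivectors with equal indices *)

Section DiagonalVectors.
Context (R : realType).
Local Notation Q := (@curvature_operator R).

Definition dg (k : nat) : wedge_basis :=
  exist (fun p : frame * frame => before p.1 p.2) (inl k, inr k) isT.

Lemma dg_inj : injective dg. Proof. by move=> k l [->]. Qed.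

Lemma mem_dg k N : (dg k \in wedge_trunc N) = (k < N)%N.
Proof. by rewrite mem_wedge_trunc andbb. Qed.

Lemma sum_wedge_diag (F : wedge_basis -> R) N : (forall e, (forall k, e != dg k) -> F e = 0) ->
  \sum_(e <- wedge_trunc N) F e = \sum_(k < N) F (dg k).
Proof.
move=> F0; pose s := [seq dg k | k <- iota 0 N].
have us : uniq s by rewrite map_inj_uniq ?iota_uniq//; exact: dg_inj.
have st : {subset s <= wedge_trunc N}.
  by move=> _ /mapP[k + ->]; rewrite mem_iota add0n mem_dg.
rewrite (sum_uniq_subset F us (wedge_trunc_uniq N) st) [X in _ + X]big1_seq ?addr0.
  by rewrite big_map (_ : iota 0 N = index_iota 0 N) ?big_mkord// /index_iota subn0.
move=> e /andP[es eN]; apply: F0 => k; apply: contraNneq es => eE.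
by move: eN; rewrite eE mem_dg => kN; apply/map_f; rewrite mem_iota.
Qed.

Lemma curv_expand (a b c d : frame) :
  let i := frame_idx a in let j := frame_idx b in let k := frame_idx c in let l := frame_idx d in
  let p := frame_coef R a in let q := frame_coef R b in
  let u := frame_coef R c in let v := frame_coef R d in
  curv R a b c d = complex.Re
   (p true * q false * u true * v false * (curv_r R j i l k)%:C%C
    - p true * q false * u false * v true * (curv_r R j i k l)%:C%C
    - p false * q true * u true * v false * (curv_r R i j l k)%:C%C
    + p false * q true * u false * v true * (curv_r R i j k l)%:C%C).
Proof.
rewrite /curv !big_bool/= !mulr0 !addr0 !add0r !curv_tr.
by congr complex.Re; ring.
Qed.

(** Each of the four surviving terms of the expansion contributes -1 times the same entry: the
    products of the coefficients 1, i and -i are -1 or 1, matched by the signs of the tensor. *)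
Lemma curvB_dg k l : curvB R (dg k) (dg l) = - 4 * diagA R k l.
Proof.
rewrite /curvB curv_expand; set z := (X in complex.Re X).
suff -> : z = (- 4 * diagA R k l)%:C%C by [].
rewrite /z [LHS]/= -/(diagA R k l); move: (diagA R k l) => A.
have ii : 'i%C * 'i%C = -1 :> R[i] by rewrite -expr2 sqr_i.
rewrite rmorphM rmorphN rmorph_nat; ring: ii.
Qed.

(** Against two equal indices l, l the relation i + k = j + l forces i = j, and among ordered basis
    bivectors only d/dx_i /\ d/dy_i has equal indices. This is the invariance of the diagonal
    span. *)
Lemma curvB_off e l : (forall k, e != dg k) -> curvB R e (dg l) = 0.
Proof.
case: e => [[a b] hab] edg; rewrite /curvB curv_expand.
have ij : frame_idx a != frame_idx b.
  apply/eqP; case: a b hab edg => i [] j //= hab edg ij; do ?by move: hab {edg}; rewrite ij ltnn.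
  by have /eqP := edg i; apply; apply: val_inj; rewrite /= ij.
have z i j : i != j -> curv_r R i j l l = 0.
  by move=> ij'; rewrite /curv_r eqn_add2r (negbTE ij').
rewrite [frame_idx _]/= (z _ _ ij) (z (frame_idx b) (frame_idx a)); last by rewrite eq_sym.
by rewrite !mulr0 !addr0 !subr0.
Qed.

Lemma ell2_sumE (V : nat -> wedge2 R) N e : (\sum_(l < N) V l) e = \sum_(l < N) V l e.
Proof.
elim: N => [|N IH]; first by rewrite !big_ord0.
by rewrite !big_ord_recr/= -IH.
Qed.

Definition dvec (w : nat -> R) N : wedge2 R := \sum_(l < N) w l *: delta R (dg l).

Lemma dvecE w N e : dvec w N e = \sum_(l < N) w l * (e == dg l)%:R.
Proof. exact: (ell2_sumE (fun l => w l *: delta R (dg l))). Qed.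

Lemma dvec_off w N e : (forall k, e != dg k) -> dvec w N e = 0.
Proof. by move=> he; rewrite dvecE big1// => l _; rewrite (negbTE (he l)) mulr0. Qed.

Lemma dvec_dg w N k : dvec w N (dg k) = (k < N)%:R * w k.
Proof.
rewrite dvecE; under eq_bigr do rewrite (inj_eq dg_inj).
have [kN|Nk] := ltnP k N.
  rewrite (bigD1 (Ordinal kN))//= eqxx mulr1 big1 ?addr0 ?mul1r// => l.
  by rewrite -val_eqE/= eq_sym => /negbTE ->; rewrite mulr0.
rewrite big1 ?mul0r// => l _; rewrite gtn_eqF ?mulr0//.
exact: leq_trans (ltn_ord l) Nk.
Qed.

Lemma sum_truncated (g : nat -> R) N M : (N <= M)%N ->
  \sum_(k < M) (k < N)%:R * g k = \sum_(k < N) g k.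
Proof.
move=> NM; rewrite (big_ord_widen M g NM) [RHS]big_mkcond/=.
by apply: eq_bigr => k _; case: ifP; rewrite ?mul1r ?mul0r.
Qed.

Lemma norm_dvec w N : `|dvec w N| ^+ 2 = \sum_(k < N) w k ^+ 2.
Proof.
have c : psum wedge_trunc (dvec w N) K @[K --> \oo] --> `|dvec w N| ^+ 2.
  by apply: cvg_psum; [exact: wedge_trunc_uniq|exact: wedge_trunc_mono|exact: wedge_trunc_cover].
apply/esym; rewrite -(cvg_lim _ c)//; apply/esym/cvg_lim => //.
apply: cvg_near_cst; near=> M; have NM : (N <= M)%N by near: M; exists N.
rewrite /psum sum_wedge_diag => [|e he]; last by rewrite dvec_off// expr0n.
rewrite -(sum_truncated (fun k => w k ^+ 2) NM); apply: eq_bigr => k _.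
by rewrite dvec_dg; case: (k < N)%N; rewrite ?mul1r// !mul0r expr0n.
Unshelve. all: by end_near. Qed.

Lemma curvature_dvec w N e : Q (dvec w N) e = \sum_(l < N) curvB R e (dg l) * w l.
Proof.
rewrite curvature_operatorE; apply/cvg_lim => //; apply: cvg_near_cst; near=> M.
have NM : (N <= M)%N by near: M; exists N.
rewrite sum_wedge_diag => [|f hf]; last by rewrite dvec_off// mulr0.
rewrite -(sum_truncated (fun l => curvB R e (dg l) * w l) NM); apply: eq_bigr => l _.
by rewrite dvec_dg mulrCA.
Unshelve. all: by end_near. Qed.

(** Off the diagonal bivectors the residual vanishes; on them it is -4 times the residual of the
    matrix, whence the factor 16. *)
Lemma norm_residual_le (w : nat -> R) (lam : R) N M :
  (forall K, \sum_(k < K) (arow w N k - (k < N)%:R * (lam * w k)) ^+ 2 <= M) ->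
  `|Q (dvec w N) - (- 4 * lam) *: dvec w N| ^+ 2 <= 16 * M.
Proof.
move=> hM; apply: (norm_le_psum wedge_trunc_uniq wedge_trunc_mono wedge_trunc_cover) => K.
have E e : (Q (dvec w N) - (- 4 * lam) *: dvec w N) e =
    Q (dvec w N) e + 4 * lam * dvec w N e.
  by rewrite [LHS](_ : _ = Q (dvec w N) e - (- 4 * lam) * dvec w N e)//; ring.
rewrite /psum sum_wedge_diag => [|e he]; last first.
  rewrite E curvature_dvec dvec_off// mulr0 addr0 big1 ?expr0n// => l _.
  by rewrite curvB_off// mul0r.
apply: (@le_trans _ _ (16 * \sum_(k < K) (arow w N k - (k < N)%:R * (lam * w k)) ^+ 2)); last first.
  by apply: ler_wpM2l; [exact: ler0n|exact: hM].
rewrite mulr_sumr le_eqVlt; apply/orP; left; apply/eqP; apply: eq_bigr => k _.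
rewrite E curvature_dvec dvec_dg.
under eq_bigr do rewrite curvB_dg -mulrA.
by rewrite -mulr_sumr -/(arow w N k); ring.
Qed.

End DiagonalVectors.

(** * Approximate eigenvectors, spectrum and failure of compactness *)

Section ApproximateEigenvectors.
Context (R : realType).
Local Notation Q := (@curvature_operator R).

(** Both residuals are measured against the harmonic sum, which is the total squared norm of the
    pair at a = 1; no separate lower bound on the cosine or sine vector is available. The factor a
    allows normalisation afterwards. *)
Lemma weyl_residual (s e B : R) : 0 < e -> exists N, B < harm R N /\ forall a : R,
  `|Q (dvec (fun l => a * wcos s l) N) - (- 4 * symb s) *: dvec (fun l => a * wcos s l) N| ^+ 2
    <= e * (a ^+ 2 * harm R N) /\
  `|Q (dvec (fun l => a * wsin s l) N) - (- 4 * symb s) *: dvec (fun l => a * wsin s l) N| ^+ 2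
    <= e * (a ^+ 2 * harm R N).
Proof.
move=> e0; have e16 : 0 < e / 16 by rewrite divr_gt0.
have [N [hB hN]] := res_sum_small s B e16; exists N; split=> // a.
have arowZ w k : arow (fun l => a * w l) N k = a * arow w N k.
  by rewrite /arow mulr_sumr; apply: eq_bigr => l _; ring.
have -> : e * (a ^+ 2 * harm R N) = 16 * (a ^+ 2 * (e / 16 * harm R N)) by field.
split; apply: norm_residual_le => K; (apply: le_trans (_ : a ^+ 2 * \sum_(k < K) (res_cos s N k ^+ 2 + res_sin s N k ^+ 2) <= _); last by apply: ler_wpM2l; [exact: sqr_ge0|exact: hN]);
  rewrite mulr_sumr; apply: ler_sum => k _; rewrite arowZ.
- rewrite (_ : _ ^+ 2 = a ^+ 2 * res_cos s N k ^+ 2); last by rewrite /res_cos symb_sin0; ring.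
  by rewrite ler_wpM2l ?sqr_ge0// lerDl sqr_ge0.
- rewrite (_ : _ ^+ 2 = a ^+ 2 * res_sin s N k ^+ 2); last by rewrite /res_sin symb_sin0; ring.
  by rewrite ler_wpM2l ?sqr_ge0// lerDr sqr_ge0.
Qed.

(** A continuous inverse bounds the norm of every vector by r times its residual. Adding the two
    estimates for the cosine and sine vectors contradicts the fact that their squared norms sum to
    the positive harmonic sum. *)
Lemma spectrum_symb (s : R) : spectrum Q (- 4 * symb s).
Proof.
move=> [S [cS SK _]].
have /linear_boundedP bS := continuous_linear_bounded 0 (cS 0).
have [r [r0 hr]] : exists r, 0 < r /\ forall x, `|S x| <= r * `|x|.
  have [M [Mr hM]] := bS; exists (Num.max 1 (M + 1)); split; first by rewrite lt_max ltr01.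
  by apply: hM; rewrite lt_max ltrDl ltr01 orbT.
have bound v : `|v| ^+ 2 <= r ^+ 2 * `|Q v - (- 4 * symb s) *: v| ^+ 2.
  rewrite -exprMn -{1}(SK v); apply: lerXn2r; rewrite ?nnegrE//.
  by rewrite mulr_ge0// ltW.
(* With this tolerance each squared norm is at most a quarter of the harmonic sum, so together they
   reach at most half of it. *)
have e0 : 0 < (4 * r ^+ 2)^-1 by rewrite invr_gt0 mulr_gt0 ?exprn_gt0.
have [N [H0 hN]] := weyl_residual s 0 e0.
have [hc hs] := hN 1.
have nE : `|dvec (fun l => 1 * wcos s l) N| ^+ 2 + `|dvec (fun l => 1 * wsin s l) N| ^+ 2 = harm R N.
  rewrite !norm_dvec -big_split/=; apply: eq_bigr => l _.
  by rewrite !mul1r wcos_sin_sqr.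
have := le_trans (bound _) (ler_wpM2l (sqr_ge0 r) hc).
have := le_trans (bound _) (ler_wpM2l (sqr_ge0 r) hs).
have -> : r ^+ 2 * ((4 * r ^+ 2)^-1 * (1 ^+ 2 * harm R N)) = harm R N / 4.
  by field; exact: lt0r_neq0.
by move: nE; move: (_ ^+ 2) (_ ^+ 2) => x y; lra.
Qed.

(** At s = 0 the sine vector vanishes, so the cosine vector alone carries the norm and can be
    normalised. *)
Lemma unit_weyl (e : R) : 0 < e -> exists W : wedge2 R,
  [/\ `|W| = 1, `|Q W - (- 4 * symb (0 : R)) *: W| <= e & forall f, `|W f| <= e].
Proof.
move=> e0; have [N [HN hN]] := weyl_residual 0 (e ^- 2) (exprn_gt0 2 e0).
have H0 : 0 < harm R N by apply: lt_trans HN; rewrite invr_gt0 exprn_gt0.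
pose a := (Num.sqrt (harm R N))^-1.
have a2 : a ^+ 2 * harm R N = 1 by rewrite exprVn sqr_sqrtr ?(ltW H0)// mulVf// gt_eqF.
have a0 : 0 <= a by rewrite invr_ge0 sqrtr_ge0.
exists (dvec (fun l => a * wcos 0 l) N); have [h _] := hN a; split.
- apply/eqP; rewrite -(@eqrXn2 _ 2)// expr1n norm_dvec; apply/eqP.
  rewrite -a2 mulr_sumr; apply: eq_bigr => l _.
  by rewrite exprMn -(wcos_sin_sqr 0) /wsin /hsin mul0r sin0 mulr0 expr0n addr0.
- by move: h; rewrite a2 mulr1 ler_pXn2r ?nnegrE ?(ltW e0).
move=> f; have ae : a <= e.
  rewrite -(@ler_pXn2r _ 2) ?nnegrE ?(ltW e0)//.
  have : a ^+ 2 * e ^- 2 <= 1 by rewrite -a2 ler_wpM2l ?sqr_ge0// ltW.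
  by rewrite ler_pdivrMr ?exprn_gt0// mul1r.
have [hf|/existsNP[k /negP/negPn/eqP ->]] := pselect (forall k, f != dg k).
  by rewrite dvec_off// normr0 ltW.
rewrite dvec_dg; case: (k < N)%N; last by rewrite mul0r normr0 ltW.
rewrite mul1r normrM ger0_norm//; have [w1 _] := w_le (0 : R) k.
by apply: le_trans ae; rewrite ler_piMr//; exact: le_trans w1 (invsqrt_le1 R k).
Qed.

(** Compactness gives the images of unit Weyl vectors a cluster point x. Its coordinates are limits
    of -lam times coordinates that tend to 0, so x = 0, while the images keep norm close to lam >
    0. *)
Lemma not_compact_curvature_operator : ~ compact_operator Q.
Proof.
move=> cQ; pose B : set (wedge2 R) := [set v | `|v| <= 1].
have bB : bounded_set B.
  by exists 1; split; [rewrite num_real|move=> x x1 v /= /le_trans; apply; exact: ltW].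
have /choice[W hW] : forall n : nat, exists W : wedge2 R,
    [/\ `|W| = 1, `|Q W - (- 4 * symb (0 : R)) *: W| <= n.+1%:R^-1 & forall f, `|W f| <= n.+1%:R^-1].
  by move=> n; apply: unit_weyl; rewrite invr_gt0.
have := cQ B bB; rewrite precompactE => /(_ ((Q \o W) @ \oo) _)[|x [_ cx]].
  exists 0%N => // n _ /=; apply: subset_closure; exists (W n) => //.
  by rewrite /B/=; have [-> _ _] := hW n.
have l0 : 0 < 4 * symb (0 : R) by rewrite mulr_gt0// symb0_gt0.
set lam := 4 * symb (0 : R) in l0.
have close (e : R) : 0 < e -> exists n : nat, n.+1%:R^-1 <= e /\ `|x - Q (W n)| <= e.
  move=> e0.
  move/cvgr0Pnorm_le: (@cvg_harmonic R) => /(_ e e0)[n0 _ h0].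
  have [||y [[n ne ->] xy]] := cx [set y | exists2 n : nat, n.+1%:R^-1 <= e & y = Q (W n)] (ball x e).
  - exists n0 => // n /= /h0 hn; exists n => //; move: hn; rewrite ger0_norm//.
    by rewrite invr_ge0.
  - exact: nbhsx_ballx.
  by exists n; split=> //; move: xy; rewrite -ball_normE /= => /ltW.
have x0 : x = 0.
  apply/val_inj/funext => f /=; apply/eqP; rewrite -normr_eq0; apply/negPn/negP => xf.
  have {}xf : 0 < `|x f| by rewrite lt0r xf normr_ge0.
  (* Three errors e, e and lam * e then add up to half of |x f|. *)
  pose e := `|x f| / (2 * (2 + lam)).
  have e0 : 0 < e by rewrite divr_gt0// mulr_gt0//; lra.
  have [n [ne hx]] := close e e0; have [W1 hQ hf] := hW n.
  have c1 := le_trans (ell2_coord_le wedge_trunc_uniq wedge_trunc_cover (x - Q (W n)) f) hx.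
  have c2 := le_trans (ell2_coord_le wedge_trunc_uniq wedge_trunc_cover
    (Q (W n) - (- 4 * symb (0 : R)) *: W n) f) (le_trans hQ ne).
  have c3 := le_trans (hf f) ne.
  have E : x f = (x - Q (W n)) f + (Q (W n) - (- 4 * symb (0 : R)) *: W n) f - lam * W n f.
    rewrite (_ : (x - Q (W n)) f = x f - Q (W n) f)//.
    rewrite (_ : (Q (W n) - _) f = Q (W n) f - (- 4 * symb (0 : R)) * W n f)//.
    by rewrite /lam; ring.
  have : `|x f| <= e + e + lam * e.
    rewrite {1}E; apply: le_trans (ler_normB _ _) _; apply: lerD.
      by apply: le_trans (ler_normD _ _) _; exact: lerD.
    by rewrite normrM gtr0_norm// ler_wpM2l// ltW.
  have -> : e + e + lam * e = `|x f| / 2 by rewrite /e; field; rewrite lt0r_neq0//; lra.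
  lra.
have e0 : 0 < lam / 4 by rewrite divr_gt0.
have [n [ne hx]] := close (lam / 4) e0; have [W1 hQ _] := hW n.
have : lam <= `|Q (W n) - (- 4 * symb (0 : R)) *: W n| + `|Q (W n)|.
  have -> : lam = `|(- 4 * symb (0 : R)) *: W n|.
    by rewrite normrZ W1 mulr1 mulNr normrN gtr0_norm.
  by rewrite [leRHS]addrC -[X in `|X| <= _](subKr (Q (W n))); exact: ler_normB.
move: hx; rewrite x0 sub0r normrN; have := le_trans hQ ne; lra.
Qed.

End ApproximateEigenvectors.

Theorem theorem1p5 (R : realType) :
  ~ compact_operator (@curvature_operator R) /\
  ~ discrete_set
      (spectrum (@curvature_operator R) `&` `[- 16 * Num.sqrt (3 / pi), 0[).
Proof.
split; first exact: not_compact_curvature_operator.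
(* The value 9 is the bound on 4 c(0); the inequality (9/16)^2 <= 3 / pi already follows from pi <
   4. *)
have lo : - 16 * Num.sqrt (3 / pi) <= - 9 :> R.
  have : 9 / 16 <= Num.sqrt (3 / pi) :> R.
    rewrite -[leLHS]ger0_norm ?divr_ge0// -sqrtr_sqr ler_wsqrtr//.
    have := @pihalf_lt2 R; have := pi_gt0 R; move: (pi : R) => y y0 y4.
    rewrite ler_pdivlMr//; lra.
  lra.
have mem (s : R) : 0 < symb s -> (spectrum (@curvature_operator R) `&` `[- 16 * Num.sqrt (3 / pi), 0[) (- 4 * symb s).
  move=> s0; split; first exact: spectrum_symb.
  rewrite /= in_itv/=; have := symb_abs_le s; have := symb0_le R; rewrite gtr0_norm// => h1 h2.
  by apply/andP; split; lra.
move=> /(_ _ (mem 0 (@symb0_gt0 R)))[_ [V V0 VD]].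
have c : - 4 * symb (n.+1%:R^-1 : R) @[n --> \oo] --> - 4 * symb (0 : R).
  by apply: cvgM; [exact: cvg_cst|exact: cvg_symb].
have [n1 _ h1] := c _ V0.
(* Tolerance c(0) keeps the nearby symbols positive, so their spectral points remain below 0 and in
   the interval. *)
have /cvgrPdist_lt /(_ _ (@symb0_gt0 R))[n2 _ h2] := @cvg_symb R.
pose n := maxn n1 n2.
have := h1 n (leq_maxl _ _); have := h2 n (leq_maxr _ _) => /= hn Vn.
have sn : 0 < symb (n.+1%:R^-1 : R).
  by move: hn; rewrite ltr_norml => /andP[_]; rewrite ltrBlDr -ltrBlDl subrr.
have : (V `&` (spectrum (@curvature_operator R) `&` `[- 16 * Num.sqrt (3 / pi), 0[)) (- 4 * symb (n.+1%:R^-1 : R)).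
  by split=> //; exact: mem.
rewrite VD /= => E.
have : symb (n.+1%:R^-1 : R) < symb 0 by apply: symb_lt; rewrite invr_gt0.
lra.
Qed.
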